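(* Hyperbolic Kepler billiards with center at the South pole $(0,0,-1)$ of $\mathcal H_S$, whose reflection wall is a combination of branches of confocal conic sections focused at the South pole, are conformally transformed, via the complex square mapping $\zeta\mapsto\zeta^2$ (the Hooke configuration being the preimage of the Kepler configuration), into the hemispherical Hooke billiards, respectively the hyperbolic Hooke billiards, with center at the South pole of the hemisphere, respectively of the hyperboloid, whose reflection wall is the corresponding combination of confocal conic sections centered at the South pole. Consequently the integrability of the hyperbolic Kepler billiards and that of the corresponding hemispherical/hyperbolic Hooke billiards are equivalent.
   Context: $\mathcal H_S=\{(x,y,z)\in\mathbb R^{2,1}:x^2+y^2-z^2=-1,\ z<0\}$ carries the hyperbolic metric induced by $dx^2+dy^2-dz^2$; $\mathcal S_{SH}$ is the open southern hemisphere ($z<0$) of the unit sphere in $\mathbb R^3$ with the round metric. Both are projected from the point $(0,0,1)$ to the unit disc $\mathcal D$ in $\{z=0\}\cong\mathbb C$; the metrics become $\frac{4}{(1+|q|^2)^2}dq\,d\bar q$ (sphere, stereographic chart) and $\frac{4}{(1-|q|^2)^2}dq\,d\bar q$ (hyperbolic plane, Poincar\'e disc), and the South pole $(0,0,-1)$ becomes $0$. The kinetic energies in these charts, with momentum $p$, are $\frac{(1+|q|^2)^2|p|^2}{8}$ (sphere) and $\frac{(1-|q|^2)^2|p|^2}{8}$ (hyperbolic). The force functions (negatives of potentials) are: spherical Hooke $-\frac{4f|q|^2}{(1-|q|^2)^2}$; hyperbolic Hooke $-\frac{4f|q|^2}{(1+|q|^2)^2}$; hyperbolic Kepler $\hat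 m\frac{1+|q|^2}{2|q|}$; with $f,\hat m\in\mathbb R$. A mechanical billiard consists of motion under such a natural mechanical system together with elastic reflection at a piecewise smooth wall (tangential velocity component kept, normal component changing sign). It is integrable if there is a first integral of the underlying system, invariant under the reflections and functionally independent of the total energy. The conformal transformation is the one induced by the square mapping on phase space, $(\zeta,w)\mapsto(q,p)=(\zeta^2,\,w/(2\bar\zeta))$. That one billiard system is conformally transformed into the other means: the system restricted to an energy hypersurface is related through this map, up to a time reparametrization, to the other system (with suitably related parameters) restricted to a corresponding energy hypersurface, with the reflection walls and the elastic reflection laws corresponding to each other. Conic sections with foci $F_1\ne F_2$ are, with $d$ the Riemannian distance, the ellipses $\{d(q,F_1)+d(q,F_2)=c\}$ and hyperbolas $\{|d(q,F_1)-d(q,F_2)|=c\}$ (with branches given by the sign of $d(q,F_1)-d(q,F_2)$). They are confocal if they share both foci, focused at the South pole if one focus is the South pole, and centered at the South pole if the midpoint of the foci is the South pole. A combination of such curves is a piecewise smooth curve whose smooth pieces each lie on one of the curves, with the same pair of foci. *)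

(* Defs.v *)
(* Stdlib real numbers with Coquelicot.

   Everything is expressed in the charts obtained by projecting from (0,0,1)
   onto the plane z = 0: the lower sheet of the hyperboloid and the open southern
   hemisphere both become the open unit disc, with the South pole (0,0,-1) at the
   origin, and the metrics become conformal, density(q)^2 |dq|^2. *)
From Stdlib Require Import Reals List.
From Coquelicot Require Import Coquelicot.
Open Scope R_scope.

Definition unit_disc (q : C) : Prop := Cmod q < 1.

Definition square (z : C) : C := (z * z)%C.

Definition velocity_of (g : R -> C) (t : R) : C :=
  (Derive (fun s => Re (g s)) t, Derive (fun s => Im (g s)) t).

Definition C1_on (I : R -> Prop) (g : R -> C) : Prop :=
  forall t, I t ->
    ex_derive (fun s => Re (g s)) t /\ ex_derive (fun s => Im (g s)) t /\
    continuous (velocity_of g) t.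

Definition curve_length (rho : C -> R) (g : R -> C) : R :=
  RInt (fun t => rho (g t) * Cmod (velocity_of g t)) 0 1.

Definition riem_dist (rho : C -> R) (a b : C) : R :=
  real (Glb_Rbar (fun l => exists g : R -> C,
    C1_on (fun t => 0 <= t <= 1) g /\ (forall t, 0 <= t <= 1 -> unit_disc (g t)) /\
    g 0 = a /\ g 1 = b /\ l = curve_length rho g)).

Definition midpoint (rho : C -> R) (M A B : C) : Prop :=
  riem_dist rho A M = riem_dist rho A B / 2 /\ riem_dist rho M B = riem_dist rho A B / 2.

Definition ellipse (rho : C -> R) (F1 F2 : C) (c : R) (q : C) : Prop :=
  unit_disc q /\ riem_dist rho q F1 + riem_dist rho q F2 = c.

Definition hyperbola (rho : C -> R) (F1 F2 : C) (c : R) (q : C) : Prop :=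
  unit_disc q /\ Rabs (riem_dist rho q F1 - riem_dist rho q F2) = c.

(* [c] and [-c] give the two branches of [hyperbola rho F1 F2 c]. *)
Definition hyperbola_branch (rho : C -> R) (F1 F2 : C) (c : R) (q : C) : Prop :=
  unit_disc q /\ riem_dist rho q F1 - riem_dist rho q F2 = c.

Definition conic (rho : C -> R) (F1 F2 : C) (X : C -> Prop) : Prop :=
  exists c, (forall q, X q <-> ellipse rho F1 F2 c q) \/
            (forall q, X q <-> hyperbola rho F1 F2 c q).

Definition conic_branch (rho : C -> R) (F1 F2 : C) (X : C -> Prop) : Prop :=
  exists c, (forall q, X q <-> ellipse rho F1 F2 c q) \/
            (forall q, X q <-> hyperbola_branch rho F1 F2 c q).

Definition open_unit (t : R) : Prop := 0 < t < 1.

(* [W] consists of finitely many regular open arcs, each lying on one curve of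
   the family, together with finitely many vertices. *)
Definition combination (family : (C -> Prop) -> Prop) (W : C -> Prop) : Prop :=
  exists (arcs : list (R -> C)) (vertices : list C),
    (forall g, In g arcs ->
       C1_on open_unit g /\ (forall t, open_unit t -> velocity_of g t <> 0%C) /\
       exists X, family X /\ forall t, open_unit t -> X (g t)) /\
    (forall v, In v vertices -> exists X, family X /\ X v) /\
    (forall q, W q <->
       (exists g t, In g arcs /\ open_unit t /\ q = g t) \/ In q vertices).

(* A wall has no tangent vectors at its endpoints and corners, so
   that no reflection is defined there. *)
Definition tangent (W : C -> Prop) (q tau : C) : Prop :=
  tau <> 0%C /\
  exists (eps : R) (g : R -> C),
    0 < eps /\ C1_on (fun t => - eps < t < eps) g /\
    g 0 = q /\ velocity_of g 0 = tau /\
    (forall t, - eps < t < eps -> W (g t)).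

Definition state : Type := (C * C)%type.

(* [force] is the force function, that is, minus the potential. *)
Record mechanics : Type := Mechanics {
  config : C -> Prop;
  density : C -> R;
  kinetic : state -> R;
  force : C -> R
}.

Definition phase (S : mechanics) (x : state) : Prop := config S (fst x).

Definition energy (S : mechanics) (x : state) : R :=
  kinetic S x - force S (fst x).

Definition metric (S : mechanics) (q u v : C) : R :=
  (density S q)^2 * (Re u * Re v + Im u * Im v).

Definition hyperbolic_density (q : C) : R := 2 / (1 - Cmod q ^ 2).

Definition spherical_density (q : C) : R := 2 / (1 + Cmod q ^ 2).

Definition hyperbolic_kinetic (x : state) : R :=
  (1 - Cmod (fst x) ^ 2)^2 * Cmod (snd x) ^ 2 / 8.

Definition spherical_kinetic (x : state) : R :=
  (1 + Cmod (fst x) ^ 2)^2 * Cmod (snd x) ^ 2 / 8.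

Definition hyperbolic_Kepler (m : R) : mechanics :=
  {| config := fun q => unit_disc q /\ q <> 0%C;
     density := hyperbolic_density;
     kinetic := hyperbolic_kinetic;
     force := fun q => m * ((1 + Cmod q ^ 2) / (2 * Cmod q)) |}.

Definition spherical_Hooke (f : R) : mechanics :=
  {| config := unit_disc;
     density := spherical_density;
     kinetic := spherical_kinetic;
     force := fun q => - (4 * f * Cmod q ^ 2 / (1 - Cmod q ^ 2)^2) |}.

Definition hyperbolic_Hooke (f : R) : mechanics :=
  {| config := unit_disc;
     density := hyperbolic_density;
     kinetic := hyperbolic_kinetic;
     force := fun q => - (4 * f * Cmod q ^ 2 / (1 + Cmod q ^ 2)^2) |}.

(* A pair (u1, u2) of real partial derivatives is identified with u1 + i u2. *)
Definition grad_q (G : state -> R) (x : state) : C :=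
  (Derive (fun s => G ((s, Im (fst x)), snd x)) (Re (fst x)),
   Derive (fun s => G ((Re (fst x), s), snd x)) (Im (fst x))).

Definition grad_p (G : state -> R) (x : state) : C :=
  (Derive (fun s => G (fst x, (s, Im (snd x)))) (Re (snd x)),
   Derive (fun s => G (fst x, (Re (snd x), s))) (Im (snd x))).

Definition has_velocity (g : R -> C) (t : R) (v : C) : Prop :=
  is_derive (fun s => Re (g s)) t (Re v) /\
  is_derive (fun s => Im (g s)) t (Im v).

Definition is_open_interval (I : R -> Prop) : Prop :=
  open I /\ forall s t u, I s -> I u -> s <= t <= u -> I t.

Definition motion (S : mechanics) (I : R -> Prop) (x : R -> state) : Prop :=
  is_open_interval I /\
  forall t, I t ->
    phase S (x t) /\
    has_velocity (fun s => fst (x s)) t (grad_p (energy S) (x t)) /\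
    has_velocity (fun s => snd (x s)) t (- grad_q (energy S) (x t))%C.

(* [x] on [I] is a motion up to a change of the time parameter. *)
Definition reparametrized_motion (S : mechanics) (I : R -> Prop)
    (x : R -> state) : Prop :=
  exists (sigma : R -> R) (J : R -> Prop) (y : R -> state),
    (forall t, I t -> exists l, 0 < l /\ is_derive sigma t l) /\
    (forall s, J s <-> exists t, I t /\ s = sigma t) /\
    motion S J y /\
    (forall t, I t -> x t = y (sigma t)).

(* The velocity of a state with momentum p is dq/dt = dH/dp. *)
Definition elastic (S : mechanics) (W : C -> Prop) (x x' : state) : Prop :=
  phase S x /\ fst x' = fst x /\ W (fst x) /\
  exists tau, tangent W (fst x) tau /\
    let v := grad_p (energy S) x in
    let v' := grad_p (energy S) x' in
    metric S (fst x) v' tau = metric S (fst x) v tau /\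
    forall n, metric S (fst x) n tau = 0 ->
      metric S (fst x) v' n = - metric S (fst x) v n.

Definition C1_phase (S : mechanics) (G : state -> R) : Prop :=
  forall x, phase S x ->
    ex_derive (fun s => G ((s, Im (fst x)), snd x)) (Re (fst x)) /\
    ex_derive (fun s => G ((Re (fst x), s), snd x)) (Im (fst x)) /\
    ex_derive (fun s => G (fst x, (s, Im (snd x)))) (Re (snd x)) /\
    ex_derive (fun s => G (fst x, (Re (snd x), s))) (Im (snd x)) /\
    continuous (grad_q G) x /\ continuous (grad_p G) x.

Definition first_integral (S : mechanics) (G : state -> R) : Prop :=
  forall I x, motion S I x -> forall s t, I s -> I t -> G (x s) = G (x t).

Definition independent_at (G H : state -> R) (x : state) : Prop :=
  forall alpha beta : R,
    (alpha * grad_q G x + beta * grad_q H x = 0)%C ->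
    (alpha * grad_p G x + beta * grad_p H x = 0)%C ->
    alpha = 0 /\ beta = 0.

(* The differentials are linearly independent on a dense subset of phase space. *)
Definition functionally_independent (S : mechanics) (G H : state -> R) : Prop :=
  forall x, phase S x -> forall eps, 0 < eps ->
    exists y, phase S y /\ Cmod (fst y - fst x) < eps /\
      Cmod (snd y - snd x) < eps /\ independent_at G H y.

Definition integrable (S : mechanics) (W : C -> Prop) : Prop :=
  exists G : state -> R,
    C1_phase S G /\
    first_integral S G /\
    (forall x x', elastic S W x x' -> G x' = G x) /\
    functionally_independent S G (energy S).

(* The cotangent lift of the square, on pairs (position, momentum). *)
Definition square_map (x : state) : state :=
  (square (fst x), (snd x / (2 * Cconj (fst x)))%C).

Definition preimage (X : C -> Prop) (z : C) : Prop := unit_disc z /\ X (square z).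

(* The billiard (K, WK) on the energy level e is transformed into the billiard
   (H, WH) on the energy level h.  The configuration point 0 of H, which is
   the preimage of the center excluded from K, has to be removed. *)
Record conformally_transformed (K : mechanics) (WK : C -> Prop) (e : R)
    (H : mechanics) (WH : C -> Prop) (h : R) : Prop := {
  ct_phase : forall x, phase H x -> fst x <> 0%C -> phase K (square_map x);
  ct_onto : forall y, phase K y ->
    exists x, phase H x /\ fst x <> 0%C /\ square_map x = y;
  ct_energy : forall x, phase H x -> fst x <> 0%C ->
    (energy H x = h <-> energy K (square_map x) = e);
  ct_push : forall I x, motion H I x ->
    (forall t, I t -> fst (x t) <> 0%C /\ energy H (x t) = h) ->
    reparametrized_motion K I (fun t => square_map (x t));
  ct_lift : forall I y, motion K I y ->
    (forall t, I t -> energy K (y t) = e) ->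
    forall t0 x0, I t0 -> phase H x0 -> square_map x0 = y t0 ->
    exists x, x t0 = x0 /\ (forall t, I t -> square_map (x t) = y t) /\
      reparametrized_motion H I x;
  ct_wall : forall z, config H z -> (WH z <-> WK (square z));
  ct_elastic : forall x x', phase H x -> fst x <> 0%C -> fst x' = fst x ->
    (elastic H WH x x' <-> elastic K WK (square_map x) (square_map x'))
}.

(* Main.v *)
(* Writing q = z^2, F = a^2, Z = |q - F| and Y = |1 - conj F q|, one has Y = |1 - conj a z| |1 + conj a z|
   and Z = |z - a| |z + a|.  By the half-angle formulas, the sum and the difference of the hyperbolic
   distances from q to 0 and F are functions of (Y - Z) / (1 + |q|) and (Y + Z) / (1 + |q|), and so are,
   by the addition formulas, the sum and the absolute difference of the distances from z to a and - a,
   both on the sphere and on the hyperbolic plane.  Hence the two families of conics correspond.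
   The square map pulls the Kepler Hamiltonian minus its energy back to the Hooke Hamiltonian minus its
   energy, up to a positive factor, which is the change of time.
   A first integral of one system at all energies is not a first integral of the other, because the force
   constant f depends on the energy e; the integrability statements are equivalent because both hold.
   The integrals are quadratic in the momentum, and they are invariant under reflections because
   the conics are the trajectories of the quadratic differential dq^2 / (q (F - q) (1 - conj F q)). *)
Require Import Defs.
From Stdlib Require Import Reals List.
From Coquelicot Require Import Coquelicot.
From Stdlib Require Import Lra Classical FunctionalExtensionality IndefiniteDescription Ranalysis5.
Open Scope R_scope.

(** * Complex-valued functions *)


(** Two obstacles shape the proof. The distances are infima over curves, so they must first be
    computed: a Möbius isometry moves one end to 0, where a function of the radius bounds all
    lengths from below. The wall is only a finite union of arcs and points, and a tangent vector is
    the velocity of any C1 curve inside it; such a curve may pass infinitely often from one conic to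
    another, and an accumulation argument singles out one conic. The resulting relation for the
    velocity degenerates in two places, on the axis through 0 and F, which contains the degenerate
    conics, and over the center, where the square map is not a local diffeomorphism. There the
    continuity of the velocity takes over. The sphere and the hyperbolic plane are treated together
    by means of a sign s with s * s = 1. *)

Lemma C_ext (z w : C) : Re z = Re w -> Im z = Im w -> z = w.
Proof. destruct z, w; simpl; intros -> ->; reflexivity. Qed.

Lemma C_neq0 (z : C) : z <> 0%C -> 0 < Re z ^ 2 + Im z ^ 2.
Proof.
  intros H. rewrite <- Cmod2_alt. apply pow_lt. now apply Cmod_gt_0.
Qed.

Lemma unit_disc_iff (z : C) : unit_disc z <-> Re z ^ 2 + Im z ^ 2 < 1.
Proof.
  unfold unit_disc. rewrite <- Cmod2_alt. pose proof (Cmod_ge_0 z). split; intros; nra.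
Qed.

Lemma unit_disc_square (z : C) : unit_disc (square z) <-> unit_disc z.
Proof.
  unfold unit_disc, square. rewrite Cmod_mult. pose proof (Cmod_ge_0 z). split; intros; nra.
Qed.

Lemma square_neq0 (z : C) : z <> 0%C -> square z <> 0%C.
Proof. intros H. now apply Cmult_neq_0. Qed.

Lemma Cconj_neq0 (z : C) : z <> 0%C -> Cconj z <> 0%C.
Proof. intros H. apply Cmod_gt_0. rewrite Cmod_conj. now apply Cmod_gt_0. Qed.

Lemma C2_neq0 : (2 : C) <> 0%C.
Proof. intros H. apply RtoC_inj in H. lra. Qed.

Lemma square_eq (z w : C) : square z = square w -> z = w \/ z = (- w)%C.
Proof.
  intros H. destruct (classic (z = w)) as [|Hn]; [now left|right].
  assert (E : ((z - w) * (z + w) = 0)%C).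
  { replace ((z - w) * (z + w))%C with (square z - square w)%C by (unfold square; ring).
    rewrite H. ring. }
  destruct (classic (z + w = 0)%C) as [Hs|Hs].
  - replace z with (z + w - w)%C by ring. rewrite Hs. ring.
  - exfalso. apply (Cmult_neq_0 (z - w) (z + w)); auto.
    intros Hz. apply Hn. replace z with (z - w + w)%C by ring. rewrite Hz. ring.
Qed.

Lemma square_surjective (q : C) : exists z, square z = q.
Proof.
  pose proof (Cmod2_alt q) as HM. pose proof (re_le_Cmod q) as HR.
  pose proof (Cmod_ge_0 q) as H0.
  destruct q as [x y]; simpl in *. set (r := Cmod (x, y)) in *. clearbody r.
  apply Rabs_le_between in HR.
  (* Half-angle formulas for the parts of a square root. They determine [u * v] only up to sign,
     hence the case distinction on [y]. *)
  set (u := sqrt ((r + x) / 2)). set (v := sqrt ((r - x) / 2)).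
  assert (Hu : u * u = (r + x) / 2) by (apply sqrt_sqrt; lra).
  assert (Hv : v * v = (r - x) / 2) by (apply sqrt_sqrt; lra).
  assert (Huv : u * v = Rabs y / 2).
  { unfold u, v. rewrite <- sqrt_mult by lra.
    replace ((r + x) / 2 * ((r - x) / 2)) with (Rsqr (y / 2)) by (unfold Rsqr; nra).
    rewrite sqrt_Rsqr_abs. unfold Rdiv. rewrite Rabs_mult. rewrite (Rabs_pos_eq (/ 2)); lra. }
  destruct (Rle_dec 0 y).
  - rewrite Rabs_pos_eq in Huv by lra. exists (u, v). apply C_ext; simpl; lra.
  - rewrite Rabs_left in Huv by lra. exists (u, - v). apply C_ext; simpl; lra.
Qed.

(** * Continuity of real and complex expressions *)

Lemma continuous_C {U : UniformSpace} (f : U -> C) (x : U) :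
  continuous (fun y => Re (f y)) x -> continuous (fun y => Im (f y)) x -> continuous f x.
Proof.
  intros H1 H2. apply continuous_ext with (fun y => (Re (f y), Im (f y)) : C).
  - intros y. now destruct (f y).
  - apply filterlim_locally. intros eps.
    pose proof (proj1 (filterlim_locally _ _) H1 eps) as L1.
    pose proof (proj1 (filterlim_locally _ _) H2 eps) as L2.
    generalize (filter_and _ _ L1 L2). apply filter_imp. intros y [B1 B2]. now split.
Qed.

Lemma continuous_Re {U : UniformSpace} (f : U -> C) (x : U) :
  continuous f x -> continuous (fun y => Re (f y)) x.
Proof. intros H. apply (continuous_comp f fst); [exact H|apply continuous_fst]. Qed.

Lemma continuous_Im {U : UniformSpace} (f : U -> C) (x : U) :
  continuous f x -> continuous (fun y => Im (f y)) x.
Proof. intros H. apply (continuous_comp f snd); [exact H|apply continuous_snd]. Qed.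

Lemma continuous_fst_comp {U V W : UniformSpace} (f : U -> V * W) (x : U) :
  continuous f x -> continuous (fun y => fst (f y)) x.
Proof. intros H. apply (continuous_comp f fst); [exact H|apply continuous_fst]. Qed.

Lemma continuous_snd_comp {U V W : UniformSpace} (f : U -> V * W) (x : U) :
  continuous f x -> continuous (fun y => snd (f y)) x.
Proof. intros H. apply (continuous_comp f snd); [exact H|apply continuous_snd]. Qed.

Section RealContinuity.
Context {U : UniformSpace}.
Implicit Types (f g : U -> R) (x : U).

Lemma continuous_Rplus f g x :
  continuous f x -> continuous g x -> continuous (fun y => f y + g y) x.
Proof. intros. now apply (continuous_plus (V := R_NormedModule)). Qed.

Lemma continuous_Ropp f x : continuous f x -> continuous (fun y => - f y) x.
Proof. intros. now apply (continuous_opp (V := R_NormedModule)). Qed.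

Lemma continuous_Rminus f g x :
  continuous f x -> continuous g x -> continuous (fun y => f y - g y) x.
Proof. intros. now apply (continuous_minus (V := R_NormedModule)). Qed.

Lemma continuous_Rmult f g x :
  continuous f x -> continuous g x -> continuous (fun y => f y * g y) x.
Proof. intros. now apply (continuous_mult (K := R_AbsRing)). Qed.

Lemma continuous_Rpow f x n : continuous f x -> continuous (fun y => f y ^ n) x.
Proof.
  intros H. induction n; simpl.
  - apply continuous_const.
  - now apply continuous_Rmult.
Qed.

Lemma continuous_Rdiv f g x :
  continuous f x -> continuous g x -> g x <> 0 -> continuous (fun y => f y / g y) x.
Proof.
  intros H1 H2 H3. apply continuous_Rmult; [exact H1|].
  apply (continuous_comp g Rinv); [exact H2|now apply continuous_Rinv].
Qed.

Lemma continuous_Rsqrt f x : continuous f x -> continuous (fun y => sqrt (f y)) x.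
Proof. intros H. apply (continuous_comp f sqrt); [exact H|apply continuous_sqrt]. Qed.
End RealContinuity.

Ltac real_cont :=
  lazymatch goal with
  | H : continuous ?f ?x |- continuous ?f ?x => exact H
  | |- continuous (fun y => @?f y + @?g y) _ => apply (continuous_Rplus f g); real_cont
  | |- continuous (fun y => @?f y - @?g y) _ => apply (continuous_Rminus f g); real_cont
  | |- continuous (fun y => @?f y * @?g y) _ => apply (continuous_Rmult f g); real_cont
  | |- continuous (fun y => @?f y / @?g y) _ => apply (continuous_Rdiv f g); real_cont
  | |- continuous (fun y => - @?f y) _ => apply (continuous_Ropp f); real_cont
  | |- continuous (fun y => @?f y ^ ?n) _ => apply (continuous_Rpow f _ n); real_cont
  | |- continuous (fun y => sqrt (@?f y)) _ => apply (continuous_Rsqrt f); real_cont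
  | |- continuous (fun y => Re (@?f y)) _ => apply (continuous_Re f); real_cont
  | |- continuous (fun y => Im (@?f y)) _ => apply (continuous_Im f); real_cont
  | |- continuous (fun y => fst (@?f y)) _ => apply (continuous_fst_comp f); real_cont
  | |- continuous (fun y => snd (@?f y)) _ => apply (continuous_snd_comp f); real_cont
  | |- continuous (fun y => y) _ => apply continuous_id
  | |- continuous (fun _ => ?c) _ => apply continuous_const
  | |- continuous _ _ => try assumption
  | |- _ => idtac
  end.

Section ComplexContinuity.
Context {U : UniformSpace}.
Implicit Types (f g : U -> C) (x : U).

Lemma continuous_Cmod f x : continuous f x -> continuous (fun y => Cmod (f y)) x.
Proof.
  intros H. apply continuous_ext with (fun y => sqrt (Re (f y) ^ 2 + Im (f y) ^ 2)).
  - intros y. now destruct (f y).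
  - real_cont.
Qed.

Lemma continuous_Cplus f g x :
  continuous f x -> continuous g x -> continuous (fun y => (f y + g y)%C) x.
Proof. intros. apply continuous_C; simpl; real_cont. Qed.

Lemma continuous_Cminus f g x :
  continuous f x -> continuous g x -> continuous (fun y => (f y - g y)%C) x.
Proof.
  intros. apply continuous_C; simpl; apply continuous_Rplus; try apply continuous_Ropp; real_cont.
Qed.

Lemma continuous_Cmult f g x :
  continuous f x -> continuous g x -> continuous (fun y => (f y * g y)%C) x.
Proof. intros. apply continuous_C; simpl; real_cont. Qed.

Lemma continuous_Copp f x : continuous f x -> continuous (fun y => (- f y)%C) x.
Proof. intros. apply continuous_C; simpl; real_cont. Qed.

Lemma continuous_Cconj f x : continuous f x -> continuous (fun y => Cconj (f y)) x.
Proof. intros. apply continuous_C; simpl; real_cont. Qed.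

Lemma continuous_RtoC (f : U -> R) x : continuous f x -> continuous (fun y => RtoC (f y)) x.
Proof. intros. apply continuous_C; simpl; real_cont. Qed.

Lemma continuous_Cdiv f g x :
  continuous f x -> continuous g x -> g x <> 0%C -> continuous (fun y => (f y / g y)%C) x.
Proof.
  intros Hf Hg H0. unfold Cdiv. apply continuous_Cmult; [exact Hf|].
  pose proof (C_neq0 _ H0) as Hp. unfold Re, Im in Hp. simpl in Hp.
  apply continuous_C; simpl; real_cont; lra.
Qed.
End ComplexContinuity.

Ltac complex_cont :=
  lazymatch goal with
  | H : continuous ?f ?x |- continuous ?f ?x => exact H
  | |- continuous (fun y => Cplus (@?f y) (@?g y)) _ => apply (continuous_Cplus f g); complex_cont
  | |- continuous (fun y => Cminus (@?f y) (@?g y)) _ => apply (continuous_Cminus f g); complex_cont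
  | |- continuous (fun y => Cmult (@?f y) (@?g y)) _ => apply (continuous_Cmult f g); complex_cont
  | |- continuous (fun y => Cdiv (@?f y) (@?g y)) _ => apply (continuous_Cdiv f g); complex_cont
  | |- continuous (fun y => Copp (@?f y)) _ => apply (continuous_Copp f); complex_cont
  | |- continuous (fun y => Cconj (@?f y)) _ => apply (continuous_Cconj f); complex_cont
  | |- continuous (fun y => RtoC (@?f y)) _ => apply (continuous_RtoC f); complex_cont
  | |- continuous (fun y => Cmod (@?f y)) _ => apply (continuous_Cmod f); complex_cont
  | |- continuous (fun y => fst (@?f y)) _ => apply (continuous_fst_comp f); complex_cont
  | |- continuous (fun y => snd (@?f y)) _ => apply (continuous_snd_comp f); complex_cont
  | |- continuous (fun y => y) _ => apply continuous_id
  | |- continuous (fun _ => ?c) _ => apply continuous_const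
  | |- continuous (fun y => @?f y + @?g y) _ => apply (continuous_Rplus f g); complex_cont
  | |- continuous (fun y => @?f y - @?g y) _ => apply (continuous_Rminus f g); complex_cont
  | |- continuous (fun y => @?f y * @?g y) _ => apply (continuous_Rmult f g); complex_cont
  | |- continuous (fun y => @?f y / @?g y) _ => apply (continuous_Rdiv f g); complex_cont
  | |- continuous (fun y => - @?f y) _ => apply (continuous_Ropp f); complex_cont
  | |- continuous (fun y => @?f y ^ ?n) _ => apply (continuous_Rpow f _ n); complex_cont
  | |- continuous (fun y => sqrt (@?f y)) _ => apply (continuous_Rsqrt f); complex_cont
  | |- continuous (fun y => Re (@?f y)) _ => apply (continuous_Re f); complex_cont
  | |- continuous (fun y => Im (@?f y)) _ => apply (continuous_Im f); complex_cont
  | |- continuous _ _ => try assumption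
  | |- _ => idtac
  end.

Lemma locally_neq0 {U : UniformSpace} (f : U -> C) (x : U) :
  continuous f x -> f x <> 0%C -> locally x (fun y => f y <> 0%C).
Proof.
  intros H H0. apply Cmod_gt_0 in H0.
  pose proof (continuous_Cmod f x H) as Hc.
  assert (L : locally (Cmod (f x)) (fun r => 0 < r)) by now apply (open_gt 0).
  apply (filter_imp (F := locally x) (fun y => 0 < Cmod (f y))); [|exact (Hc _ L)].
  intros y. apply Cmod_gt_0.
Qed.

(** * Velocities of plane curves *)

Lemma has_velocity_velocity_of (g : R -> C) (t : R) (v : C) :
  has_velocity g t v -> velocity_of g t = v.
Proof.
  intros [H1 H2]. unfold velocity_of.
  apply C_ext; simpl; now apply is_derive_unique.
Qed.

Lemma has_velocity_continuous (g : R -> C) (t : R) (v : C) :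
  has_velocity g t v -> continuous g t.
Proof.
  intros [H1 H2]. apply continuous_C.
  - apply (ex_derive_continuous (V := R_NormedModule) (fun s => Re (g s))).
    eexists; eassumption.
  - apply (ex_derive_continuous (V := R_NormedModule) (fun s => Im (g s))).
    eexists; eassumption.
Qed.

Lemma C1_on_has_velocity (I : R -> Prop) (g : R -> C) (t : R) :
  C1_on I g -> I t -> has_velocity g t (velocity_of g t).
Proof. intros H Ht. destruct (H t Ht) as (H1 & H2 & _). split; now apply Derive_correct. Qed.

Lemma C1_on_intro (I : R -> Prop) (g v : R -> C) :
  (forall t, I t -> locally t (fun s => has_velocity g s (v s))) ->
  (forall t, I t -> continuous v t) -> C1_on I g.
Proof.
  intros H Hv t Ht. destruct (locally_singleton _ _ (H t Ht)) as [H1 H2].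
  split; [eexists; exact H1|split; [eexists; exact H2|]].
  apply continuous_ext_loc with v; [|now apply Hv].
  generalize (H t Ht). apply filter_imp. intros s Hs. symmetry. now apply has_velocity_velocity_of.
Qed.

Lemma has_velocity_eq (g : R -> C) (t : R) (v w : C) :
  has_velocity g t v -> v = w -> has_velocity g t w.
Proof. now intros H <-. Qed.

Lemma is_derive_eq (f : R -> R) (t l k : R) : is_derive f t l -> l = k -> is_derive f t k.
Proof. now intros H <-. Qed.

Lemma has_velocity_const (c : C) (t : R) : has_velocity (fun _ => c) t 0%C.
Proof. split; apply (is_derive_const (V := R_NormedModule)). Qed.

Lemma has_velocity_RtoC (f : R -> R) (t d : R) :
  is_derive f t d -> has_velocity (fun s => RtoC (f s)) t (RtoC d).
Proof. intros H. split; [exact H|].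
  change (is_derive (fun _ : R => 0) t 0). apply (is_derive_const (V := R_NormedModule)). Qed.

Lemma is_derive_Rmult (f g : R -> R) (t a b : R) :
  is_derive f t a -> is_derive g t b -> is_derive (fun s => f s * g s) t (a * g t + f t * b).
Proof. intros. apply (is_derive_mult f g t a b); auto. intros; apply Rmult_comm. Qed.

Lemma is_derive_Rplus (f g : R -> R) (t a b : R) :
  is_derive f t a -> is_derive g t b -> is_derive (fun s => f s + g s) t (a + b).
Proof. intros. now apply (is_derive_plus (V := R_NormedModule)). Qed.

Lemma is_derive_Rminus (f g : R -> R) (t a b : R) :
  is_derive f t a -> is_derive g t b -> is_derive (fun s => f s - g s) t (a - b).
Proof. intros. now apply (is_derive_minus (V := R_NormedModule)). Qed.

Lemma is_derive_Ropp (f : R -> R) (t a : R) :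
  is_derive f t a -> is_derive (fun s => - f s) t (- a).
Proof. intros. now apply (is_derive_opp (V := R_NormedModule)). Qed.

Section VelocityRules.
Variables (f g : R -> C) (t : R) (u v : C).
Hypothesis (Hf : has_velocity f t u) (Hg : has_velocity g t v).

Lemma has_velocity_plus : has_velocity (fun s => f s + g s)%C t (u + v)%C.
Proof. destruct Hf, Hg. split; simpl; now apply is_derive_Rplus. Qed.

Lemma has_velocity_minus : has_velocity (fun s => f s - g s)%C t (u - v)%C.
Proof. destruct Hf, Hg. split; simpl; now apply is_derive_Rminus. Qed.

Lemma has_velocity_conj : has_velocity (fun s => Cconj (f s)) t (Cconj u).
Proof. destruct Hf. split; simpl; [assumption|now apply is_derive_Ropp]. Qed.

Lemma has_velocity_mult : has_velocity (fun s => f s * g s)%C t (u * g t + f t * v)%C.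
Proof.
  destruct Hf, Hg. split; simpl.
  - eapply is_derive_eq; [apply is_derive_Rminus; apply is_derive_Rmult; eassumption|].
    unfold Re, Im in *; simpl in *; ring.
  - eapply is_derive_eq; [apply is_derive_Rplus; apply is_derive_Rmult; eassumption|].
    unfold Re, Im in *; simpl in *; ring.
Qed.

Lemma has_velocity_div : g t <> 0%C ->
  has_velocity (fun s => f s / g s)%C t ((u * g t - f t * v) / (g t * g t))%C.
Proof.
  intros H0. pose proof (C_neq0 _ H0) as Hp. destruct Hf as [F1 F2], Hg as [G1 G2].
  assert (D : is_derive (fun s => Re (g s) ^ 2 + Im (g s) ^ 2) t
     (2 * (Re v * Re (g t) + Im v * Im (g t)))).
  { eapply is_derive_ext with (fun s => Re (g s) * Re (g s) + Im (g s) * Im (g s)).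
    - intros s; simpl; ring.
    - eapply is_derive_eq; [apply is_derive_Rplus; apply is_derive_Rmult; eassumption|].
      cbv beta; ring. }
  split.
  - eapply is_derive_ext with (fun s => (Re (f s) * Re (g s) + Im (f s) * Im (g s)) /
       (Re (g s) ^ 2 + Im (g s) ^ 2)).
    + intros s. simpl. unfold Re, Im, Rdiv. simpl. ring.
    + eapply is_derive_eq;
       [apply is_derive_div; [apply is_derive_Rplus; apply is_derive_Rmult; eassumption|exact D|lra]|].
      clear F1 F2 G1 G2 D. cbv beta.
      destruct (f t), (g t), u, v; unfold Re, Im in *; simpl in *. field. nra.
  - eapply is_derive_ext with (fun s => (Im (f s) * Re (g s) - Re (f s) * Im (g s)) /
       (Re (g s) ^ 2 + Im (g s) ^ 2)).
    + intros s. simpl. unfold Re, Im, Rdiv. simpl. ring.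
    + eapply is_derive_eq;
       [apply is_derive_div; [apply is_derive_Rminus; apply is_derive_Rmult; eassumption|exact D|lra]|].
      clear F1 F2 G1 G2 D. cbv beta.
      destruct (f t), (g t), u, v; unfold Re, Im in *; simpl in *. field. nra.
Qed.
End VelocityRules.

Lemma has_velocity_scal (a : R -> R) (f : R -> C) (t d : R) (v : C) :
  is_derive a t d -> has_velocity f t v ->
  has_velocity (fun s => a s * f s)%C t (d * f t + a t * v)%C.
Proof.
  intros Ha Hf. apply (has_velocity_mult (fun s => RtoC (a s)) f t d v);
    [now apply has_velocity_RtoC|exact Hf].
Qed.

Lemma has_velocity_comp (f : R -> C) (s : R -> R) (t d : R) (v : C) :
  has_velocity f (s t) v -> is_derive s t d -> has_velocity (fun r => f (s r)) t (d * v)%C.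
Proof.
  intros [H1 H2] Hs. split.
  - eapply is_derive_eq;
     [apply (is_derive_comp (fun r => Re (f r)) s); eassumption|];
     unfold scal; simpl; unfold mult, Re, Im; simpl; ring.
  - eapply is_derive_eq;
     [apply (is_derive_comp (fun r => Im (f r)) s); eassumption|];
     unfold scal; simpl; unfold mult, Re, Im; simpl; ring.
Qed.

Lemma is_derive_Cmod_sqr (f : R -> C) (t : R) (v : C) :
  has_velocity f t v ->
  is_derive (fun s => Cmod (f s) ^ 2) t (2 * (Re (f t) * Re v + Im (f t) * Im v)).
Proof.
  intros [H1 H2]. apply is_derive_ext with (fun s => Re (f s) * Re (f s) + Im (f s) * Im (f s)).
  - intros s. rewrite Cmod2_alt. simpl; ring.
  - eapply is_derive_eq; [apply is_derive_Rplus; apply is_derive_Rmult; eassumption|].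
    cbv beta; ring.
Qed.

Lemma is_derive_Cmod (f : R -> C) (t : R) (v : C) :
  has_velocity f t v -> f t <> 0%C ->
  is_derive (fun s => Cmod (f s)) t ((Re (f t) * Re v + Im (f t) * Im v) / Cmod (f t)).
Proof.
  intros H H0. apply Cmod_gt_0 in H0. pose proof (is_derive_Cmod_sqr _ _ _ H) as D.
  apply is_derive_ext with (fun s => sqrt (Cmod (f s) ^ 2)).
  - intros s. apply sqrt_pow2, Cmod_ge_0.
  - eapply is_derive_eq; [apply is_derive_sqrt; [exact D|now apply pow_lt]|].
    cbv beta. rewrite sqrt_pow2 by lra. field. lra.
Qed.

Lemma zero_derivative_const (f : R -> R) (a b : R) :
  (forall t, Rmin a b <= t <= Rmax a b -> is_derive f t 0) -> f a = f b.
Proof.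
  intros H. destruct (MVT_gen f a b (fun _ => 0)) as (c & _ & E).
  - intros; apply H; lra.
  - intros x Hx. apply continuity_pt_filterlim.
    apply (ex_derive_continuous (V := R_NormedModule) f). eexists. now apply H.
  - lra.
Qed.

(** * Riemannian distances *)


(** A calibration argument: a function of the position whose rate of change along every curve is at
    most the speed bounds the length from below by its increment. Both radial estimates have this
    form. *)
Lemma increment_le_RInt (psi dpsi sp : R -> R) :
  (forall t, 0 <= t <= 1 -> is_derive psi t (dpsi t)) ->
  (forall t, 0 <= t <= 1 -> dpsi t <= sp t) ->
  (forall t, 0 <= t <= 1 -> continuous sp t) ->
  psi 1 - psi 0 <= RInt sp 0 1.
Proof.
  intros Hd Hle Hc.
  (* Freezing the speed outside [0, 1] makes its primitive differentiable at the endpoints. *)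
  set (cl := fun t => Rmax 0 (Rmin 1 t)).
  assert (Hcl : forall t, 0 <= cl t <= 1).
  { intros t. unfold cl. split; [apply Rmax_l|]. apply Rmax_lub; [lra|apply Rmin_l]. }
  assert (Hid : forall t, 0 <= t <= 1 -> cl t = t).
  { intros t Ht. unfold cl. rewrite Rmin_right, Rmax_right; lra. }
  assert (Hclc : forall t, continuous cl t).
  { intros t. apply continuity_pt_filterlim.
    intros e He. exists e. split; [exact He|]. intros x [_ Hx]. simpl in *. unfold R_dist in *.
    apply Rle_lt_trans with (2 := Hx). unfold cl, Rmax, Rmin.
    repeat destruct Rle_dec; unfold Rabs; repeat destruct Rcase_abs; lra. }
  assert (Hspc : forall t, continuous (fun t => sp (cl t)) t).
  { intros t. apply (continuous_comp cl sp); [apply Hclc|apply Hc, Hcl]. }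
  rewrite (RInt_ext sp (fun t => sp (cl t))).
  2:{ intros t Ht. rewrite Rmin_left, Rmax_right in Ht by lra. rewrite Hid; lra. }
  set (L := fun t => RInt (fun t => sp (cl t)) 0 t).
  assert (HL : forall t, is_derive L t (sp (cl t))).
  { intros t. apply (is_derive_RInt (fun t => sp (cl t)) L 0 t); [|apply Hspc].
    apply filter_forall. intros b. apply (RInt_correct (V := R_CompleteNormedModule)).
    apply (ex_RInt_continuous (V := R_CompleteNormedModule)). intros; apply Hspc. }
  destruct (MVT_gen (fun t => L t - psi t) 0 1 (fun t => sp (cl t) - dpsi t))
    as (c & Hc1 & E); rewrite Rmin_left, Rmax_right in * by lra.
  - intros x Hx. apply (is_derive_Rminus L psi); [apply HL|apply Hd; lra].
  - intros x Hx. apply continuity_pt_filterlim.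
    apply (ex_derive_continuous (V := R_NormedModule) (fun t => L t - psi t)). eexists.
    apply (is_derive_Rminus L psi); [apply HL|apply Hd; lra].
  - pose proof (Hle c Hc1). rewrite Hid in E by assumption.
    assert (HL0 : L 0 = 0) by (unfold L; now rewrite RInt_point).
    fold (L 1). lra.
Qed.

(** The metric of curvature [s] in the stereographic chart. With [s] kept as a variable subject to
    [s * s = 1], one argument serves both surfaces. *)
Definition curvature_density (s : R) (q : C) : R := 2 / (1 + s * Cmod q ^ 2).

Lemma spherical_density_curvature : spherical_density = curvature_density 1.
Proof.
  apply functional_extensionality. intros q. unfold spherical_density, curvature_density.
  f_equal. ring.
Qed.

Lemma hyperbolic_density_curvature : hyperbolic_density = curvature_density (-1).
Proof.
  apply functional_extensionality. intros q. unfold hyperbolic_density, curvature_density.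
  f_equal. ring.
Qed.

(* For [s = 1] (sphere) and [s = -1] (hyperbolic plane) this is the isometry taking [b] to [0]. *)
Definition mobius (s : R) (b q : C) : C := ((q - b) / (1 + s * (Cconj b * q)))%C.

Lemma sign_cases (s : R) : s * s = 1 -> s = 1 \/ s = -1.
Proof.
  intros H. assert (E : (s - 1) * (s + 1) = 0) by (ring_simplify; simpl; lra).
  apply Rmult_integral in E. destruct E; [left|right]; lra.
Qed.

Section Distance.
Variables (s : R) (Hs : s * s = 1).

(** Divided by the squared modulus of the denominator, this is the transformation law of the
    conformal factor; for a fixed focus b it also ties the two moduli in the distance formula
    together. *)
Lemma mobius_norm_identity (b q : C) :
  Cmod (1 + s * (Cconj b * q)) ^ 2 + s * Cmod (q - b) ^ 2 =
  (1 + s * Cmod b ^ 2) * (1 + s * Cmod q ^ 2).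
Proof.
  rewrite !Cmod2_alt. destruct b as [b1 b2], q as [x y]. simpl.
  destruct (sign_cases s Hs) as [-> | ->]; ring.
Qed.

Lemma curvature_factor_pos (q : C) : unit_disc q -> 0 < 1 + s * Cmod q ^ 2.
Proof.
  unfold unit_disc. intros H. pose proof (Cmod_ge_0 q).
  assert (Cmod q ^ 2 < 1) by nra. assert (-1 <= s <= 1) by nra. nra.
Qed.

Lemma one_plus_neq0 (k : C) : Cmod k < 1 -> (1 + s * k)%C <> 0%C.
Proof.
  intros H E. assert (Ek : (s * k = - (1))%C).
  { replace (s * k)%C with (1 + s * k - 1)%C by ring. rewrite E. ring. }
  apply (f_equal Cmod) in Ek. rewrite Cmod_mult, Cmod_R, Cmod_opp, Cmod_1 in Ek.
  pose proof (Cmod_ge_0 k). assert (Rabs s <= 1) by (unfold Rabs; destruct Rcase_abs; nra). nra.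
Qed.

Lemma mobius_den_neq0 (b q : C) :
  unit_disc b -> unit_disc q -> (1 + s * (Cconj b * q))%C <> 0%C.
Proof.
  intros Hb Hq. apply one_plus_neq0. rewrite Cmod_mult, Cmod_conj.
  unfold unit_disc in *. pose proof (Cmod_ge_0 b). pose proof (Cmod_ge_0 q). nra.
Qed.

Lemma mobius_curvature_factor (b q : C) : (1 + s * (Cconj b * q))%C <> 0%C ->
  1 + s * Cmod (mobius s b q) ^ 2 =
  (1 + s * Cmod b ^ 2) * (1 + s * Cmod q ^ 2) / Cmod (1 + s * (Cconj b * q)) ^ 2.
Proof.
  intros H. unfold mobius. rewrite Cmod_div by exact H. rewrite <- mobius_norm_identity.
  apply Cmod_gt_0 in H. field. lra.
Qed.

Lemma mobius_velocity (b v : C) (g : R -> C) (t : R) :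
  has_velocity g t v -> (1 + s * (Cconj b * g t))%C <> 0%C ->
  has_velocity (fun r => mobius s b (g r)) t
    (RtoC (1 + s * Cmod b ^ 2) * v / ((1 + s * (Cconj b * g t)) * (1 + s * (Cconj b * g t))))%C.
Proof.
  intros Hg H. eapply has_velocity_eq.
  - apply has_velocity_div; [apply has_velocity_minus; [exact Hg|apply has_velocity_const]| |exact H].
    apply has_velocity_plus; [apply has_velocity_const|].
    apply has_velocity_mult; [apply has_velocity_const|].
    apply has_velocity_mult; [apply has_velocity_const|exact Hg].
  - rewrite RtoC_plus, RtoC_mult, Cmod2_conj. field. exact H.
Qed.

(** The derivative of the Möbius map has modulus (1 + s |b|^2) / |denominator|^2, which by
    [mobius_curvature_factor] is the quotient of the conformal factors at the image and at q. *)
Lemma mobius_isometry (b q v : C) :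
  0 < 1 + s * Cmod b ^ 2 -> 0 < 1 + s * Cmod q ^ 2 -> (1 + s * (Cconj b * q))%C <> 0%C ->
  curvature_density s (mobius s b q) *
    Cmod (RtoC (1 + s * Cmod b ^ 2) * v / ((1 + s * (Cconj b * q)) * (1 + s * (Cconj b * q)))) =
  curvature_density s q * Cmod v.
Proof.
  intros Hb Hq H. unfold curvature_density. rewrite mobius_curvature_factor by exact H.
  rewrite Cmod_div by now apply Cmult_neq_0.
  rewrite !Cmod_mult, Cmod_R, Rabs_pos_eq by lra. apply Cmod_gt_0 in H. field. lra.
Qed.

Lemma mobius_0 (b : C) : mobius s b 0 = (- b)%C.
Proof.
  unfold mobius, Cdiv. replace (1 + s * (Cconj b * 0))%C with (1 : C) by ring.
  rewrite <- RtoC_inv, Rinv_1 by lra. ring.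
Qed.

Lemma mobius_inverse (b q : C) :
  0 < 1 + s * Cmod b ^ 2 -> (1 + s * (Cconj b * q))%C <> 0%C ->
  mobius s (- b) (mobius s b q) = q.
Proof.
  intros Hb H. unfold mobius. rewrite Copp_conj.
  assert (Hn : (1 + RtoC s * (Cconj b * b))%C <> 0%C).
  { intros E. assert (E' : RtoC (1 + s * Cmod b ^ 2) = 0%C).
    { rewrite RtoC_plus, RtoC_mult, Cmod2_conj. rewrite <- E. ring. }
    apply RtoC_inj in E'. lra. }
  field. split; [exact H|].
  intros E. apply Hn. rewrite <- E. ring.
Qed.

(** Geodesics through b are images of radial lines. Being in the disc means |denominator|^2 -
    |numerator|^2 > 0, and this is a concave quadratic in r, positive at r = 0 and r = 1. On the
    sphere this is the convexity of the open hemisphere. *)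
Lemma geodesic_in_disc (b w : C) (r : R) :
  unit_disc b -> 0 <= r <= 1 -> unit_disc (mobius s (- b) w) ->
  (1 + s * (Cconj (- b) * w))%C <> 0%C -> (1 + s * (Cconj (- b) * (r * w)))%C <> 0%C ->
  unit_disc (mobius s (- b) (r * w)).
Proof.
  intros Hb Hr H1 Hn Hnr. rewrite unit_disc_iff in Hb. unfold unit_disc, mobius in *.
  rewrite Cmod_div in * by assumption.
  assert (key : forall n d : C, d <> 0%C -> (Cmod n / Cmod d < 1 <-> Cmod n ^ 2 < Cmod d ^ 2)).
  { intros n d Hd. apply Cmod_gt_0 in Hd. pose proof (Cmod_ge_0 n). split; intros L.
    - apply Rlt_div_l in L; [nra|exact Hd].
    - apply Rlt_div_l; [exact Hd|nra]. }
  apply key; [exact Hnr|]. apply key in H1; [|exact Hn]. clear key Hn Hnr.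
  rewrite !Cmod2_alt in *. destruct b as [b1 b2], w as [u v]. simpl in *.
  (* The excess of the concave quadratic over its chord between r = 0 and r = 1. *)
  assert (Hbd : 0 <= (1 - b1 * b1 - b2 * b2) * (u * u + v * v) * (r - r * r)).
  { apply Rmult_le_pos; [apply Rmult_le_pos|]; nra. }
  assert (Hconv : forall A B, 0 < A -> 0 < B -> 0 < (1 - r) * A + r * B).
  { intros A B HA HB. destruct (Rle_dec r (1 / 2)); nra. }
  apply Rminus_lt_0 in Hb. apply Rminus_lt_0 in H1. apply Rminus_lt_0.
  pose proof (Hconv _ _ Hb H1) as HC. eapply Rlt_le_trans; [exact HC|].
  apply Rminus_le_0. eapply Rle_trans; [exact Hbd|]. apply Req_le.
  destruct (sign_cases s Hs) as [-> | ->]; ring.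
Qed.

(** * The distance as an infimum, given the distance [T] from 0 as a function of the radius *)

Section Radial.
Variable T : R -> R.
Hypothesis HT0 : T 0 = 0.
Hypothesis HT : forall r, 0 < 1 + s * r ^ 2 -> is_derive T r (2 / (1 + s * r ^ 2)).
Hypothesis Tlow : forall w dw : R -> C,
  (forall t, 0 <= t <= 1 -> has_velocity w t (dw t) /\ 0 < 1 + s * Cmod (w t) ^ 2) ->
  (forall t, 0 <= t <= 1 ->
     continuous (fun t => curvature_density s (w t) * Cmod (dw t)) t) ->
  w 1 = 0%C ->
  T (Cmod (w 0)) <= RInt (fun t => curvature_density s (w t) * Cmod (dw t)) 0 1.

(** The isometry taking b to 0 preserves the length integrand, which reduces the bound to curves
    ending at 0. *)
Lemma curve_length_ge (q b : C) (g : R -> C) : unit_disc b ->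
  C1_on (fun t => 0 <= t <= 1) g -> (forall t, 0 <= t <= 1 -> unit_disc (g t)) ->
  g 0 = q -> g 1 = b -> T (Cmod (mobius s b q)) <= curve_length (curvature_density s) g.
Proof.
  intros Hb Hg Hd H0 H1. unfold curve_length.
  pose (dw t := (RtoC (1 + s * Cmod b ^ 2) * velocity_of g t /
    ((1 + s * (Cconj b * g t)) * (1 + s * (Cconj b * g t))))%C).
  pose proof (curvature_factor_pos b Hb) as Hbp.
  assert (Hn : forall t, 0 <= t <= 1 -> (1 + s * (Cconj b * g t))%C <> 0%C).
  { intros t Ht. apply mobius_den_neq0; auto. }
  assert (E : forall t, 0 <= t <= 1 ->
    curvature_density s (mobius s b (g t)) * Cmod (dw t) =
    curvature_density s (g t) * Cmod (velocity_of g t)).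
  { intros t Ht. apply mobius_isometry; auto. now apply curvature_factor_pos, Hd. }
  rewrite <- (RInt_ext (fun t => curvature_density s (mobius s b (g t)) * Cmod (dw t))).
  2:{ intros t Ht. rewrite Rmin_left, Rmax_right in Ht by lra. apply E; lra. }
  rewrite <- H0. apply (Tlow (fun t => mobius s b (g t)) dw).
  - intros t Ht. split.
    + apply mobius_velocity; [|now apply Hn]. eapply C1_on_has_velocity; eauto.
    + rewrite mobius_curvature_factor by now apply Hn.
      apply Rdiv_lt_0_compat.
      * apply Rmult_lt_0_compat; [lra|]. now apply curvature_factor_pos, Hd.
      * apply pow_lt, Cmod_gt_0. now apply Hn.
  - intros t Ht.
    assert (Cg : continuous g t).
    { eapply has_velocity_continuous. eapply C1_on_has_velocity; eauto. }
    destruct (Hg t Ht) as (_ & _ & Cv).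
    assert (Hden : 1 + s * Cmod (mobius s b (g t)) ^ 2 <> 0).
    { rewrite mobius_curvature_factor by now apply Hn. apply Rgt_not_eq.
      apply Rdiv_lt_0_compat.
      * apply Rmult_lt_0_compat; [lra|]. now apply curvature_factor_pos, Hd.
      * apply pow_lt, Cmod_gt_0. now apply Hn. }
    pose proof (Hn t Ht).
    unfold dw, curvature_density, mobius in *. complex_cont; auto.
    now apply Cmult_neq_0.
  - rewrite H1. unfold mobius. rewrite <- H1. unfold Cdiv, Cminus. rewrite Cplus_opp_r. ring.
Qed.

(** The minimizer is the radial segment from w to 0, carried back by the inverse Möbius map. On the
    sphere w may lie outside the unit disc, so the denominators need care. *)
Lemma geodesic_exists (q b : C) : unit_disc q -> unit_disc b ->
  exists g, C1_on (fun t => 0 <= t <= 1) g /\ (forall t, 0 <= t <= 1 -> unit_disc (g t)) /\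
    g 0 = q /\ g 1 = b /\ curve_length (curvature_density s) g = T (Cmod (mobius s b q)).
Proof.
  intros Hq Hb. set (w := mobius s b q).
  pose proof (mobius_den_neq0 b q Hb Hq) as HD.
  pose proof (curvature_factor_pos b Hb) as Hbp. pose proof (curvature_factor_pos q Hq) as Hqp.
  assert (Hinv : mobius s (- b) w = q) by now apply mobius_inverse.
  (* Multiplied by the denominator at q, this expression becomes 1 + s times a convex combination of
     |b|^2 and conj b q, both of modulus less than 1. *)
  assert (Hn : forall t, 0 <= t <= 1 -> (1 + s * (Cconj (- b) * (RtoC (1 - t) * w)))%C <> 0%C).
  { intros t Ht E.
    apply (one_plus_neq0 (RtoC ((1 - t) * Cmod b ^ 2) + RtoC t * (Cconj b * q))%C).
    - eapply Rle_lt_trans; [apply Cmod_triangle|].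
      rewrite !Cmod_mult, Cmod_conj, !Cmod_R.
      unfold unit_disc in *. pose proof (Cmod_ge_0 b). pose proof (Cmod_ge_0 q).
      rewrite !Rabs_pos_eq by nra.
      assert (P : Cmod b ^ 2 < 1) by nra. assert (Q : Cmod b * Cmod q < 1) by nra.
      revert P Q. generalize (Cmod b ^ 2), (Cmod b * Cmod q). intros P Q HP HQ.
      destruct (Rle_dec t (1 / 2)); nra.
    - replace (1 + s * (RtoC ((1 - t) * Cmod b ^ 2) + RtoC t * (Cconj b * q)))%C
        with ((1 + s * (Cconj b * q)) * (1 + s * (Cconj (- b) * (RtoC (1 - t) * w))))%C.
      + rewrite E. ring.
      + unfold w, mobius. rewrite Copp_conj, RtoC_mult, Cmod2_conj, RtoC_minus. field. exact HD. }
  assert (Hw : 0 < 1 + s * Cmod w ^ 2).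
  { unfold w. rewrite mobius_curvature_factor by assumption.
    apply Rdiv_lt_0_compat; [now apply Rmult_lt_0_compat|]. apply pow_lt. now apply Cmod_gt_0. }
  assert (Hrw : forall t, 0 <= t <= 1 -> 0 < 1 + s * ((1 - t) * Cmod w) ^ 2).
  { intros t Ht. rewrite Rpow_mult_distr. pose proof (pow2_ge_0 (Cmod w)).
    assert (K : 0 <= (1 - t) ^ 2 <= 1) by nra. revert K. generalize ((1 - t) ^ 2). intros k K.
    assert (k * Cmod w ^ 2 <= Cmod w ^ 2) by nra. assert (0 <= k * Cmod w ^ 2) by nra.
    destruct (sign_cases s Hs) as [E | E]; rewrite E in *; lra. }
  set (g := fun t => mobius s (- b) (RtoC (1 - t) * w)).
  set (dg := fun t => (RtoC (1 + s * Cmod (- b) ^ 2) * - w /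
    ((1 + s * (Cconj (- b) * (RtoC (1 - t) * w))) *
     (1 + s * (Cconj (- b) * (RtoC (1 - t) * w)))))%C).
  assert (Hlin : forall t, has_velocity (fun t => RtoC (1 - t) * w)%C t (- w)%C).
  { intros t. eapply has_velocity_eq.
    - apply has_velocity_scal with (d := -1); [|apply has_velocity_const].
      auto_derive; [exact I|ring].
    - apply C_ext; simpl; ring. }
  assert (Hclin : forall t, continuous (fun t => RtoC (1 - t) * w)%C t).
  { intros t. eapply has_velocity_continuous, Hlin. }
  assert (Hg : forall t, 0 <= t <= 1 -> locally t (fun t => has_velocity g t (dg t))).
  { intros t Ht.
    assert (L : locally t (fun t => (1 + s * (Cconj (- b) * (RtoC (1 - t) * w)))%C <> 0%C)).
    { apply (locally_neq0 (fun t => (1 + s * (Cconj (- b) * (RtoC (1 - t) * w)))%C) t);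
       [|now apply Hn].
      pose proof (Hclin t). complex_cont. }
    revert L. apply filter_imp. intros r Hr.
    apply (mobius_velocity (- b) (- w) (fun t => RtoC (1 - t) * w)%C r); [apply Hlin|exact Hr]. }
  exists g. split; [|split; [|split; [|split]]].
  - apply C1_on_intro with dg; [exact Hg|]. intros t Ht.
    pose proof (Hn t Ht). unfold dg. complex_cont. now apply Cmult_neq_0.
  - intros t Ht. apply geodesic_in_disc; try assumption; try lra.
    + now rewrite Hinv.
    + specialize (Hn 0 ltac:(lra)). replace (RtoC (1 - 0) * w)%C with w in Hn; [exact Hn|].
      apply C_ext; simpl; ring.
    + now apply Hn.
  - unfold g. rewrite <- Hinv. f_equal. apply C_ext; simpl; ring.
  - unfold g. replace (RtoC (1 - 1) * w)%C with (RtoC 0) by (apply C_ext; simpl; ring).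
    rewrite mobius_0. ring.
  (* The integrand depends on t only through the radius (1 - t) |w|, so - T ((1 - t) |w|) is a
     primitive. *)
  - unfold curve_length.
    rewrite (RInt_ext _ (fun t => 2 / (1 + s * ((1 - t) * Cmod w) ^ 2) * Cmod w)).
    + etransitivity.
      * apply is_RInt_unique.
        apply (is_RInt_derive (V := R_CompleteNormedModule) (fun t => - T ((1 - t) * Cmod w))).
        -- intros t Ht. rewrite Rmin_left, Rmax_right in Ht by lra.
           eapply is_derive_eq.
           ++ apply is_derive_Ropp. apply (is_derive_comp T (fun t => (1 - t) * Cmod w)).
              ** apply HT. now apply Hrw.
              ** apply (is_derive_Rmult (fun t => 1 - t) (fun _ => Cmod w) t (-1) 0).
                 --- auto_derive; [exact I|ring].
                 --- apply (is_derive_const (V := R_NormedModule)).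
           ++ unfold scal; simpl; unfold mult; simpl. ring.
        -- intros t Ht. rewrite Rmin_left, Rmax_right in Ht by lra.
           pose proof (Hrw t Ht). real_cont. lra.
      * simpl. replace ((1 - 1) * Cmod w) with 0 by ring. replace ((1 - 0) * Cmod w) with (Cmod w) by ring.
        rewrite HT0. unfold minus, plus, opp; simpl. ring.
    + intros t Ht. rewrite Rmin_left, Rmax_right in Ht by lra.
      assert (Ht' : 0 <= t <= 1) by lra.
      rewrite (has_velocity_velocity_of g t (dg t)) by exact (locally_singleton _ _ (Hg t Ht')).
      assert (Em : Cmod (RtoC (1 - t) * w) = (1 - t) * Cmod w).
      { rewrite Cmod_mult, Cmod_R, Rabs_pos_eq; lra. }
      unfold g, dg. rewrite mobius_isometry.
      * unfold curvature_density. now rewrite Em, Cmod_opp.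
      * now rewrite Cmod_opp.
      * rewrite Em. now apply Hrw.
      * now apply Hn.
Qed.

Lemma riem_dist_radial (q b : C) : unit_disc q -> unit_disc b ->
  riem_dist (curvature_density s) q b = T (Cmod (mobius s b q)).
Proof.
  intros Hq Hb. unfold riem_dist.
  rewrite (is_glb_Rbar_unique _ (T (Cmod (mobius s b q)))); [reflexivity|].
  split.
  - intros l (g & Hg & Hd & H0 & H1 & ->). now apply curve_length_ge.
  - intros l Hl. apply Hl. destruct (geodesic_exists q b Hq Hb) as (g & Hg & Hd & H0 & H1 & E).
    exists g. split; [exact Hg|]. split; [exact Hd|]. auto.
Qed.
End Radial.
End Distance.


(** * Lower bounds for the lengths of curves ending at 0 *)

Lemma inner_le_Cmod (u v : C) : Re u * Re v + Im u * Im v <= Cmod u * Cmod v.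
Proof.
  rewrite <- (Cmod_conj v), <- Cmod_mult.
  replace (Re u * Re v + Im u * Im v) with (Re (u * Cconj v)) by (simpl; unfold Re, Im; ring).
  eapply Rle_trans; [apply Rle_abs|apply re_le_Cmod].
Qed.

Lemma atan_radial_le_length (w dw : R -> C) :
  (forall t, 0 <= t <= 1 -> has_velocity w t (dw t) /\ 0 < 1 + 1 * Cmod (w t) ^ 2) ->
  (forall t, 0 <= t <= 1 ->
     continuous (fun t => curvature_density 1 (w t) * Cmod (dw t)) t) ->
  w 1 = 0%C ->
  2 * atan (Cmod (w 0)) <= RInt (fun t => curvature_density 1 (w t) * Cmod (dw t)) 0 1.
Proof.
  intros Hw Hc H1. apply le_epsilon. intros eps Heps.
  (* The perturbation is tan d, so that the end of the curve, where w = 0, contributes exactly 2 d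
     <= eps; d <= 1/2 keeps d in the range where [atan] inverts [tan]. *)
  set (d := Rmin eps 1 / 2).
  assert (Hd : 0 < d <= eps / 2 /\ d <= 1 / 2).
  { unfold d. pose proof (Rmin_l eps 1). pose proof (Rmin_r eps 1).
    assert (0 < Rmin eps 1) by (apply Rmin_glb_lt; lra). lra. }
  pose proof PI2_1 as HPI.
  assert (Ht : 0 < tan d) by (apply tan_gt_0; lra).
  (* [atan |w|] is not differentiable where [w = 0], unlike this perturbation. *)
  set (N := fun t => Cmod (w t) ^ 2 + tan d ^ 2).
  assert (HN : forall t, 0 < N t) by (intros t; unfold N; nra).
  assert (Hmain : 2 * atan (sqrt (N 1)) - 2 * atan (sqrt (N 0)) >=
    - RInt (fun t => curvature_density 1 (w t) * Cmod (dw t)) 0 1).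
  { set (dpsi := fun t => - (2 / (1 + N t) *
       ((Re (w t) * Re (dw t) + Im (w t) * Im (dw t)) / sqrt (N t)))).
    enough (B : - (2 * atan (sqrt (N 1))) - - (2 * atan (sqrt (N 0))) <=
      RInt (fun t => curvature_density 1 (w t) * Cmod (dw t)) 0 1) by lra.
    apply (increment_le_RInt (fun t => - (2 * atan (sqrt (N t)))) dpsi); [| |exact Hc].
    - intros t Ht'. destruct (Hw t Ht') as [Hv _].
      assert (DN : is_derive N t (2 * (Re (w t) * Re (dw t) + Im (w t) * Im (dw t)))).
      { eapply is_derive_eq.
        - apply (is_derive_Rplus (fun t => Cmod (w t) ^ 2) (fun _ => tan d ^ 2)).
          + exact (is_derive_Cmod_sqr w t _ Hv).
          + apply (is_derive_const (V := R_NormedModule)).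
        - unfold zero; simpl; ring. }
      pose proof (is_derive_sqrt N t _ DN (HN t)) as DS.
      pose proof (is_derive_comp atan (fun t => sqrt (N t)) t _ _
        (is_derive_atan _) DS) as DA.
      eapply is_derive_eq.
      + apply is_derive_Ropp.
        apply (is_derive_Rmult (fun _ => 2) (fun t => atan (sqrt (N t))) t 0); [|exact DA].
        apply (is_derive_const (V := R_NormedModule)).
      + unfold dpsi, scal; simpl; unfold mult; simpl.
        rewrite Rsqr_sqrt by (left; apply HN). pose proof (HN t).
        pose proof (sqrt_lt_R0 _ H). field. lra.
    - intros t Ht'. destruct (Hw t Ht') as [Hv _].
      pose proof (HN t) as HNt. pose proof (sqrt_lt_R0 _ HNt) as HS.
      pose proof (inner_le_Cmod (- w t) (dw t)) as IC. rewrite Cmod_opp in IC. simpl in IC.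
      unfold dpsi, curvature_density.
      assert (HwS : Cmod (w t) <= sqrt (N t)).
      { rewrite <- (sqrt_pow2 (Cmod (w t))) by apply Cmod_ge_0.
        apply sqrt_le_1_alt. unfold N. nra. }
      assert (A : - ((Re (w t) * Re (dw t) + Im (w t) * Im (dw t)) / sqrt (N t)) <= Cmod (dw t)).
      { apply Rmult_le_reg_r with (sqrt (N t)); [exact HS|].
        replace (- ((Re (w t) * Re (dw t) + Im (w t) * Im (dw t)) / sqrt (N t)) * sqrt (N t))
          with (- (Re (w t) * Re (dw t) + Im (w t) * Im (dw t))) by (field; lra).
        pose proof (Cmod_ge_0 (dw t)). unfold Re, Im in *. nra. }
      assert (Bk : 2 / (1 + N t) <= 2 / (1 + 1 * Cmod (w t) ^ 2)).
      { apply Rmult_le_compat_l; [lra|]. apply Rinv_le_contravar; unfold N; nra. }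
      assert (0 < 2 / (1 + N t)) by (apply Rdiv_lt_0_compat; lra).
      pose proof (Cmod_ge_0 (dw t)).
      apply Rle_trans with (2 / (1 + N t) * Cmod (dw t)); nra. }
  assert (E1 : sqrt (N 1) = tan d).
  { unfold N. rewrite H1, Cmod_0. replace (0 ^ 2 + tan d ^ 2) with (tan d ^ 2) by ring.
    apply sqrt_pow2. lra. }
  rewrite E1, atan_tan in Hmain by lra.
  assert (E0 : Cmod (w 0) <= sqrt (N 0)).
  { rewrite <- (sqrt_pow2 (Cmod (w 0))) by apply Cmod_ge_0.
    apply sqrt_le_1_alt. unfold N. nra. }
  assert (atan (Cmod (w 0)) <= atan (sqrt (N 0))).
  { destruct E0 as [E0 | E0]; [left; now apply atan_increasing|rewrite E0; lra]. }
  lra.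
Qed.

Lemma is_derive_log_ratio (r : R) : 0 < 1 + -1 * r ^ 2 ->
  is_derive (fun r => ln ((1 + r) / (1 - r))) r (2 / (1 + -1 * r ^ 2)).
Proof.
  intros H. assert (-1 < r < 1) by nra.
  auto_derive.
  - split; [lra|]. split; [|exact I]. apply Rdiv_lt_0_compat; lra.
  - field. repeat split; nra.
Qed.

(** The hyperbolic density grows with |w|, so projecting the curve orthogonally to the diameter
    through w 0 does not lengthen it; this avoids differentiating |w| at 0. The spherical density
    decreases, and the projection would go the wrong way there. *)
Lemma log_radial_le_length (w dw : R -> C) :
  (forall t, 0 <= t <= 1 -> has_velocity w t (dw t) /\ 0 < 1 + -1 * Cmod (w t) ^ 2) ->
  (forall t, 0 <= t <= 1 ->
     continuous (fun t => curvature_density (-1) (w t) * Cmod (dw t)) t) ->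
  w 1 = 0%C ->
  ln ((1 + Cmod (w 0)) / (1 - Cmod (w 0))) <=
    RInt (fun t => curvature_density (-1) (w t) * Cmod (dw t)) 0 1.
Proof.
  intros Hw Hc H1.
  (* The direction of w 0; any unit vector serves if w 0 = 0. *)
  assert (He : exists e, Cmod e = 1 /\ Re (w 0 * Cconj e) = Cmod (w 0)).
  { destruct (classic (w 0 = 0%C)) as [E | E].
    - exists 1%C. rewrite Cmod_1, E, Cmod_0. split; [reflexivity|simpl; ring].
    - pose proof (proj1 (Cmod_gt_0 _) E) as P. exists (w 0 / Cmod (w 0))%C.
      assert (RtoC (Cmod (w 0)) <> 0%C) by (intros F; apply RtoC_inj in F; lra).
      split.
      + rewrite Cmod_div, Cmod_R, Rabs_pos_eq by (assumption || lra). field. lra.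
      + rewrite Cdiv_conj by assumption.
        replace (w 0 * (Cconj (w 0) / Cconj (Cmod (w 0))))%C with (RtoC (Cmod (w 0))); [reflexivity|].
        replace (Cconj (Cmod (w 0))) with (RtoC (Cmod (w 0))) by (apply C_ext; simpl; ring).
        unfold Cdiv. rewrite Cmult_assoc, <- Cmod2_conj, <- RtoC_inv, <- RtoC_mult by lra.
        f_equal. field. lra. }
  destruct He as (e & He & Hw0).
  set (u := fun t => Re (w t * Cconj e)). set (du := fun t => Re (dw t * Cconj e)).
  assert (Hu : forall t, Rabs (u t) <= Cmod (w t)).
  { intros t. eapply Rle_trans; [apply re_le_Cmod|]. rewrite Cmod_mult, Cmod_conj, He. lra. }
  assert (Hpos : forall t, 0 <= t <= 1 -> 0 < 1 + -1 * u t ^ 2).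
  { intros t Ht. destruct (Hw t Ht) as [_ Hp]. specialize (Hu t).
    rewrite <- (pow2_abs (u t)). pose proof (Rabs_pos (u t)). nra. }
  assert (E0 : u 0 = Cmod (w 0)) by exact Hw0.
  assert (E1 : u 1 = 0) by (unfold u; rewrite H1; simpl; ring).
  enough (B : - ln ((1 + u 1) / (1 - u 1)) - - ln ((1 + u 0) / (1 - u 0)) <=
    RInt (fun t => curvature_density (-1) (w t) * Cmod (dw t)) 0 1).
  { rewrite E0, E1 in B. replace ((1 + 0) / (1 - 0)) with 1 in B by field.
    rewrite ln_1 in B. lra. }
  apply (increment_le_RInt (fun t => - ln ((1 + u t) / (1 - u t)))
    (fun t => - (du t * (2 / (1 + -1 * u t ^ 2))))); [| |exact Hc].
  - intros t Ht. destruct (Hw t Ht) as [Hv _].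
    assert (D : is_derive u t (du t)).
    { pose proof (has_velocity_mult w (fun _ => Cconj e) t _ _ Hv (has_velocity_const _ _)) as [D _].
      eapply is_derive_eq; [exact D|]. unfold du. simpl. unfold Re, Im. ring. }
    apply is_derive_Ropp.
    exact (is_derive_comp (fun r => ln ((1 + r) / (1 - r))) u t _ _
      (is_derive_log_ratio _ (Hpos t Ht)) D).
  - intros t Ht. destruct (Hw t Ht) as [_ Hp]. pose proof (Hpos t Ht) as Hp'.
    assert (A : - du t <= Cmod (dw t)).
    { apply Rle_trans with (Rabs (du t)).
      - rewrite <- Rabs_Ropp. apply Rle_abs.
      - eapply Rle_trans; [apply re_le_Cmod|]. rewrite Cmod_mult, Cmod_conj, He. lra. }
    unfold curvature_density.
    assert (Bk : 2 / (1 + -1 * u t ^ 2) <= 2 / (1 + -1 * Cmod (w t) ^ 2)).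
    { apply Rmult_le_compat_l; [lra|]. apply Rinv_le_contravar; [exact Hp|].
      specialize (Hu t). rewrite <- (pow2_abs (u t)). pose proof (Rabs_pos (u t)). nra. }
    assert (0 < 2 / (1 + -1 * u t ^ 2)) by (apply Rdiv_lt_0_compat; lra).
    pose proof (Cmod_ge_0 (dw t)).
    apply Rle_trans with (2 / (1 + -1 * u t ^ 2) * Cmod (dw t)); nra.
Qed.

Lemma spherical_dist (q b : C) : unit_disc q -> unit_disc b ->
  riem_dist spherical_density q b = 2 * atan (Cmod (q - b) / Cmod (1 + Cconj b * q)).
Proof.
  intros Hq Hb. rewrite spherical_density_curvature.
  rewrite (riem_dist_radial 1 ltac:(ring) (fun r => 2 * atan r)); try assumption.
  - pose proof (mobius_den_neq0 1 ltac:(ring) b q Hb Hq) as H.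
    unfold mobius. rewrite Cmod_div by exact H. rewrite Cmult_1_l. reflexivity.
  - rewrite atan_0. ring.
  - intros r Hr. auto_derive; [exact I|]. unfold Rsqr. field. nra.
  - exact atan_radial_le_length.
Qed.

Lemma hyperbolic_dist (q b : C) : unit_disc q -> unit_disc b ->
  riem_dist hyperbolic_density q b =
  ln ((Cmod (1 - Cconj b * q) + Cmod (q - b)) / (Cmod (1 - Cconj b * q) - Cmod (q - b))).
Proof.
  intros Hq Hb. rewrite hyperbolic_density_curvature.
  rewrite (riem_dist_radial (-1) ltac:(ring) (fun r => ln ((1 + r) / (1 - r)))); try assumption.
  - pose proof (mobius_den_neq0 (-1) ltac:(ring) b q Hb Hq) as H.
    pose proof (mobius_norm_identity (-1) ltac:(ring) b q) as E.
    pose proof (curvature_factor_pos (-1) ltac:(ring) b Hb).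
    pose proof (curvature_factor_pos (-1) ltac:(ring) q Hq).
    unfold mobius. rewrite Cmod_div by exact H.
    replace (1 + RtoC (-1) * (Cconj b * q))%C with (1 - Cconj b * q)%C in *
      by (apply C_ext; simpl; ring).
    apply Cmod_gt_0 in H. pose proof (Cmod_ge_0 (q - b)). f_equal. field.
    assert (Cmod (1 - Cconj b * q) - Cmod (q - b) <> 0); [|split; lra].
    intros F. assert (0 < (1 + -1 * Cmod b ^ 2) * (1 + -1 * Cmod q ^ 2)) by now apply Rmult_lt_0_compat.
    nra.
  - replace ((1 + 0) / (1 - 0)) with 1 by field. apply ln_1.
  - exact is_derive_log_ratio.
  - exact log_radial_le_length.
Qed.

(** * Conics *)


Lemma unit_disc_0 : unit_disc 0%C.
Proof. unfold unit_disc. rewrite Cmod_0. lra. Qed.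

Lemma unit_disc_opp (a : C) : unit_disc a -> unit_disc (- a)%C.
Proof. unfold unit_disc. now rewrite Cmod_opp. Qed.

Lemma Cmod_square (z : C) : Cmod (square z) = Cmod z ^ 2.
Proof. unfold square. rewrite Cmod_mult. ring. Qed.

Lemma hyperbolic_norm_identity (b q : C) :
  Cmod (1 - Cconj b * q) ^ 2 - Cmod (q - b) ^ 2 = (1 - Cmod b ^ 2) * (1 - Cmod q ^ 2).
Proof.
  pose proof (mobius_norm_identity (-1) ltac:(ring) b q) as E.
  replace (1 + RtoC (-1) * (Cconj b * q))%C with (1 - Cconj b * q)%C in E
    by (apply C_ext; simpl; ring).
  lra.
Qed.

Lemma spherical_norm_identity (b q : C) :
  Cmod (1 + Cconj b * q) ^ 2 + Cmod (q - b) ^ 2 = (1 + Cmod b ^ 2) * (1 + Cmod q ^ 2).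
Proof.
  pose proof (mobius_norm_identity 1 ltac:(ring) b q) as E.
  rewrite Cmult_1_l in E. lra.
Qed.

Lemma one_minus_sqr_pos (b : C) : unit_disc b -> 0 < 1 - Cmod b ^ 2.
Proof. unfold unit_disc. intros H. pose proof (Cmod_ge_0 b). nra. Qed.

Lemma hyperbolic_gap_pos (b q : C) : unit_disc b -> unit_disc q ->
  0 < Cmod (1 - Cconj b * q) - Cmod (q - b).
Proof.
  intros Hb Hq. pose proof (hyperbolic_norm_identity b q) as E.
  pose proof (Rmult_lt_0_compat _ _ (one_minus_sqr_pos b Hb) (one_minus_sqr_pos q Hq)).
  pose proof (Cmod_ge_0 (q - b)). pose proof (Cmod_ge_0 (1 - Cconj b * q)). nra.
Qed.

Lemma hyperbolic_dist_ge_0 (q b : C) : unit_disc q -> unit_disc b ->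
  0 <= riem_dist hyperbolic_density q b.
Proof.
  intros Hq Hb. rewrite hyperbolic_dist by assumption.
  pose proof (hyperbolic_gap_pos b q Hb Hq). pose proof (Cmod_ge_0 (q - b)).
  rewrite <- ln_1. apply ln_le; [lra|].
  apply Rmult_le_reg_r with (Cmod (1 - Cconj b * q) - Cmod (q - b)); [assumption|].
  unfold Rdiv. rewrite Rmult_assoc, Rinv_l; lra.
Qed.

(* The conics with foci 0 and F are the level curves of these two functions:
   a decreasing function of the sum, and one of the difference, of the distances to 0 and F. *)
Definition sum_level (F q : C) : R :=
  (Cmod (1 - Cconj F * q) - Cmod (q - F)) / (1 + Cmod q).
Definition diff_level (F q : C) : R :=
  (Cmod (1 - Cconj F * q) + Cmod (q - F)) / (1 + Cmod q).

Section KeplerConics.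
Variables (F q : C) (HF : unit_disc F) (Hq : unit_disc q).

Lemma sum_level_pos : 0 < sum_level F q.
Proof.
  pose proof (hyperbolic_gap_pos F q HF Hq). pose proof (Cmod_ge_0 q).
  unfold sum_level. apply Rdiv_lt_0_compat; lra.
Qed.

Lemma diff_level_pos : 0 < diff_level F q.
Proof.
  pose proof (hyperbolic_gap_pos F q HF Hq). pose proof (Cmod_ge_0 q).
  pose proof (Cmod_ge_0 (q - F)). unfold diff_level. apply Rdiv_lt_0_compat; lra.
Qed.

Lemma hyperbolic_dist_0 :
  riem_dist hyperbolic_density q 0 = ln ((1 + Cmod q) / (1 - Cmod q)).
Proof.
  rewrite hyperbolic_dist by (assumption || apply unit_disc_0).
  replace (1 - Cconj 0 * q)%C with (RtoC 1) by (apply C_ext; simpl; ring).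
  replace (q - 0)%C with q by ring. now rewrite Cmod_1.
Qed.

(** With r = |q|, Y = |1 - conj F q| and Z = |q - F|, the product of (1 + r) / (1 - r) and (Y + Z) /
    (Y - Z) becomes a square up to a constant after replacing (1 - |F|^2) (1 - r^2) by Y^2 - Z^2.
    The quotient of the two factors behaves in the same way. *)
Lemma kepler_sum_dist :
  riem_dist hyperbolic_density q 0 + riem_dist hyperbolic_density q F =
  ln ((1 - Cmod F ^ 2) / sum_level F q ^ 2).
Proof.
  rewrite hyperbolic_dist_0, hyperbolic_dist by assumption. unfold sum_level.
  pose proof (hyperbolic_gap_pos F q HF Hq) as G. pose proof (hyperbolic_norm_identity F q) as E.
  pose proof (Cmod_ge_0 q). pose proof (Cmod_ge_0 (q - F)). pose proof Hq as Hq'. unfold unit_disc in Hq'.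
  set (Y := Cmod (1 - Cconj F * q)) in *. set (Z := Cmod (q - F)) in *. clearbody Y Z.
  rewrite <- ln_mult; try (apply Rdiv_lt_0_compat; lra). f_equal.
  replace (1 - Cmod F ^ 2) with ((Y ^ 2 - Z ^ 2) / (1 - Cmod q ^ 2)) by (rewrite E; field; nra).
  field. repeat split; nra.
Qed.

Lemma kepler_diff_dist :
  riem_dist hyperbolic_density q 0 - riem_dist hyperbolic_density q F =
  ln ((1 - Cmod F ^ 2) / diff_level F q ^ 2).
Proof.
  rewrite hyperbolic_dist_0, hyperbolic_dist by assumption. unfold diff_level.
  pose proof (hyperbolic_gap_pos F q HF Hq) as G. pose proof (hyperbolic_norm_identity F q) as E.
  pose proof (Cmod_ge_0 q). pose proof (Cmod_ge_0 (q - F)). pose proof Hq as Hq'. unfold unit_disc in Hq'.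
  set (Y := Cmod (1 - Cconj F * q)) in *. set (Z := Cmod (q - F)) in *. clearbody Y Z.
  rewrite <- ln_div; try (apply Rdiv_lt_0_compat; lra). f_equal.
  replace (1 - Cmod F ^ 2) with ((Y ^ 2 - Z ^ 2) / (1 - Cmod q ^ 2)) by (rewrite E; field; nra).
  field. repeat split; nra.
Qed.
End KeplerConics.

Lemma ln_over_square_inj (k u v : R) : 0 < k -> 0 < u -> 0 < v ->
  (ln (k / u ^ 2) = ln (k / v ^ 2) <-> u = v).
Proof.
  intros Hk Hu Hv. split; [|now intros ->]. intros E.
  apply ln_inv in E; try (apply Rdiv_lt_0_compat; nra).
  assert (E' : v ^ 2 = u ^ 2).
  { apply Rmult_eq_reg_l with (k / u ^ 2 / v ^ 2).
    - transitivity (k / u ^ 2); [field; lra|]. rewrite E at 1. field; lra.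
    - apply Rgt_not_eq. repeat apply Rdiv_lt_0_compat; nra. }
  nra.
Qed.

(** x + / x is 2 cosh (ln x), and cosh is even and injective on the nonnegative numbers. This trades
    the absolute difference of two hyperbolic distances for an algebraic quantity. *)
Lemma abs_ln_sqr_eq_iff (x y : R) : 0 < x -> 0 < y ->
  (Rabs (ln (x ^ 2)) = Rabs (ln (y ^ 2)) <-> x + / x = y + / y).
Proof.
  intros Hx Hy.
  assert (E : x + / x = y + / y <-> x = y \/ x = / y).
  { split; [|intros [-> | ->]; [reflexivity|rewrite Rinv_inv; ring]]. intros E.
    assert (P : (x - y) * (x * y - 1) = 0).
    { replace ((x - y) * (x * y - 1)) with (x * y * ((x + / x) - (y + / y))) by (field; lra).
      rewrite E. ring. }
    apply Rmult_integral in P. destruct P as [P | P]; [left; lra|right].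
    apply Rmult_eq_reg_r with y; [rewrite Rinv_l; lra|lra]. }
  rewrite E. rewrite !ln_pow by assumption. split.
  - intros A. assert (B : ln x = ln y \/ ln x = - ln y).
    { revert A. simpl INR. unfold Rabs. repeat destruct Rcase_abs; intros; lra. }
    rewrite <- ln_Rinv in B by assumption.
    destruct B as [B | B]; [left|right]; apply ln_inv; auto. now apply Rinv_0_lt_compat.
  - intros [-> | ->]; [reflexivity|]. rewrite ln_Rinv by assumption.
    rewrite <- Rabs_Ropp. f_equal. ring.
Qed.

(** The spherical counterpart: the cosine is even and injective on [0, PI]. *)
Lemma abs_eq_iff_cos (x y : R) : - PI <= x <= PI -> - PI <= y <= PI ->
  (Rabs (2 * x) = Rabs (2 * y) <-> cos x = cos y).
Proof.
  assert (C : forall u, cos (Rabs u) = cos u).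
  { intros u. unfold Rabs. destruct Rcase_abs; [apply cos_neg|reflexivity]. }
  intros Hx Hy. rewrite !Rabs_mult, (Rabs_pos_eq 2) by lra. split; intros E.
  - rewrite <- (C x), <- (C y). f_equal. lra.
  - rewrite <- (C x), <- (C y) in E.
    assert (0 <= Rabs x <= PI) by (split; [apply Rabs_pos|apply Rabs_le; lra]).
    assert (0 <= Rabs y <= PI) by (split; [apply Rabs_pos|apply Rabs_le; lra]).
    rewrite <- (acos_cos (Rabs x)), <- (acos_cos (Rabs y)) by assumption. now rewrite E.
Qed.

(** * Sum and difference of the distances to a and - a *)

Section HookeConics.
Variables (a : C) (Ha : unit_disc a).
Let F := square a.

Let gap_pos (z : C) (Hz : unit_disc z) :
  0 < Cmod (1 - Cconj a * z) - Cmod (z - a) /\ 0 < Cmod (1 + Cconj a * z) - Cmod (z + a).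
Proof.
  split; [now apply hyperbolic_gap_pos|].
  pose proof (hyperbolic_gap_pos (- a) z (unit_disc_opp a Ha) Hz) as G.
  rewrite Copp_conj in G.
  replace (1 - - Cconj a * z)%C with (1 + Cconj a * z)%C in G by ring.
  now replace (z - - a)%C with (z + a)%C in G by ring.
Qed.

Let level_factors (z : C) :
  Cmod (1 - Cconj F * square z) = Cmod (1 - Cconj a * z) * Cmod (1 + Cconj a * z) /\
  Cmod (square z - F) = Cmod (z - a) * Cmod (z + a).
Proof.
  rewrite <- !Cmod_mult. unfold F, square. rewrite Cmult_conj. split; f_equal; ring.
Qed.

Let opposite_focus (z : C) :
  (1 - Cconj (- a) * z = 1 + Cconj a * z)%C /\ (1 + Cconj (- a) * z = 1 - Cconj a * z)%C /\
  (z - - a = z + a)%C.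
Proof. rewrite Copp_conj. repeat split; ring. Qed.

Let norm_identities (z : C) :
  Cmod (1 - Cconj a * z) ^ 2 - Cmod (z - a) ^ 2 = (1 - Cmod a ^ 2) * (1 - Cmod z ^ 2) /\
  Cmod (1 + Cconj a * z) ^ 2 - Cmod (z + a) ^ 2 = (1 - Cmod a ^ 2) * (1 - Cmod z ^ 2) /\
  Cmod (1 + Cconj a * z) ^ 2 + Cmod (z - a) ^ 2 = (1 + Cmod a ^ 2) * (1 + Cmod z ^ 2) /\
  Cmod (1 - Cconj a * z) ^ 2 + Cmod (z + a) ^ 2 = (1 + Cmod a ^ 2) * (1 + Cmod z ^ 2).
Proof.
  destruct (opposite_focus z) as (E1 & E2 & E3).
  pose proof (hyperbolic_norm_identity (- a) z) as H1.
  pose proof (spherical_norm_identity (- a) z) as H2. rewrite Cmod_opp, E3 in *.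
  rewrite E1 in H1. rewrite E2 in H2.
  repeat split; try assumption; [apply hyperbolic_norm_identity|apply spherical_norm_identity].
Qed.

(** [E] and [D] are the exponentials of half the sum and half the difference of the distances, so
    that E + / E and D + / D are twice the hyperbolic cosines of these halves. *)
Lemma hyperbolic_hooke_dist (z : C) : unit_disc z ->
  let E := (Cmod (1 - Cconj a * z) + Cmod (z - a)) * (Cmod (1 + Cconj a * z) + Cmod (z + a)) /
    ((1 - Cmod a ^ 2) * (1 - Cmod z ^ 2)) in
  let D := (Cmod (1 - Cconj a * z) + Cmod (z - a)) * (Cmod (1 + Cconj a * z) - Cmod (z + a)) /
    ((1 - Cmod a ^ 2) * (1 - Cmod z ^ 2)) in
  (0 < E /\ riem_dist hyperbolic_density z a + riem_dist hyperbolic_density z (- a) = ln (E ^ 2) /\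
   E + / E = 2 * (1 + Cmod a ^ 2) / sum_level F (square z)) /\
  (0 < D /\ riem_dist hyperbolic_density z a - riem_dist hyperbolic_density z (- a) = ln (D ^ 2) /\
   D + / D = 2 * (1 + Cmod a ^ 2) / diff_level F (square z)).
Proof.
  intros Hz E D. destruct (gap_pos z Hz) as [G1 G2].
  destruct (norm_identities z) as (N1 & N2 & _ & _).
  destruct (level_factors z) as [L1 L2]. destruct (opposite_focus z) as (O1 & _ & O3).
  pose proof (hyperbolic_norm_identity F (square z)) as N. rewrite L1, L2 in N.
  unfold sum_level, diff_level. rewrite L1, L2.
  assert (EF : Cmod F = Cmod a ^ 2) by apply Cmod_square. rewrite EF, Cmod_square in *.
  rewrite (hyperbolic_dist z a), (hyperbolic_dist z (- a)) by auto using unit_disc_opp.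
  rewrite O1, O3.
  pose proof (one_minus_sqr_pos a Ha) as Pa. pose proof (one_minus_sqr_pos z Hz) as Pz.
  pose proof (Cmod_ge_0 (z - a)) as Z1p. pose proof (Cmod_ge_0 (z + a)) as Z2p.
  assert (Pal : 0 <= Cmod a ^ 2) by apply pow2_ge_0. assert (PA : 0 <= Cmod z ^ 2) by apply pow2_ge_0.
  unfold E, D. clear E D L1 L2 O1 O3 EF.
  set (Y1 := Cmod (1 - Cconj a * z)) in *. set (Z1 := Cmod (z - a)) in *.
  set (Y2 := Cmod (1 + Cconj a * z)) in *. set (Z2 := Cmod (z + a)) in *.
  set (al := Cmod a ^ 2) in *. set (A := Cmod z ^ 2) in *.
  clearbody Y1 Z1 Y2 Z2 al A.
  set (Q := (1 - al) * (1 - A)) in *.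
  assert (HQ : 0 < Q) by now apply Rmult_lt_0_compat.
  (* Both factors on the right equal Q. Hence the inverse of [E] or [D] is obtained by changing the
     signs of Z1 and Z2, and the sum with its inverse loses its mixed terms. *)
  assert (HQQ : Q * Q = (Y1 ^ 2 - Z1 ^ 2) * (Y2 ^ 2 - Z2 ^ 2)) by (rewrite N1, N2; ring).
  assert (HYZ : 0 < Y1 * Y2 - Z1 * Z2) by nra.
  assert (HYZ' : 0 < Y1 * Y2 + Z1 * Z2) by nra.
  assert (HS : 0 < (Y1 + Z1) * (Y2 + Z2)) by nra.
  assert (HD : 0 < (Y1 + Z1) * (Y2 - Z2)) by nra.
  assert (HY : (1 - al) * (1 - A) = Q) by reflexivity. clearbody Q.
  split; (split; [now apply Rdiv_lt_0_compat|split]).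
  - rewrite <- ln_mult by (apply Rdiv_lt_0_compat; lra). f_equal.
    unfold Rdiv. rewrite Rpow_mult_distr, pow_inv. replace (Q ^ 2) with (Q * Q) by ring.
    rewrite HQQ. field. repeat split; nra.
  - replace (/ ((Y1 + Z1) * (Y2 + Z2) / Q)) with ((Y1 - Z1) * (Y2 - Z2) / Q).
    2:{ apply Rmult_eq_reg_r with (Q * ((Y1 + Z1) * (Y2 + Z2))); [|nra].
        field_simplify; [|nra|nra]. replace (Q ^ 2) with (Q * Q) by ring. rewrite HQQ. ring. }
    transitivity (2 * (Y1 * Y2 + Z1 * Z2) / Q); [field; lra|].
    apply Rmult_eq_reg_r with (Q * (Y1 * Y2 - Z1 * Z2)); [|nra].
    transitivity (2 * ((Y1 * Y2) ^ 2 - (Z1 * Z2) ^ 2)); [field; lra|]. rewrite N, <- HY. field. lra.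
  - rewrite <- ln_div by (apply Rdiv_lt_0_compat; lra). f_equal.
    unfold Rdiv. rewrite Rpow_mult_distr, pow_inv. replace (Q ^ 2) with (Q * Q) by ring.
    rewrite HQQ. field. repeat split; nra.
  - replace (/ ((Y1 + Z1) * (Y2 - Z2) / Q)) with ((Y1 - Z1) * (Y2 + Z2) / Q).
    2:{ apply Rmult_eq_reg_r with (Q * ((Y1 + Z1) * (Y2 - Z2))); [|nra].
        field_simplify; [|nra|nra]. replace (Q ^ 2) with (Q * Q) by ring. rewrite HQQ. ring. }
    transitivity (2 * (Y1 * Y2 - Z1 * Z2) / Q); [field; lra|].
    apply Rmult_eq_reg_r with (Q * (Y1 * Y2 + Z1 * Z2)); [|nra].
    transitivity (2 * ((Y1 * Y2) ^ 2 - (Z1 * Z2) ^ 2)); [field; lra|]. rewrite N, <- HY. field. lra.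
Qed.

(** Half the distances are angles of two right triangles with the same hypotenuse, so the addition
    theorem for the cosine involves only one denominator. The indices are crossed because on the
    sphere the distance to a is paired with |1 + conj a z|. *)
Lemma spherical_hooke_dist (z : C) : unit_disc z ->
  (exists x, 0 <= x <= PI /\
    riem_dist spherical_density z a + riem_dist spherical_density z (- a) = 2 * x /\
    cos x = sum_level F (square z) / (1 + Cmod a ^ 2)) /\
  (exists x, - PI <= x <= PI /\
    riem_dist spherical_density z a - riem_dist spherical_density z (- a) = 2 * x /\
    cos x = diff_level F (square z) / (1 + Cmod a ^ 2)).
Proof.
  intros Hz. destruct (gap_pos z Hz) as [G1 G2].
  destruct (norm_identities z) as (_ & _ & N1 & N2).
  destruct (level_factors z) as [L1 L2]. destruct (opposite_focus z) as (_ & O2 & O3).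
  unfold sum_level, diff_level. rewrite L1, L2, Cmod_square.
  rewrite (spherical_dist z a), (spherical_dist z (- a)) by auto using unit_disc_opp.
  rewrite O2, O3.
  pose proof (Cmod_ge_0 (z - a)) as Z1p. pose proof (Cmod_ge_0 (z + a)) as Z2p.
  assert (Pal : 0 <= Cmod a ^ 2) by apply pow2_ge_0. assert (PA : 0 <= Cmod z ^ 2) by apply pow2_ge_0.
  set (Y1 := Cmod (1 - Cconj a * z)) in *. set (Z1 := Cmod (z - a)) in *.
  set (Y2 := Cmod (1 + Cconj a * z)) in *. set (Z2 := Cmod (z + a)) in *.
  set (al := Cmod a ^ 2) in *. set (A := Cmod z ^ 2) in *.
  clearbody Y1 Z1 Y2 Z2 al A. clear L1 L2 O2 O3.
  assert (HP : 0 < (1 + al) * (1 + A)) by (apply Rmult_lt_0_compat; lra).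
  set (P := (1 + al) * (1 + A)) in *.
  (* A right triangle with legs Y and Z and hypotenuse sqrt P. *)
  assert (trig : forall Y Z, 0 < Y -> Y ^ 2 + Z ^ 2 = P ->
    cos (atan (Z / Y)) = Y / sqrt P /\ sin (atan (Z / Y)) = Z / sqrt P).
  { intros Y Z HY E. pose proof (sqrt_lt_R0 P HP).
    assert (ES : sqrt (1 + (Z / Y)²) = sqrt P / Y).
    { replace (1 + (Z / Y)²) with (P / Y ^ 2) by (rewrite <- E; unfold Rsqr; field; lra).
      rewrite sqrt_div_alt by nra. now rewrite sqrt_pow2 by lra. }
    rewrite cos_atan, sin_atan, ES. split; field; lra. }
  destruct (trig Y2 Z1 ltac:(lra) N1) as [C1 S1]. destruct (trig Y1 Z2 ltac:(lra) N2) as [C2 S2].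
  pose proof (atan_bound (Z1 / Y2)). pose proof (atan_bound (Z2 / Y1)).
  pose proof (sqrt_lt_R0 P HP) as HsP. pose proof (sqrt_sqrt P ltac:(lra)) as HPP.
  assert (atan_nonneg : forall r, 0 <= r -> 0 <= atan r).
  { intros r [Hr | <-]; [|rewrite atan_0; lra].
    left. rewrite <- atan_0. now apply atan_increasing. }
  pose proof (atan_nonneg (Z1 / Y2) ltac:(apply Rdiv_le_0_compat; lra)).
  pose proof (atan_nonneg (Z2 / Y1) ltac:(apply Rdiv_le_0_compat; lra)).
  split.
  - exists (atan (Z1 / Y2) + atan (Z2 / Y1)). split; [lra|]. split; [ring|].
    rewrite cos_plus, C1, S1, C2, S2.
    transitivity ((Y1 * Y2 - Z1 * Z2) / (sqrt P * sqrt P)); [field; lra|].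
    rewrite HPP. unfold P. field. lra.
  - exists (atan (Z1 / Y2) - atan (Z2 / Y1)). split; [lra|]. split; [ring|].
    rewrite cos_minus, C1, S1, C2, S2.
    transitivity ((Y1 * Y2 + Z1 * Z2) / (sqrt P * sqrt P)); [field; lra|].
    rewrite HPP. unfold P. field. lra.
Qed.
End HookeConics.

Lemma Rmult_div_eq_iff (k u v : R) : k <> 0 -> (u / k = v / k <-> u = v).
Proof.
  intros Hk. split; [|now intros ->]. intros E.
  apply Rmult_eq_reg_r with (/ k); [exact E|now apply Rinv_neq_0_compat].
Qed.

Lemma Rdiv_eq_iff (k u v : R) : k <> 0 -> u <> 0 -> v <> 0 -> (k / u = k / v <-> u = v).
Proof.
  intros Hk Hu Hv. split; [|now intros ->]. intros E.
  apply Rinv_eq_reg, (Rmult_eq_reg_l k); assumption.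
Qed.

(** * Correspondence between focused and centered conics *)

Section Correspondence.
Variables (a : C) (Ha : unit_disc a).
Let F := square a.
Let HF : unit_disc F.
Proof. now apply unit_disc_square. Qed.

Let K (q : C) := riem_dist hyperbolic_density q 0 + riem_dist hyperbolic_density q F.
Let N (q : C) := riem_dist hyperbolic_density q 0 - riem_dist hyperbolic_density q F.

Lemma kepler_sum_eq_iff (q q' : C) : unit_disc q -> unit_disc q' ->
  (K q = K q' <-> sum_level F q = sum_level F q').
Proof.
  intros H H'. unfold K. rewrite !kepler_sum_dist by assumption.
  apply ln_over_square_inj; auto using one_minus_sqr_pos, sum_level_pos.
Qed.

Lemma kepler_diff_eq_iff (q q' : C) : unit_disc q -> unit_disc q' ->
  (N q = N q' <-> diff_level F q = diff_level F q').
Proof.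
  intros H H'. unfold N. rewrite !kepler_diff_dist by assumption.
  apply ln_over_square_inj; auto using one_minus_sqr_pos, diff_level_pos.
Qed.

(** Comparing two points avoids an explicit relation between the constants of corresponding conics.
    A signed difference faces an absolute value because z and - z have the same square, while z to -
    z exchanges the distances to a and - a: one Kepler branch comes from both Hooke branches. *)
Definition same_levels (rho : C -> R) : Prop := forall z z', unit_disc z -> unit_disc z' ->
  (riem_dist rho z a + riem_dist rho z (- a) = riem_dist rho z' a + riem_dist rho z' (- a) <->
   K (square z) = K (square z')) /\
  (Rabs (riem_dist rho z a - riem_dist rho z (- a)) =
   Rabs (riem_dist rho z' a - riem_dist rho z' (- a)) <->
   N (square z) = N (square z')).

Lemma spherical_same_levels : same_levels spherical_density.
Proof.
  intros z z' Hz Hz'.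
  destruct (spherical_hooke_dist a Ha z Hz) as [(x & Bx & Sx & Cx) (y & By & Dy & Cy)].
  destruct (spherical_hooke_dist a Ha z' Hz') as [(x' & Bx' & Sx' & Cx') (y' & By' & Dy' & Cy')].
  rewrite kepler_sum_eq_iff, kepler_diff_eq_iff by now apply unit_disc_square.
  pose proof (pow2_ge_0 (Cmod a)). rewrite Sx, Sx', Dy, Dy'. split.
  - rewrite <- (Rabs_pos_eq (2 * x)), <- (Rabs_pos_eq (2 * x')) by lra.
    rewrite abs_eq_iff_cos, Cx, Cx' by lra. apply Rmult_div_eq_iff. lra.
  - rewrite abs_eq_iff_cos, Cy, Cy' by assumption. apply Rmult_div_eq_iff. lra.
Qed.

Lemma hyperbolic_same_levels : same_levels hyperbolic_density.
Proof.
  intros z z' Hz Hz'.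
  destruct (hyperbolic_hooke_dist a Ha z Hz) as [(PE & SE & CE) (PD & SD & CD)].
  destruct (hyperbolic_hooke_dist a Ha z' Hz') as [(PE' & SE' & CE') (PD' & SD' & CD')].
  fold F in CE, CD, CE', CD'.
  pose proof (unit_disc_square z) as [_ Hq]. pose proof (unit_disc_square z') as [_ Hq'].
  specialize (Hq Hz). specialize (Hq' Hz').
  pose proof (sum_level_pos F _ HF Hq). pose proof (sum_level_pos F _ HF Hq').
  pose proof (diff_level_pos F _ HF Hq). pose proof (diff_level_pos F _ HF Hq').
  rewrite kepler_sum_eq_iff, kepler_diff_eq_iff by assumption.
  pose proof (pow2_ge_0 (Cmod a)). split.
  - assert (P : forall w, unit_disc w ->
      0 <= riem_dist hyperbolic_density w a + riem_dist hyperbolic_density w (- a)).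
    { intros w Hw. apply Rplus_le_le_0_compat; apply hyperbolic_dist_ge_0; auto using unit_disc_opp. }
    rewrite <- (Rabs_pos_eq _ (P z Hz)), <- (Rabs_pos_eq _ (P z' Hz')).
    rewrite SE, SE', abs_ln_sqr_eq_iff, CE, CE' by assumption. apply Rdiv_eq_iff; lra.
  - rewrite SD, SD', abs_ln_sqr_eq_iff, CD, CD' by assumption. apply Rdiv_eq_iff; lra.
Qed.

(** A single point of the curve determines the constant of the corresponding conic, and
    [same_levels] then compares every other point with it. Only empty curves have no such point. *)
Lemma conic_correspondence (rho : C -> R) : same_levels rho ->
  (forall X, conic_branch hyperbolic_density 0%C F X -> conic rho a (- a)%C (preimage X)) /\
  (forall Y, conic rho a (- a)%C Y ->
     exists X, conic_branch hyperbolic_density 0%C F X /\ forall z, Y z <-> preimage X z).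
Proof.
  intros Hrho.
  (* The constant -1 describes an empty conic, which represents the empty curves on either side. *)
  assert (nosum : forall q, ~ ellipse hyperbolic_density 0 F (-1) q).
  { intros q [Hq E].
    pose proof (hyperbolic_dist_ge_0 q 0 Hq unit_disc_0).
    pose proof (hyperbolic_dist_ge_0 q F Hq HF). lra. }
  assert (nodiff : forall q, ~ hyperbola rho a (- a) (-1) q).
  { intros q [_ E]. pose proof (Rabs_pos (riem_dist rho q a - riem_dist rho q (- a))). lra. }
  split.
  - intros X (c & HX).
    destruct (classic (exists z0, preimage X z0)) as [(z0 & Hz0 & Xz0) | none].
    + destruct HX as [HX | HX]; apply HX in Xz0 as [_ E0].
      * exists (riem_dist rho z0 a + riem_dist rho z0 (- a)). left. intros z.
        unfold preimage, ellipse. rewrite HX. unfold ellipse. rewrite unit_disc_square, <- E0.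
        split; [intros (Hz & _ & E)|intros (Hz & E); split; [|split]]; try assumption.
        -- split; [exact Hz|]. now apply (Hrho z z0 Hz Hz0).
        -- now apply (Hrho z z0 Hz Hz0).
      * exists (Rabs (riem_dist rho z0 a - riem_dist rho z0 (- a))). right. intros z.
        unfold preimage, hyperbola. rewrite HX. unfold hyperbola_branch.
        rewrite unit_disc_square, <- E0.
        split; [intros (Hz & _ & E)|intros (Hz & E); split; [|split]]; try assumption.
        -- split; [exact Hz|]. now apply (Hrho z z0 Hz Hz0).
        -- now apply (Hrho z z0 Hz Hz0).
    + exists (-1). right. intros z. split; intros H; exfalso; [|now apply (nodiff z)].
      apply none. now exists z.
  - intros Y (c & HY).
    destruct (classic (exists z0, Y z0)) as [(z0 & Yz0) | none].
    + destruct HY as [HY | HY]; pose proof Yz0 as Yz1; apply HY in Yz1 as [Hz0 E0].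
      * exists (ellipse hyperbolic_density 0 F (K (square z0))). split.
        -- exists (K (square z0)). left. reflexivity.
        -- intros z. rewrite HY. unfold preimage, ellipse. rewrite unit_disc_square, <- E0.
           split; [intros (Hz & E); split; [|split]|intros (Hz & _ & E); split]; try assumption;
           now apply (Hrho z z0 Hz Hz0).
      * exists (hyperbola_branch hyperbolic_density 0 F (N (square z0))). split.
        -- exists (N (square z0)). right. reflexivity.
        -- intros z. rewrite HY. unfold preimage, hyperbola, hyperbola_branch.
           rewrite unit_disc_square, <- E0.
           split; [intros (Hz & E); split; [|split]|intros (Hz & _ & E); split]; try assumption;
           now apply (Hrho z z0 Hz Hz0).
    + exists (ellipse hyperbolic_density 0 F (-1)). split.
      * exists (-1). left. reflexivity.
      * intros z. split; intros H; exfalso; [apply none; now exists z|].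
        destruct H as [_ H]. now apply (nosum (square z)).
Qed.

(** * The South pole as the midpoint of the Hooke foci *)

Let focus_moduli :
  Cmod (1 + Cconj (- a) * a) = 1 - Cmod a ^ 2 /\ Cmod (1 - Cconj (- a) * a) = 1 + Cmod a ^ 2 /\
  Cmod (a - - a) = 2 * Cmod a.
Proof.
  pose proof (one_minus_sqr_pos a Ha). pose proof (pow2_ge_0 (Cmod a)).
  repeat split.
  - replace (1 + Cconj (- a) * a)%C with (RtoC (1 - Cmod a ^ 2)).
    + rewrite Cmod_R, Rabs_pos_eq; lra.
    + rewrite RtoC_minus, Cmod2_conj, Copp_conj. ring.
  - replace (1 - Cconj (- a) * a)%C with (RtoC (1 + Cmod a ^ 2)).
    + rewrite Cmod_R, Rabs_pos_eq; lra.
    + rewrite RtoC_plus, Cmod2_conj, Copp_conj. ring.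
  - replace (a - - a)%C with (2 * a)%C by ring. rewrite Cmod_mult, Cmod_R, Rabs_pos_eq; lra.
Qed.

Let center_moduli (b : C) :
  Cmod (0 - b) = Cmod b /\ Cmod (b - 0) = Cmod b /\
  Cmod (1 + Cconj b * 0) = 1 /\ Cmod (1 + Cconj 0 * b) = 1 /\
  Cmod (1 - Cconj b * 0) = 1 /\ Cmod (1 - Cconj 0 * b) = 1.
Proof.
  replace (0 - b)%C with (- b)%C by ring. replace (b - 0)%C with b by ring.
  replace (Cconj 0) with (RtoC 0) by (apply C_ext; simpl; ring).
  rewrite Cmod_opp. repeat split; (transitivity (Cmod 1); [f_equal; ring|apply Cmod_1]).
Qed.

Lemma spherical_midpoint : midpoint spherical_density 0%C a (- a)%C.
Proof.
  pose proof unit_disc_0 as H0. pose proof (unit_disc_opp a Ha) as Ha'.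
  destruct focus_moduli as (M1 & _ & M3). pose proof (center_moduli a) as (_ & C1 & _ & C2 & _).
  pose proof (center_moduli (- a)) as (C3 & _ & C4 & _).
  unfold midpoint. rewrite !spherical_dist by assumption.
  rewrite M1, M3, C1, C2, C3, C4, Cmod_opp, Rdiv_1_r.
  assert (Hr : 0 <= Cmod a < 1) by (split; [apply Cmod_ge_0|exact Ha]).
  generalize dependent (Cmod a). intros r _ _ _ _ Hr. clear -Hr.
  assert (E : atan (2 * r / (1 - r ^ 2)) = 2 * atan r); [|lra].
  assert (Hat : 0 <= atan r < PI / 4).
  { split.
    - destruct (proj1 Hr) as [P | <-]; [|rewrite atan_0; lra].
      left. rewrite <- atan_0. now apply atan_increasing.
    - rewrite <- atan_1. now apply atan_increasing. }
  pose proof PI_RGT_0.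
  rewrite <- (atan_tan (2 * atan r)) by lra. f_equal. rewrite tan_2a, tan_atan.
  - f_equal. ring.
  - apply Rgt_not_eq, cos_gt_0; lra.
  - apply Rgt_not_eq, cos_gt_0; lra.
  - rewrite tan_atan. nra.
Qed.

Lemma hyperbolic_midpoint : midpoint hyperbolic_density 0%C a (- a)%C.
Proof.
  pose proof unit_disc_0 as H0. pose proof (unit_disc_opp a Ha) as Ha'.
  destruct focus_moduli as (_ & M2 & M3). pose proof (center_moduli a) as (_ & C1 & _ & _ & _ & C2).
  pose proof (center_moduli (- a)) as (C3 & _ & _ & _ & C4 & _).
  unfold midpoint. rewrite !hyperbolic_dist by assumption.
  rewrite M2, M3, C1, C2, C3, C4, Cmod_opp.
  assert (Hr : 0 <= Cmod a < 1) by (split; [apply Cmod_ge_0|exact Ha]).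
  generalize dependent (Cmod a). intros r _ _ _ _ Hr. clear -Hr.
  assert (E : ln ((1 + r ^ 2 + 2 * r) / (1 + r ^ 2 - 2 * r)) = 2 * ln ((1 + r) / (1 - r))); [|lra].
  replace (2 * ln ((1 + r) / (1 - r))) with (ln (((1 + r) / (1 - r)) ^ 2)).
  - f_equal. field. split; nra.
  - rewrite ln_pow by (apply Rdiv_lt_0_compat; lra). simpl. ring.
Qed.
End Correspondence.

(** * Tangent directions of conics *)


(* A level curve of the sum or of the difference of the distances to 0 and F,
   according to the sign [sg]. *)
Lemma conic_branch_level (F : C) (X : C -> Prop) : unit_disc F ->
  conic_branch hyperbolic_density 0%C F X ->
  exists sg k, sg * sg = 1 /\ forall q, X q -> unit_disc q /\
    Cmod (1 - Cconj F * q) - sg * Cmod (q - F) = k * (1 + Cmod q).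
Proof.
  intros HF (c & HX). pose proof (one_minus_sqr_pos F HF) as Pk.
  assert (key : forall u, 0 < u -> ln ((1 - Cmod F ^ 2) / u ^ 2) = c ->
    u = sqrt ((1 - Cmod F ^ 2) / exp c)).
  { intros u Hu <-. rewrite exp_ln by (apply Rdiv_lt_0_compat; nra).
    replace ((1 - Cmod F ^ 2) / ((1 - Cmod F ^ 2) / u ^ 2)) with (u ^ 2) by (field; lra).
    now rewrite sqrt_pow2 by lra. }
  destruct HX as [HX | HX];
  [exists 1, (sqrt ((1 - Cmod F ^ 2) / exp c))|exists (-1), (sqrt ((1 - Cmod F ^ 2) / exp c))];
  (split; [ring|]); intros q Xq; apply HX in Xq as [Hq E]; (split; [exact Hq|]);
  pose proof (Cmod_ge_0 q).
  - rewrite kepler_sum_dist in E by assumption.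
    rewrite <- (key _ (sum_level_pos F q HF Hq) E). unfold sum_level. field. lra.
  - rewrite kepler_diff_dist in E by assumption.
    rewrite <- (key _ (diff_level_pos F q HF Hq) E). unfold diff_level. field. lra.
Qed.

(** A curve in the wall need not follow the parametrized arcs; for its velocity it only matters that
    finitely many conics cover the wall. *)
Lemma combination_cover (family : (C -> Prop) -> Prop) (W : C -> Prop) :
  combination family W ->
  exists L, (forall X, In X L -> family X) /\ (forall q, W q -> exists X, In X L /\ X q).
Proof.
  intros (arcs & vertices & Harcs & Hvert & HW).
  assert (LA : exists L, (forall X, In X L -> family X) /\
    forall g t, In g arcs -> open_unit t -> exists X, In X L /\ X (g t)).
  { clear HW. induction arcs as [|g arcs IH].
    - exists nil. split; [intros _ []|intros _ _ []].
    - destruct IH as (L & HL & Hcov); [intros h Hh; apply Harcs; now right|].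
      destruct (Harcs g (or_introl eq_refl)) as (_ & _ & X & HX & Xg).
      exists (X :: L). split; [intros Y [<- | HY]; auto|].
      intros h t [<- | Hh] Ht; [exists X; split; [now left|auto]|].
      destruct (Hcov h t Hh Ht) as (Y & HY & Yh). exists Y. split; [now right|exact Yh]. }
  assert (LV : exists L, (forall X, In X L -> family X) /\
    forall v, In v vertices -> exists X, In X L /\ X v).
  { clear HW. induction vertices as [|v vertices IH].
    - exists nil. split; intros _ [].
    - destruct IH as (L & HL & Hcov); [intros w Hw; apply Hvert; now right|].
      destruct (Hvert v (or_introl eq_refl)) as (X & HX & Xv).
      exists (X :: L). split; [intros Y [<- | HY]; auto|].
      intros w [<- | Hw]; [exists X; split; [now left|auto]|].
      destruct (Hcov w Hw) as (Y & HY & Yh). exists Y. split; [now right|exact Yh]. }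
  destruct LA as (L1 & F1 & C1), LV as (L2 & F2 & C2). exists (L1 ++ L2). split.
  - intros X HX. apply in_app_or in HX. destruct HX; auto.
  - intros q Hq. apply HW in Hq. destruct Hq as [(g & t & Hg & Ht & ->) | Hq].
    + destruct (C1 g t Hg Ht) as (X & HX & Xg). exists X. split; [apply in_or_app; now left|exact Xg].
    + destruct (C2 q Hq) as (X & HX & Xg). exists X. split; [apply in_or_app; now right|exact Xg].
Qed.

(** t is an accumulation point of [P]; t itself is excluded. *)
Definition clusters (P : R -> Prop) (t : R) : Prop :=
  forall d, 0 < d -> exists s, 0 < Rabs (s - t) < d /\ P s.

(** Pigeonhole principle: if every member of the list were avoided on some punctured neighbourhood
    of t, the smallest of these finitely many radii would leave a time that is not covered. This
    replaces the false claim that a curve in the wall stays on one conic near t. *)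
Lemma finite_cover_clusters {A : Type} (L : list A) (P : A -> R -> Prop) (t : R) :
  locally t (fun s => exists X, In X L /\ P X s) -> exists X, In X L /\ clusters (P X) t.
Proof.
  intros [e He]. apply NNPP. intros none.
  assert (H : exists d, 0 < d /\ forall X s, In X L -> 0 < Rabs (s - t) < d -> ~ P X s).
  { assert (none' : forall X, In X L -> ~ clusters (P X) t).
    { intros X HX HC. apply none. now exists X. }
    clear none He. induction L as [|X L IH].
    - exists 1. split; [lra|]. intros _ _ [].
    - destruct IH as (d & Hd & H); [intros Y HY; apply none'; now right|].
      destruct (not_all_ex_not _ _ (none' X (or_introl eq_refl))) as (d' & Hd').
      apply imply_to_and in Hd' as [Hd' N].
      exists (Rmin d d'). split; [now apply Rmin_glb_lt|].
      intros Y s HY [Hs1 Hs2] PY. destruct HY as [<- | HY].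
      + apply N. exists s. split; [split; [exact Hs1|]|exact PY].
        eapply Rlt_le_trans; [exact Hs2|apply Rmin_r].
      + apply (H Y s HY); [split; [exact Hs1|]|exact PY].
        eapply Rlt_le_trans; [exact Hs2|apply Rmin_l]. }
  destruct H as (d & Hd & H). pose proof (cond_pos e) as Hpe.
  set (r := Rmin d e / 2).
  assert (Hr : 0 < r /\ r < d /\ r < e).
  { unfold r. pose proof (Rmin_l d e). pose proof (Rmin_r d e).
    assert (0 < Rmin d e) by now apply Rmin_glb_lt. lra. }
  assert (Ha : Rabs (t + r - t) = r) by (replace (t + r - t) with r by ring; apply Rabs_pos_eq; lra).
  destruct (He (t + r)) as (X & HX & PX).
  - change (Rabs (t + r - t) < e). lra.
  - apply (H X (t + r) HX); [lra|exact PX].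
Qed.

Lemma continuous_clusters_zero (f : R -> R) (t : R) :
  continuous f t -> clusters (fun s => f s = 0) t -> f t = 0.
Proof.
  intros Hc HC. apply NNPP. intros Hn.
  assert (He : 0 < Rabs (f t)) by now apply Rabs_pos_lt.
  destruct (proj1 (filterlim_locally _ _) Hc (mkposreal _ He)) as [d Hd].
  destruct (HC d (cond_pos d)) as (s & [Hs1 Hs2] & Es).
  specialize (Hd s Hs2). change (Rabs (f s - f t) < Rabs (f t)) in Hd.
  rewrite Es, Rminus_0_l, Rabs_Ropp in Hd. lra.
Qed.

Lemma derivative_clusters_zero (f : R -> R) (t l : R) :
  is_derive f t l -> clusters (fun s => f s = 0) t -> f t = 0 /\ l = 0.
Proof.
  intros Hf HC.
  assert (E : f t = 0).
  { apply continuous_clusters_zero; [|exact HC].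
    apply (ex_derive_continuous (V := R_NormedModule) f). eexists; exact Hf. }
  split; [exact E|]. apply NNPP. intros Hn.
  assert (He : 0 < Rabs l) by now apply Rabs_pos_lt.
  apply is_derive_Reals in Hf. destruct (Hf (Rabs l) He) as [d Hd].
  destruct (HC d (cond_pos d)) as (s & [Hs1 Hs2] & Es).
  specialize (Hd (s - t)). replace (t + (s - t)) with s in Hd by ring.
  rewrite Es, E in Hd.
  assert (Hst : s - t <> 0) by (intros Z; rewrite Z, Rabs_R0 in Hs1; lra).
  specialize (Hd Hst Hs2). replace ((0 - 0) / (s - t) - l) with (- l) in Hd by (field; assumption).
  rewrite Rabs_Ropp in Hd. lra.
Qed.

(* The directions of the conics with foci 0 and F through q are the two directions tau for which the
   quadratic differential dq^2 / (q (F - q) (1 - conj F q)) is real. *)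
Definition conic_form (F q tau : C) : R :=
  Im ((F - q) * (1 - Cconj F * q) * q * (Cconj tau * Cconj tau)).

(** Put A = |q|, Z = |q - F|, Y = |1 - conj F q|, N2 = A dA and N1 = Z dZ. The left side is then (A
    Z)^2 times the difference of the squares of (1 - A^2) dZ + A Z dA and Y dA, which agree up to
    sign along a conic. The factor Im (conj F q) on the right is the reason why the axis needs its
    own argument. *)
Lemma conic_form_identity (F q tau : C) :
  let N1 := Re (q - F) * Re tau + Im (q - F) * Im tau in
  let N2 := Re q * Re tau + Im q * Im tau in
  Cmod q ^ 2 * ((1 - Cmod q ^ 2) * N1 + Cmod (q - F) ^ 2 * N2) ^ 2 -
    Cmod (1 - Cconj F * q) ^ 2 * Cmod (q - F) ^ 2 * N2 ^ 2 =
  (1 - Cmod q ^ 2) * Im (Cconj F * q) * conic_form F q tau.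
Proof.
  intros N1 N2. unfold N1, N2, conic_form. rewrite !Cmod2_alt.
  destruct F, q, tau. simpl. ring.
Qed.

(** Eliminating k, ka and dY from the level equation, the norm identity and their derivatives leaves
    a relation in which the kind of conic survives only as the sign [sg]; squaring removes even
    that, so ellipses and hyperbolas obey one quadratic equation. *)
Lemma level_derivative_identity (A Y Z dA dY dZ sg k ka : R) :
  sg * sg = 1 -> Y - sg * Z = k * (1 + A) -> dY - sg * dZ = k * dA ->
  Y ^ 2 - Z ^ 2 = ka * (1 - A ^ 2) -> Y * dY - Z * dZ = - ka * (A * dA) ->
  0 < Y - Z -> 0 <= Z ->
  (1 - A ^ 2) * dZ + A * Z * dA = - sg * Y * dA.
Proof.
  intros Hsg E1 E2 E3 E4 Hp HZ.
  assert (Hn : Y - sg * Z <> 0).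
  { destruct (sign_cases sg Hsg) as [-> | ->]; nra. }
  (* This factor is nonzero because Y > Z >= 0; multiplying by it lets the level equation replace k
     (1 + A). *)
  apply Rmult_eq_reg_l with (sg * (Y - sg * Z)).
  2:{ apply Rmult_integral_contrapositive_currified; [nra|exact Hn]. }
  assert (E5 : (dY - sg * dZ) * (1 + A) = (Y - sg * Z) * dA) by (rewrite E1, E2; ring).
  assert (E6 : Y * dY * (1 - A ^ 2) = Z * dZ * (1 - A ^ 2) - (Y ^ 2 - Z ^ 2) * (A * dA)).
  { replace (Y * dY) with (Z * dZ - ka * (A * dA)) by lra. rewrite E3. ring. }
  assert (E7 : Y * (dY - sg * dZ) * (1 - A ^ 2) = Y * (Y - sg * Z) * dA * (1 - A)).
  { transitivity (Y * ((dY - sg * dZ) * (1 + A)) * (1 - A)); [ring|]. rewrite E5. ring. }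
  clear - Hsg E6 E7. destruct (sign_cases sg Hsg) as [-> | ->]; lra.
Qed.

Section TangentDirections.
Variables (F : C) (HF : unit_disc F) (HF0 : F <> 0%C).
Variables (W : C -> Prop) (HW : combination (conic_branch hyperbolic_density 0%C F) W).

(** The points 0 and F lie on the axis, so away from it all three moduli are differentiable. A conic
    that the curve meets at times accumulating at t forces both its level equation and the
    derivative of that equation at t. *)
Lemma conic_form_off_axis (I : R -> Prop) (g : R -> C) (t : R) :
  open I -> C1_on I g -> (forall s, I s -> W (g s)) -> I t -> Im (Cconj F * g t) <> 0 ->
  conic_form F (g t) (velocity_of g t) = 0.
Proof.
  intros HI Hg HWg Ht Hoff.
  destruct (combination_cover _ _ HW) as (L & HL & Hcov).
  destruct (finite_cover_clusters L (fun X s => X (g s)) t) as (X & HX & HC).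
  { generalize (HI t Ht). apply filter_imp. intros s Hs. apply Hcov, HWg, Hs. }
  destruct (conic_branch_level F X HF (HL X HX)) as (sg & k & Hsg & Hlev).
  pose proof (C1_on_has_velocity I g t Hg Ht) as Hv. set (tau := velocity_of g t) in *.
  assert (N0 : g t <> 0%C) by (intros E; apply Hoff; rewrite E; simpl; ring).
  assert (NF : (g t - F)%C <> 0%C).
  { intros E. apply Hoff. replace (g t) with (g t - F + F)%C by ring. rewrite E. simpl. ring. }
  assert (Hq : unit_disc (g t)).
  { destruct (Hcov (g t) (HWg t Ht)) as (X' & HX' & Xg).
    destruct (conic_branch_level F X' HF (HL X' HX')) as (sg' & k' & _ & Hlev'). now apply Hlev'. }
  pose proof (hyperbolic_gap_pos F (g t) HF Hq) as Gap.
  pose proof (hyperbolic_norm_identity F (g t)) as NI.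
  pose proof (Cmod_ge_0 (g t - F)) as HZ0.
  assert (NY : (1 - Cconj F * g t)%C <> 0%C) by (apply Cmod_gt_0; lra).
  assert (VZ : has_velocity (fun s => g s - F)%C t tau).
  { eapply has_velocity_eq; [apply has_velocity_minus; [exact Hv|apply has_velocity_const]|]. ring. }
  assert (VY : has_velocity (fun s => 1 - Cconj F * g s)%C t (- (Cconj F * tau))%C).
  { eapply has_velocity_eq.
    - apply has_velocity_minus; [apply has_velocity_const|].
      apply has_velocity_mult; [apply has_velocity_const|exact Hv].
    - cbv beta; ring. }
  pose proof (is_derive_Cmod _ _ _ Hv N0) as DA.
  pose proof (is_derive_Cmod _ _ _ VZ NF) as DZ.
  pose proof (is_derive_Cmod _ _ _ VY NY) as DY. cbv beta in DZ, DY.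
  match type of DA with is_derive _ _ ?d => set (dA := d) in * end.
  match type of DZ with is_derive _ _ ?d => set (dZ := d) in * end.
  match type of DY with is_derive _ _ ?d => set (dY := d) in * end.
  destruct (derivative_clusters_zero
    (fun s => Cmod (1 - Cconj F * g s) - sg * Cmod (g s - F) - k * (1 + Cmod (g s))) t
    (dY - sg * dZ - k * dA)) as [E1 E2].
  - apply (is_derive_Rminus (fun s => Cmod (1 - Cconj F * g s) - sg * Cmod (g s - F))
      (fun s => k * (1 + Cmod (g s)))).
    + apply (is_derive_Rminus (fun s => Cmod (1 - Cconj F * g s)) (fun s => sg * Cmod (g s - F)));
      [exact DY|]. now apply is_derive_scal.
    + apply is_derive_scal. eapply is_derive_eq.
      * apply (is_derive_Rplus (fun _ => 1) (fun s => Cmod (g s)) t 0); [|exact DA].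
        apply (is_derive_const (V := R_NormedModule)).
      * ring.
  - intros d Hd. destruct (HC d Hd) as (s & Hs & Xs). exists s. split; [exact Hs|].
    destruct (Hlev _ Xs) as [_ E]. lra.
  - assert (PA : 0 < Cmod (g t)) by now apply Cmod_gt_0.
    assert (PZ : 0 < Cmod (g t - F)) by now apply Cmod_gt_0.
    assert (PY : 0 < Cmod (1 - Cconj F * g t)) by now apply Cmod_gt_0.
    assert (EA : Cmod (g t) * dA = Re (g t) * Re tau + Im (g t) * Im tau)
      by (unfold dA; field; lra).
    assert (EZ : Cmod (g t - F) * dZ = Re (g t - F) * Re tau + Im (g t - F) * Im tau)
      by (unfold dZ; field; lra).
    assert (EY : Cmod (1 - Cconj F * g t) * dY =
      Re (1 - Cconj F * g t) * Re (- (Cconj F * tau)) + Im (1 - Cconj F * g t) * Im (- (Cconj F * tau)))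
      by (unfold dY; field; lra).
    clearbody dA dZ dY.
    assert (LD : (1 - Cmod (g t) ^ 2) * dZ + Cmod (g t) * Cmod (g t - F) * dA =
      - sg * Cmod (1 - Cconj F * g t) * dA).
    { apply (level_derivative_identity _ _ _ _ dY _ sg k (1 - Cmod F ^ 2)); try lra.
      rewrite EA, EZ, EY, Cmod2_alt. clear. destruct F, (g t), tau. simpl. ring. }
    pose proof (conic_form_identity F (g t) tau) as CI. cbv zeta in CI.
    rewrite <- EA, <- EZ in CI.
    assert (Z0 : (1 - Cmod (g t) ^ 2) * Im (Cconj F * g t) * conic_form F (g t) tau = 0).
    { rewrite <- CI.
      transitivity ((Cmod (g t) * Cmod (g t - F)) ^ 2 *
        (((1 - Cmod (g t) ^ 2) * dZ + Cmod (g t) * Cmod (g t - F) * dA) ^ 2 -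
         (Cmod (1 - Cconj F * g t) * dA) ^ 2)); [ring|].
      rewrite LD. destruct (sign_cases sg Hsg) as [-> | ->]; ring. }
    apply Rmult_integral in Z0. destruct Z0 as [Z0 | Z0]; [|exact Z0].
    apply Rmult_integral in Z0. pose proof (one_minus_sqr_pos _ Hq). destruct Z0; [lra|contradiction].
Qed.

(** Both q and tau are real multiples of F, so the conjugate of F squared coming from tau meets F
    squared, and the product is real. *)
Lemma conic_form_on_axis (q tau : C) :
  Im (Cconj F * q) = 0 -> Im (Cconj F * tau) = 0 -> conic_form F q tau = 0.
Proof.
  intros H1 H2.
  assert (scal : forall z, Im (Cconj F * z) = 0 -> exists r : R, z = (r * F)%C).
  { intros z Hz. pose proof (C_neq0 F HF0) as P.
    exists ((Re F * Re z + Im F * Im z) / (Re F ^ 2 + Im F ^ 2)).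
    destruct F as [f1 f2], z as [x y]. simpl in Hz, P |- *.
    assert (E : f1 * y = f2 * x) by lra.
    assert (Q : f1 * f1 + f2 * f2 <> 0) by lra.
    apply C_ext; simpl; apply Rmult_eq_reg_r with (f1 * f1 + f2 * f2); try exact Q.
    - transitivity (f1 * f1 * x + f2 * (f1 * y)); [rewrite E; ring|field; lra].
    - transitivity (f1 * (f2 * x) + f2 * f2 * y); [rewrite <- E; ring|field; lra]. }
  destruct (scal q H1) as [r ->], (scal tau H2) as [s ->].
  unfold conic_form. destruct F. simpl. ring.
Qed.

Lemma conic_form_along_wall (I : R -> Prop) (g : R -> C) (t : R) :
  open I -> C1_on I g -> (forall s, I s -> W (g s)) -> I t ->
  conic_form F (g t) (velocity_of g t) = 0.
Proof.
  intros HI Hg HWg Ht. apply NNPP. intros Hn.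
  pose proof (C1_on_has_velocity I g t Hg Ht) as Hv.
  assert (Hc : continuous (fun s => conic_form F (g s) (velocity_of g s)) t).
  { pose proof (has_velocity_continuous _ _ _ Hv). destruct (Hg t Ht) as (_ & _ & Hcv).
    unfold conic_form. complex_cont. }
  (* Off the axis the form vanishes, so near t the wall stays on the axis. *)
  assert (Hax : locally t (fun s => Im (Cconj F * g s) = 0)).
  { assert (L : locally t (fun s => conic_form F (g s) (velocity_of g s) <> 0)).
    { apply (Hc (fun r => r <> 0)). apply (open_neq 0). exact Hn. }
    generalize (filter_and _ _ L (HI t Ht)). apply filter_imp. intros s [Hs Is].
    apply NNPP. intros Hoff. apply Hs. now apply (conic_form_off_axis I). }
  apply Hn, conic_form_on_axis; [now apply locally_singleton in Hax|].
  destruct (has_velocity_mult (fun _ => Cconj F) g t _ _ (has_velocity_const _ _) Hv) as [_ D].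
  replace (Im (Cconj F * velocity_of g t))
    with (Im (0 * g t + Cconj F * velocity_of g t)) by (f_equal; ring).
  transitivity (Derive (fun s => Im (Cconj F * g s)) t); [symmetry; now apply is_derive_unique|].
  apply is_derive_unique. apply (is_derive_ext_loc (fun _ => 0)).
  - revert Hax. apply filter_imp. intros s E. symmetry. exact E.
  - apply (is_derive_const (V := R_NormedModule)).
Qed.

Lemma open_symmetric_interval (e : R) : open (fun t => - e < t < e).
Proof. apply open_and; [apply open_gt|apply open_lt]. Qed.

Lemma tangent_conic_form (q tau : C) : tangent W q tau -> conic_form F q tau = 0.
Proof.
  intros (_ & e & g & He & Hg & <- & <- & HWg).
  apply (conic_form_along_wall (fun t => - e < t < e)); auto using open_symmetric_interval. lra.
Qed.

Lemma square_curve_velocity (h : R -> C) (t : R) (v : C) :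
  has_velocity h t v -> has_velocity (fun s => square (h s)) t (2 * h t * v)%C.
Proof.
  intros H. eapply has_velocity_eq; [exact (has_velocity_mult h h t v v H H)|]. ring.
Qed.

Lemma C1_on_square (I : R -> Prop) (h : R -> C) :
  open I -> C1_on I h -> C1_on I (fun t => square (h t)).
Proof.
  intros HI Hh. apply C1_on_intro with (fun t => 2 * h t * velocity_of h t)%C.
  - intros t Ht. generalize (HI t Ht). apply filter_imp. intros s Hs.
    apply square_curve_velocity. now apply (C1_on_has_velocity I).
  - intros t Ht. destruct (Hh t Ht) as (_ & _ & Hc).
    pose proof (has_velocity_continuous _ _ _ (C1_on_has_velocity I h t Hh Ht)). complex_cont.
Qed.

Lemma tangent_preimage_square (z tau : C) : z <> 0%C ->
  tangent (preimage W) z tau -> tangent W (square z) (2 * z * tau)%C.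
Proof.
  intros Hz (Htau & e & h & He & Hh & H0 & Hv & HWh). split.
  - repeat apply Cmult_neq_0; auto using C2_neq0.
  - exists e, (fun t => square (h t)). split; [exact He|].
    split; [apply C1_on_square; auto using open_symmetric_interval|].
    split; [now rewrite H0|]. split; [|intros t Ht; now apply HWh].
    rewrite <- H0, <- Hv. apply has_velocity_velocity_of, square_curve_velocity.
    apply (C1_on_has_velocity _ _ _ Hh). lra.
Qed.
End TangentDirections.

(** The pull-back of the condition on the quadratic differential: dq = 2 z dz cancels the pole at q
    = 0, so this form carries information at the center too. *)
Definition centered_conic_form (a z tau : C) : R :=
  Im ((square a - square z) * (1 - Cconj (square a) * square z) * (Cconj tau * Cconj tau)).

Lemma conic_form_square (a z tau : C) :
  conic_form (square a) (square z) (2 * z * tau) = 4 * Cmod z ^ 4 * centered_conic_form a z tau.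
Proof.
  replace (Cmod z ^ 4) with ((Cmod z ^ 2) ^ 2) by ring. rewrite Cmod2_alt.
  unfold conic_form, centered_conic_form, square. destruct a, z, tau. simpl. ring.
Qed.

Lemma tangent_centered_conic_form (a : C) (W : C -> Prop) (z tau : C) :
  unit_disc a -> square a <> 0%C ->
  combination (conic_branch hyperbolic_density 0%C (square a)) W ->
  tangent (preimage W) z tau -> centered_conic_form a z tau = 0.
Proof.
  intros Ha Ha0 HW (Htau & e & h & He & Hh & <- & <- & HWh).
  pose proof (open_symmetric_interval e) as HI. set (I := fun t => - e < t < e) in *.
  assert (key : forall t, I t -> h t <> 0%C -> centered_conic_form a (h t) (velocity_of h t) = 0).
  { intros t Ht Hn.
    pose proof (conic_form_along_wall (square a) (proj2 (unit_disc_square a) Ha) Ha0 W HW I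
      (fun t => square (h t)) t HI (C1_on_square I h HI Hh) (fun s Hs => proj2 (HWh s Hs)) Ht) as E.
    rewrite (has_velocity_velocity_of _ _ _
      (square_curve_velocity h t _ (C1_on_has_velocity I h t Hh Ht))) in E.
    rewrite conic_form_square in E. apply Cmod_gt_0 in Hn.
    apply Rmult_integral in E. destruct E as [E | E]; [|exact E].
    pose proof (pow_lt _ 4 Hn). lra. }
  assert (I0 : I 0) by (unfold I; lra).
  destruct (classic (h 0 = 0%C)) as [E0 | N0]; [|now apply key].
  pose proof (C1_on_has_velocity I h 0 Hh I0) as Hv. destruct (Hh 0 I0) as (_ & _ & Hc).
  (* At the center itself the pulled-back identity reads 0 = 0; the form is recovered by continuity
     from nearby times with h <> 0. *)
  apply (continuous_clusters_zero (fun t => centered_conic_form a (h t) (velocity_of h t))).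
  - pose proof (has_velocity_continuous _ _ _ Hv). unfold centered_conic_form, square. complex_cont.
  - intros d Hd. apply NNPP. intros none.
    (* If no such times accumulate at 0, then h is 0 on a punctured neighbourhood and its velocity
       vanishes, contrary to the choice of a nonzero tangent vector. *)
    assert (Z : forall s, 0 < Rabs (s - 0) < Rmin d e -> h s = 0%C).
    { intros s [Hs1 Hs2]. pose proof (Rmin_l d e). pose proof (Rmin_r d e).
      apply NNPP. intros Hs. apply none. exists s. split; [lra|]. apply key; [|exact Hs].
      rewrite Rminus_0_r in Hs2. apply Rabs_def2 in Hs2. unfold I. lra. }
    assert (Pd : 0 < Rmin d e) by now apply Rmin_glb_lt.
    assert (ZC : forall f : C -> R, f 0%C = 0 -> clusters (fun s => f (h s) = 0) 0).
    { intros f Hf d' Hd'. set (r := Rmin (Rmin d e) d' / 2).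
      pose proof (Rmin_l (Rmin d e) d'). pose proof (Rmin_r (Rmin d e) d').
      assert (0 < Rmin (Rmin d e) d') by now apply Rmin_glb_lt.
      assert (Rabs (r - 0) = r) by (rewrite Rminus_0_r; apply Rabs_pos_eq; unfold r; lra).
      exists r. split; [unfold r in *; lra|]. rewrite Z; [exact Hf|]. unfold r in *; lra. }
    apply Htau. destruct Hv as [H1 H2]. apply C_ext.
    + now apply (derivative_clusters_zero _ _ _ H1 (ZC Re eq_refl)).
    + now apply (derivative_clusters_zero _ _ _ H2 (ZC Im eq_refl)).
Qed.

(** * Square roots of curves *)


(** The root is z0 times the exponential of half the primitive of the logarithmic derivative v / g.
    Its square divided by g has zero derivative, hence stays equal to its initial value 1; no branch
    of the root has to be chosen. *)
Lemma square_root_lift (I : R -> Prop) (g v : R -> C) (t0 : R) (z0 : C) :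
  is_open_interval I ->
  (forall t, I t -> has_velocity g t (v t)) -> (forall t, I t -> continuous v t) ->
  (forall t, I t -> g t <> 0%C) -> I t0 -> square z0 = g t0 ->
  exists h, h t0 = z0 /\
    forall t, I t -> square (h t) = g t /\ has_velocity h t (v t / (2 * h t))%C.
Proof.
  intros [Hopen Hint] Hg Hv Hn I0 Hz0.
  set (k := fun t => (v t / g t)%C).
  assert (Hk : forall t, I t -> continuous k t).
  { intros t Ht. pose proof (has_velocity_continuous _ _ _ (Hg t Ht)).
    pose proof (Hv t Ht). pose proof (Hn t Ht). unfold k. complex_cont. assumption. }
  assert (Ek : forall t, k t = (v t / g t)%C) by reflexivity. clearbody k.
  assert (prim : forall f : R -> R, (forall t, I t -> continuous f t) ->
    exists u, u t0 = 0 /\ forall t, I t -> is_derive u t (f t)).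
  { intros f Hf. exists (fun t => RInt f t0 t). split; [apply (RInt_point (V := R_CompleteNormedModule))|].
    intros t Ht. apply (is_derive_RInt f (fun t => RInt f t0 t) t0 t); [|now apply Hf].
    generalize (Hopen t Ht). apply filter_imp. intros s Hs.
    apply (RInt_correct (V := R_CompleteNormedModule)).
    apply (ex_RInt_continuous (V := R_CompleteNormedModule)).
    intros r Hr. apply Hf. destruct (Rle_dec t0 s).
    - rewrite Rmin_left, Rmax_right in Hr by lra. now apply (Hint t0 r s).
    - rewrite Rmin_right, Rmax_left in Hr by lra. now apply (Hint s r t0). }
  destruct (prim (fun t => Re (k t))) as (u & u0 & Hu);
    [intros t Ht; apply continuous_Re; now apply Hk|].
  destruct (prim (fun t => Im (k t))) as (th & th0 & Hth);
    [intros t Ht; apply continuous_Im; now apply Hk|].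
  set (ex := fun t => (exp (u t / 2) * cos (th t / 2), exp (u t / 2) * sin (th t / 2)) : C).
  assert (Hex : forall t, I t -> has_velocity ex t (RtoC (/ 2) * (k t * ex t))%C).
  { intros t Ht. pose proof (Hu t Ht) as Du. pose proof (Hth t Ht) as Dth.
    assert (K2 : (RtoC (/ 2) * (k t * ex t))%C =
      (/ 2 * (Re (k t) * Re (ex t) - Im (k t) * Im (ex t)),
       / 2 * (Re (k t) * Im (ex t) + Im (k t) * Re (ex t)))).
    { apply C_ext; simpl; unfold Re, Im; ring. }
    rewrite K2. unfold ex. split; simpl.
    - auto_derive; [repeat split; eexists; eassumption|].
      replace (Derive (fun x : R => u x) t) with (Re (k t)) by (symmetry; now apply is_derive_unique).
      replace (Derive (fun x : R => th x) t) with (Im (k t)) by (symmetry; now apply is_derive_unique).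
      simpl; unfold Rdiv, Re, Im; ring.
    - auto_derive; [repeat split; eexists; eassumption|].
      replace (Derive (fun x : R => u x) t) with (Re (k t)) by (symmetry; now apply is_derive_unique).
      replace (Derive (fun x : R => th x) t) with (Im (k t)) by (symmetry; now apply is_derive_unique).
      simpl; unfold Rdiv, Re, Im; ring. }
  assert (ex0 : ex t0 = 1%C).
  { unfold ex. rewrite u0, th0. replace (0 / 2) with 0 by field.
    rewrite exp_0, cos_0, sin_0. apply C_ext; simpl; ring. }
  set (h := fun t => (z0 * ex t)%C).
  assert (Hh : forall t, I t -> has_velocity h t (h t * (k t / 2))%C).
  { intros t Ht. eapply has_velocity_eq.
    - apply has_velocity_mult; [apply has_velocity_const|now apply Hex].
    - cbv beta. unfold h. rewrite RtoC_inv by lra. field. }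
  assert (Hquot : forall t, I t -> has_velocity (fun s => square (h s) / g s)%C t 0%C).
  { intros t Ht. pose proof (Hn t Ht). eapply has_velocity_eq.
    - apply has_velocity_div; [apply square_curve_velocity; now apply Hh|now apply Hg|assumption].
    - cbv beta. rewrite Ek. unfold square. field. assumption. }
  assert (Hsq : forall t, I t -> square (h t) = g t).
  { intros t Ht.
    assert (E : (square (h t) / g t)%C = 1%C).
    { transitivity (square (h t0) / g t0)%C.
      - assert (Hseg : forall s, Rmin t t0 <= s <= Rmax t t0 -> I s).
        { intros s Hs. destruct (Rle_dec t t0).
          - rewrite Rmin_left, Rmax_right in Hs by lra. now apply (Hint t s t0).
          - rewrite Rmin_right, Rmax_left in Hs by lra. now apply (Hint t0 s t). }
        apply C_ext.
        + apply (zero_derivative_const (fun s => Re (square (h s) / g s))).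
          intros s Hs. now apply Hquot, Hseg.
        + apply (zero_derivative_const (fun s => Im (square (h s) / g s))).
          intros s Hs. now apply Hquot, Hseg.
      - unfold h. rewrite ex0, <- Hz0. replace (z0 * 1)%C with z0 by ring. field.
        rewrite Hz0. now apply Hn. }
    replace (square (h t)) with (square (h t) / g t * g t)%C by (field; now apply Hn).
    rewrite E. ring. }
  exists h. split; [unfold h; rewrite ex0; ring|]. intros t Ht. split; [now apply Hsq|].
  pose proof (Hn t Ht) as Hnt. rewrite <- (Hsq t Ht) in Hnt.
  assert (Hht : h t <> 0%C) by (intros E; apply Hnt; unfold square; rewrite E; ring).
  eapply has_velocity_eq; [now apply Hh|].
  rewrite Ek, <- (Hsq t Ht). unfold square. field. repeat split; auto using C2_neq0.
Qed.

Lemma open_unit_interval : is_open_interval open_unit.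
Proof.
  split; [apply open_and; [apply open_gt|apply open_lt]|]. unfold open_unit. intros; lra.
Qed.

(* Only the degenerate conics with foci 0 and F contain the focus 0: a segment and
   two rays, all contained in a line and ending at 0. *)
Lemma conic_branch_through_center (F : C) (X : C -> Prop) : unit_disc F ->
  conic_branch hyperbolic_density 0%C F X -> X 0%C ->
  exists sg, sg * sg = 1 /\ forall q, X q ->
    sg * Re (Cconj F * q) = Cmod F * Cmod q /\ Im (Cconj F * q) = 0.
Proof.
  intros HF HX X0. destruct (conic_branch_level F X HF HX) as (sg & k & Hsg & Hlev).
  exists sg. split; [exact Hsg|]. intros q' Xq.
  destruct (Hlev _ X0) as [_ E0]. destruct (Hlev _ Xq) as [Hq E].
  replace (1 - Cconj F * 0)%C with (RtoC 1) in E0 by ring.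
  replace (0 - F)%C with (- F)%C in E0 by ring. rewrite Cmod_opp, Cmod_0, Cmod_1 in E0.
  pose proof (hyperbolic_norm_identity F q') as NI. pose proof (Cmod_ge_0 F) as PF.
  pose proof (Cmod_ge_0 q') as Pq. unfold unit_disc in HF, Hq.
  set (Y := Cmod (1 - Cconj F * q')) in *.
  assert (EZ : Cmod (q' - F) ^ 2 = Cmod q' ^ 2 + Cmod F ^ 2 - 2 * Re (Cconj F * q')).
  { rewrite !Cmod2_alt. destruct F, q'. simpl. ring. }
  assert (EM : Re (Cconj F * q') ^ 2 + Im (Cconj F * q') ^ 2 = (Cmod F * Cmod q') ^ 2).
  { rewrite <- Cmod2_alt, Cmod_mult, Cmod_conj. reflexivity. }
  set (Z := Cmod (q' - F)) in *. set (al := Cmod F) in *. set (A := Cmod q') in *.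
  set (r := Re (Cconj F * q')) in *. set (i := Im (Cconj F * q')) in *. clearbody Y Z al A r i.
  (* The quotient of the norm identity by the level equation. The two linear equations give sg Z =
     sg |F| - |q|, which is the equality case of the triangle inequality and forces q onto the line
     through 0 and F. *)
  assert (E' : Y + sg * Z = (1 + sg * al) * (1 - A)).
  { apply Rmult_eq_reg_l with (Y - sg * Z).
    - transitivity (Y ^ 2 - sg * sg * Z ^ 2); [ring|]. rewrite Hsg, Rmult_1_l, NI, E.
      replace k with (1 - sg * al) by lra.
      transitivity ((1 - sg * sg * al ^ 2) * (1 - A ^ 2)); [rewrite Hsg; ring|ring].
    - rewrite E. apply Rmult_integral_contrapositive_currified; [|lra].
      destruct (sign_cases sg Hsg) as [-> | ->]; lra. }
  assert (r = sg * al * A).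
  { assert (EZ' : sg * Z = sg * al - A) by (replace k with (1 - sg * al) in E by lra; lra).
    assert (Z ^ 2 = (sg * al - A) ^ 2).
    { rewrite <- EZ'. transitivity (sg * sg * Z ^ 2); [rewrite Hsg|]; ring. }
    destruct (sign_cases sg Hsg) as [-> | ->]; lra. }
  split.
  - subst r. transitivity (sg * sg * (al * A)); [ring|]. rewrite Hsg. ring.
  - assert (i ^ 2 = 0); [|nra].
    assert (r ^ 2 = (al * A) ^ 2).
    { subst r. transitivity (sg * sg * (al * A) ^ 2); [ring|]. rewrite Hsg. ring. }
    lra.
Qed.

(** A conic through 0 lies on a ray that ends there. An arc reaching 0 at an interior time would
    give sg Re (conj F g) an interior minimum while Im (conj F g) is constantly 0, so its velocity
    would vanish. Arcs therefore have smooth square roots. *)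
Lemma arc_avoids_center (F : C) (X : C -> Prop) (g : R -> C) : unit_disc F -> F <> 0%C ->
  conic_branch hyperbolic_density 0%C F X ->
  C1_on open_unit g -> (forall t, open_unit t -> velocity_of g t <> 0%C) ->
  (forall t, open_unit t -> X (g t)) -> forall t, open_unit t -> g t <> 0%C.
Proof.
  intros HF HF0 HX Hg Hv Xg t Ht E0. apply (Hv t Ht).
  pose proof (Xg t Ht) as X0. rewrite E0 in X0.
  destruct (conic_branch_through_center F X HF HX X0) as (sg & Hsg & Hray).
  pose proof (C1_on_has_velocity _ _ _ Hg Ht) as V. set (tau := velocity_of g t) in *.
  pose proof (has_velocity_mult (fun _ => Cconj F) g t _ _ (has_velocity_const _ _) V) as [D1 D2].
  cbv beta in D1, D2. replace (0 * g t + Cconj F * tau)%C with (Cconj F * tau)%C in D1, D2 by ring.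
  assert (Z1 : Re (Cconj F * tau) = 0).
  { pose proof (is_derive_scal (fun s => Re (Cconj F * g s)) t sg _ D1) as D.
    apply is_derive_Reals in D.
    pose proof (deriv_minimum (fun s => sg * Re (Cconj F * g s)) 0 1 t (exist _ _ D)) as M.
    assert (sg * Re (Cconj F * tau) = 0).
    { apply M; try apply Ht. intros s H0 H1. rewrite E0.
      destruct (Hray (g s) (Xg s (conj H0 H1))) as [-> _].
      replace (sg * Re (Cconj F * 0)) with 0 by (simpl; ring).
      apply Rmult_le_pos; apply Cmod_ge_0. }
    destruct (sign_cases sg Hsg); nra. }
  assert (Z2 : Im (Cconj F * tau) = 0).
  { transitivity (Derive (fun s => Im (Cconj F * g s)) t); [symmetry; now apply is_derive_unique|].
    apply is_derive_unique. apply (is_derive_ext_loc (fun _ => 0)).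
    - generalize (proj1 open_unit_interval t Ht). apply filter_imp. intros s Hs.
      symmetry. now apply Hray, Xg.
    - apply (is_derive_const (V := R_NormedModule)). }
  assert (Z : (Cconj F * tau)%C = 0%C) by now apply C_ext.
  apply NNPP. intros N. apply (Cmult_neq_0 (Cconj F) tau); auto using Cconj_neq0.
Qed.

(** Every arc lifts to two opposite arcs and every vertex to its square roots, so the preimage is
    again made of finitely many pieces. *)
Lemma combination_preimage (F : C) (family : (C -> Prop) -> Prop) (W : C -> Prop) :
  unit_disc F -> F <> 0%C ->
  (forall X, conic_branch hyperbolic_density 0%C F X -> family (preimage X)) ->
  combination (conic_branch hyperbolic_density 0%C F) W -> combination family (preimage W).
Proof.
  intros HF HF0 Hfam (arcs & vertices & Harcs & Hvert & HW).
  assert (disc : forall X q, conic_branch hyperbolic_density 0%C F X -> X q -> unit_disc q).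
  { intros X q HX Xq. destruct (conic_branch_level F X HF HX) as (sg & k & _ & H).
    now apply H. }
  assert (LV : exists vs, forall z, In z vs <-> In (square z) vertices).
  { clear - vertices. induction vertices as [|v vs (us & IH)].
    - exists nil. intros z. split; intros [].
    - destruct (square_surjective v) as [w Hw]. exists (w :: (- w)%C :: us). intros z. simpl.
      rewrite IH. split.
      + intros [<- | [<- | H]]; [now left| |now right]. left. rewrite <- Hw. unfold square. ring.
      + intros [E | H]; [|now right; right]. rewrite <- Hw in E. symmetry in E.
        destruct (square_eq _ _ E) as [-> | ->]; auto. }
  assert (LA : exists hs,
    (forall h, In h hs -> C1_on open_unit h /\
       (forall t, open_unit t -> velocity_of h t <> 0%C) /\
       exists X, conic_branch hyperbolic_density 0%C F X /\
         forall t, open_unit t -> X (square (h t))) /\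
    forall z, (exists h t, In h hs /\ open_unit t /\ z = h t) <->
       (exists g t, In g arcs /\ open_unit t /\ square z = g t)).
  { clear - Harcs HF HF0. induction arcs as [|g arcs IH].
    - exists nil. split; [intros _ []|]. intros z. split; intros (_ & _ & [] & _).
    - destruct IH as (hs & Hhs & Ehs); [intros g' Hg'; apply Harcs; now right|].
      destruct (Harcs g (or_introl eq_refl)) as (Hg & Hv & X & HX & Xg).
      pose proof (arc_avoids_center F X g HF HF0 HX Hg Hv Xg) as Hn.
      destruct (square_surjective (g (1 / 2))) as [z0 Hz0].
      destruct (square_root_lift open_unit g (velocity_of g) (1 / 2) z0) as (h & _ & Hh);
        try assumption; try exact open_unit_interval.
      { intros t Ht. now apply (C1_on_has_velocity open_unit). }
      { intros t Ht. now apply Hg. }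
      { unfold open_unit. lra. }
      assert (Hhn : forall t, open_unit t -> h t <> 0%C).
      { intros t Ht E. apply (Hn t Ht). rewrite <- (proj1 (Hh t Ht)), E. unfold square. ring. }
      assert (lift : forall e : C, (e * e = 1)%C ->
        C1_on open_unit (fun t => e * h t)%C /\
        (forall t, open_unit t -> velocity_of (fun t => e * h t)%C t <> 0%C) /\
        forall t, open_unit t -> square (e * h t) = g t).
      { intros e He.
        assert (He0 : e <> 0%C).
        { intros E. rewrite E in He. apply (f_equal Re) in He. simpl in He. lra. }
        assert (V : forall t, open_unit t ->
          has_velocity (fun t => e * h t)%C t (e * (velocity_of g t / (2 * h t)))%C).
        { intros t Ht. eapply has_velocity_eq.
          - apply has_velocity_mult; [apply has_velocity_const|now apply Hh].
          - cbv beta. ring. }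
        split; [|split].
        - apply C1_on_intro with (fun t => e * (velocity_of g t / (2 * h t)))%C.
          + intros t Ht. generalize (proj1 open_unit_interval t Ht). apply filter_imp. exact V.
          + intros t Ht. pose proof (has_velocity_continuous _ _ _ (proj2 (Hh t Ht))).
            destruct (Hg t Ht) as (_ & _ & Cv). complex_cont.
            apply Cmult_neq_0; auto using C2_neq0.
        - intros t Ht. rewrite (has_velocity_velocity_of _ _ _ (V t Ht)).
          assert (D : (2 * h t)%C <> 0%C) by (apply Cmult_neq_0; auto using C2_neq0).
          apply Cmult_neq_0; [exact He0|]. apply Cmult_neq_0; [now apply Hv|].
          intros E. apply (f_equal (Cmult (2 * h t))) in E.
          rewrite Cinv_r in E by exact D. apply (f_equal Re) in E. simpl in E. lra.
        - intros t Ht. rewrite <- (proj1 (Hh t Ht)). unfold square.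
          transitivity (e * e * (h t * h t))%C; [ring|]. rewrite He. ring. }
      destruct (lift 1%C ltac:(ring)) as (A1 & A2 & A3).
      destruct (lift (- (1))%C ltac:(ring)) as (B1 & B2 & B3).
      exists ((fun t => 1 * h t)%C :: (fun t => - (1) * h t)%C :: hs). split.
      + intros h' [<- | [<- | Hh']]; [| |now apply Hhs].
        * split; [exact A1|]. split; [exact A2|]. exists X. split; [exact HX|].
          intros t Ht. rewrite A3 by exact Ht. now apply Xg.
        * split; [exact B1|]. split; [exact B2|]. exists X. split; [exact HX|].
          intros t Ht. rewrite B3 by exact Ht. now apply Xg.
      + intros z. split.
        * intros (h' & t & [<- | [<- | Hh']] & Ht & ->).
          -- exists g, t. split; [now left|]. split; [exact Ht|now apply A3].
          -- exists g, t. split; [now left|]. split; [exact Ht|now apply B3].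
          -- destruct (proj1 (Ehs (h' t))) as (g' & t' & Hg' & Ht' & E); [now exists h', t|].
             exists g', t'. split; [now right|]. now split.
        * intros (g' & t & [<- | Hg'] & Ht & E).
          -- rewrite <- (proj1 (Hh t Ht)) in E. destruct (square_eq _ _ E) as [-> | ->].
             ++ exists (fun t => 1 * h t)%C, t. split; [now left|]. split; [exact Ht|ring].
             ++ exists (fun t => - (1) * h t)%C, t. split; [now right; left|]. split; [exact Ht|ring].
          -- destruct (proj2 (Ehs z)) as (h' & t' & Hh' & Ht' & E'); [now exists g', t|].
             exists h', t'. split; [now right; right|]. now split. }
  destruct LV as (vs & Hvs), LA as (hs & Hhs & Ehs). exists hs, vs. split; [|split].
  - intros h Hh. destruct (Hhs h Hh) as (H1 & H2 & X & HX & Xh).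
    split; [exact H1|]. split; [exact H2|]. exists (preimage X). split; [now apply Hfam|].
    intros t Ht. split; [|now apply Xh]. apply unit_disc_square. apply (disc X); auto.
  - intros v Hv. apply Hvs in Hv. destruct (Hvert _ Hv) as (X & HX & Xv).
    exists (preimage X). split; [now apply Hfam|]. split; [|exact Xv].
    apply unit_disc_square. apply (disc X); auto.
  - intros z. rewrite Ehs, Hvs. unfold preimage. rewrite HW. split; [now intros [_ H]|].
    intros H. split; [|exact H]. apply unit_disc_square.
    destruct H as [(g & t & Hg & Ht & ->) | H].
    + destruct (Harcs g Hg) as (_ & _ & X & HX & Xg). apply (disc X); auto.
    + destruct (Hvert _ H) as (X & HX & Xv). apply (disc X); auto.
Qed.

(** * Reparametrization and equations of motion *)


Section InverseFunction.
Variables (I : R -> Prop) (sigma l : R -> R).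
Hypothesis HI : is_open_interval I.
Hypothesis Hl : forall t, I t -> 0 < l t.
Hypothesis Hs : forall t, I t -> is_derive sigma t (l t).

Let J (s : R) : Prop := exists t, I t /\ s = sigma t.

Lemma open_interval_between (a b t : R) : I a -> I b -> a <= t <= b -> I t.
Proof. intros Ha Hb Ht. now apply (proj2 HI a t b). Qed.

Lemma primitive_continuity_pt (t : R) : I t -> continuity_pt sigma t.
Proof.
  intros Ht. apply continuity_pt_filterlim.
  apply (ex_derive_continuous (V := R_NormedModule) sigma). eexists; now apply Hs.
Qed.

Lemma primitive_increasing (a b : R) : I a -> I b -> a < b -> sigma a < sigma b.
Proof.
  intros Ha Hb Hab.
  assert (Hseg : forall t, Rmin a b <= t <= Rmax a b -> I t).
  { intros t Ht. rewrite Rmin_left, Rmax_right in Ht by lra. now apply (open_interval_between a b). }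
  destruct (MVT_gen sigma a b l) as (c & Hc & E).
  - intros t Ht. apply Hs, Hseg. lra.
  - intros t Ht. now apply primitive_continuity_pt, Hseg.
  - pose proof (Hl c (Hseg c Hc)). nra.
Qed.

Lemma primitive_injective (a b : R) : I a -> I b -> sigma a = sigma b -> a = b.
Proof.
  intros Ha Hb E. destruct (Rtotal_order a b) as [L | [L | L]]; [|exact L|];
  [pose proof (primitive_increasing a b Ha Hb L)|pose proof (primitive_increasing b a Hb Ha L)]; lra.
Qed.

Lemma primitive_surjective (a b s : R) : I a -> I b -> a <= b -> sigma a <= s <= sigma b ->
  exists t, a <= t <= b /\ sigma t = s.
Proof.
  intros Ha Hb [Hab | <-] Hs'; [|exists a; split; lra].
  destruct (f_interv_is_interv sigma a b s Hab Hs') as (t & Ht & E).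
  - intros t Ht. apply primitive_continuity_pt. now apply (open_interval_between a b).
  - now exists t.
Qed.

Lemma interval_neighbours (t d : R) : I t -> 0 < d ->
  exists a b, I a /\ I b /\ t - d < a < t /\ t < b < t + d.
Proof.
  intros Ht Hd. destruct (proj1 HI t Ht) as [e He]. pose proof (cond_pos e).
  set (r := Rmin d e / 2). pose proof (Rmin_l d e). pose proof (Rmin_r d e).
  assert (0 < Rmin d e) by now apply Rmin_glb_lt.
  exists (t - r), (t + r). repeat split; try (unfold r; lra); apply He.
  - change (Rabs (t - r - t) < e). replace (t - r - t) with (- r) by ring.
    rewrite Rabs_Ropp, Rabs_pos_eq; unfold r; lra.
  - change (Rabs (t + r - t) < e). replace (t + r - t) with r by ring.
    rewrite Rabs_pos_eq; unfold r; lra.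
Qed.

Lemma primitive_image_open_interval : is_open_interval J.
Proof.
  split.
  - intros s (t & Ht & ->).
    destruct (interval_neighbours t 1 Ht Rlt_0_1) as (a & b & Ia & Ib & Ha & Hb).
    pose proof (primitive_increasing a t Ia Ht (proj2 Ha)) as L1.
    pose proof (primitive_increasing t b Ht Ib (proj1 Hb)) as L2.
    apply (filter_imp (fun s => sigma a < s < sigma b)).
    + intros s Hsab. destruct (primitive_surjective a b s Ia Ib) as (r & Hr & <-); [lra|lra|].
      exists r. split; [now apply (open_interval_between a b)|reflexivity].
    + apply (open_and (fun s => sigma a < s) (fun s => s < sigma b));
        [apply open_gt|apply open_lt|split; assumption].
  - intros s r u (a & Ia & ->) (b & Ib & ->) Hr.
    destruct (Rle_dec a b) as [L | L].
    + destruct (primitive_surjective a b r Ia Ib L Hr) as (t & Ht & <-).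
      exists t. split; [now apply (open_interval_between a b)|reflexivity].
    + pose proof (primitive_increasing b a Ib Ia ltac:(lra)). lra.
Qed.

(** [tau] is an arbitrary right inverse with values in [I]. Its continuity is derived first, from
    the monotonicity of [sigma] on an interval around the point. *)
Lemma inverse_is_derive (tau : R -> R) :
  (forall s, J s -> I (tau s) /\ sigma (tau s) = s) ->
  forall s, J s -> is_derive tau s (/ l (tau s)).
Proof.
  intros Htau s HJ. destruct (Htau s HJ) as [It Es]. set (t := tau s) in *.
  pose proof (Hl t It) as Lp.
  assert (Hcont : forall d, 0 < d -> exists e, 0 < e /\
    forall r, Rabs (r - s) < e -> J r /\ Rabs (tau r - t) < d).
  { intros d Hd. destruct (interval_neighbours t d It Hd) as (a & b & Ia & Ib & Ha & Hb).
    pose proof (primitive_increasing a t Ia It (proj2 Ha)) as L1.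
    pose proof (primitive_increasing t b It Ib (proj1 Hb)) as L2. rewrite Es in L1, L2.
    exists (Rmin (s - sigma a) (sigma b - s)). split; [apply Rmin_glb_lt; lra|].
    intros r Hr. pose proof (Rmin_l (s - sigma a) (sigma b - s)).
    pose proof (Rmin_r (s - sigma a) (sigma b - s)). apply Rabs_def2 in Hr.
    destruct (primitive_surjective a b r Ia Ib) as (c & Hc & Ec); [lra|lra|].
    assert (Ic : I c) by now apply (open_interval_between a b).
    assert (HJr : J r) by (exists c; split; [exact Ic|now symmetry]).
    destruct (Htau r HJr) as [Itr Er].
    assert (tau r = c) as -> by (apply primitive_injective; congruence).
    split; [exact HJr|]. apply Rabs_def1; lra. }
  apply is_derive_Reals. intros eps Heps.
  pose proof (Hs t It) as D. apply is_derive_Reals in D.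
  (* The bound l/2 keeps the difference quotient h / k above l/2; the second bound then makes the
     difference of the inverses smaller than eps. *)
  set (eta := Rmin (l t / 2) (eps * (l t) ^ 2 / 2)).
  assert (Heta : 0 < eta).
  { apply Rmin_glb_lt; [lra|]. apply Rdiv_lt_0_compat; [|lra].
    apply Rmult_lt_0_compat; [exact Heps|now apply pow_lt]. }
  destruct (D eta Heta) as [d Hd]. destruct (Hcont d (cond_pos d)) as (e & He & Hc).
  exists (mkposreal e He). intros h Hh Hhe. simpl in Hhe.
  destruct (Hc (s + h)) as [HJr Hk]; [now replace (s + h - s) with h by ring|].
  destruct (Htau (s + h) HJr) as [Itr Er]. set (k := tau (s + h) - t) in *.
  assert (Ek : tau (s + h) = t + k) by (unfold k; ring).
  assert (Eh : h = sigma (t + k) - sigma t) by (rewrite <- Ek, Er, Es; ring).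
  assert (Hk0 : k <> 0).
  { intros Z. apply Hh. rewrite Eh, Z, Rplus_0_r. ring. }
  specialize (Hd k Hk0 Hk). rewrite <- Eh in Hd.
  change (tau (s + h) - tau s) with k.
  pose proof (Rmin_l (l t / 2) (eps * (l t) ^ 2 / 2)) as M1.
  pose proof (Rmin_r (l t / 2) (eps * (l t) ^ 2 / 2)) as M2. fold eta in M1, M2.
  assert (Hq : l t / 2 < h / k) by (apply Rabs_def2 in Hd; lra).
  replace (k / h - / l t) with (- ((h / k - l t) * / (h / k * l t))) by (field; repeat split; lra).
  rewrite Rabs_Ropp, Rabs_mult, (Rabs_pos_eq (/ _)).
  - apply Rmult_lt_reg_r with (h / k * l t); [apply Rmult_lt_0_compat; lra|].
    rewrite Rmult_assoc, Rinv_l, Rmult_1_r by (apply Rgt_not_eq, Rmult_lt_0_compat; lra).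
    apply Rlt_le_trans with (1 := Hd). apply Rle_trans with (1 := M2).
    assert (eps * l t * (l t / 2) <= eps * l t * (h / k)); [|nra].
    apply Rmult_le_compat_l; [apply Rmult_le_pos; lra|lra].
  - left. apply Rinv_0_lt_compat, Rmult_lt_0_compat; lra.
Qed.
End InverseFunction.

(** The new time is the primitive of the rate [l], and the motion is the given curve composed with
    the inverse of this primitive. *)
Lemma reparametrize (S : mechanics) (I : R -> Prop) (x : R -> state) (l : R -> R) :
  is_open_interval I -> (forall t, I t -> 0 < l t) -> (forall t, I t -> continuous l t) ->
  (forall t, I t -> phase S (x t) /\
     has_velocity (fun s => fst (x s)) t (l t * grad_p (energy S) (x t))%C /\
     has_velocity (fun s => snd (x s)) t (l t * - grad_q (energy S) (x t))%C) ->
  reparametrized_motion S I x.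
Proof.
  intros HI Hl Hlc Hx.
  destruct (classic (exists t0, I t0)) as [[t0 I0] | none].
  2:{ exists (fun t => t), I, x. split; [|split; [|split]].
      - intros t Ht. exfalso. apply none. now exists t.
      - intros s. split; [intros H; now exists s|now intros (t & H & ->)].
      - split; [exact HI|]. intros t Ht. exfalso. apply none. now exists t.
      - reflexivity. }
  set (sigma := fun t => RInt l t0 t).
  assert (Hs : forall t, I t -> is_derive sigma t (l t)).
  { intros t Ht. apply (is_derive_RInt l sigma t0 t); [|now apply Hlc].
    generalize (proj1 HI t Ht). apply filter_imp. intros s Is.
    apply (RInt_correct (V := R_CompleteNormedModule)).
    apply (ex_RInt_continuous (V := R_CompleteNormedModule)).
    intros r Hr. apply Hlc. destruct (Rle_dec t0 s).
    - rewrite Rmin_left, Rmax_right in Hr by lra. now apply (proj2 HI t0 r s).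
    - rewrite Rmin_right, Rmax_left in Hr by lra. now apply (proj2 HI s r t0). }
  (* The inverse is chosen on the whole line; outside the image of [sigma] its value is arbitrary,
     and 0 is taken. *)
  destruct (functional_choice (fun s t => (exists t', I t' /\ s = sigma t') -> I t /\ sigma t = s))
    as [tau Htau].
  { intros s. destruct (classic (exists t', I t' /\ s = sigma t')) as [(t & Ht & ->) | n].
    - now exists t.
    - now exists 0. }
  exists sigma, (fun s => exists t, I t /\ s = sigma t), (fun s => x (tau s)).
  split; [|split; [|split]].
  - intros t Ht. exists (l t). auto.
  - reflexivity.
  - split; [now apply (primitive_image_open_interval I sigma l)|].
    intros s HJ. destruct (Htau s HJ) as [It _]. destruct (Hx _ It) as (Hp & V1 & V2).
    pose proof (inverse_is_derive I sigma l HI Hl Hs tau Htau s HJ) as D.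
    pose proof (Hl _ It). split; [exact Hp|].
    assert (cancel : forall c, (RtoC (/ l (tau s)) * (RtoC (l (tau s)) * c))%C = c).
    { intros c. rewrite Cmult_assoc, <- RtoC_mult, Rinv_l by lra. ring. }
    split; (eapply has_velocity_eq; [|apply cancel]).
    + apply (has_velocity_comp (fun s => fst (x s)) tau); assumption.
    + apply (has_velocity_comp (fun s => snd (x s)) tau); assumption.
  - intros t Ht. f_equal. symmetry.
    destruct (Htau (sigma t)) as [It E]; [now exists t|].
    now apply (primitive_injective I sigma l HI Hl Hs).
Qed.

(** With d the geodesic distance to 0, the force function is - f tan^2 d on the sphere and - f
    tanh^2 d on the hyperbolic plane. *)
Definition curvature_Hooke (s f : R) : mechanics :=
  {| config := unit_disc;
     density := curvature_density s;
     kinetic := fun x => (1 + s * Cmod (fst x) ^ 2) ^ 2 * Cmod (snd x) ^ 2 / 8;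
     force := fun q => - (4 * f * Cmod q ^ 2 / (1 - s * Cmod q ^ 2) ^ 2) |}.

Lemma spherical_Hooke_curvature (f : R) : spherical_Hooke f = curvature_Hooke 1 f.
Proof.
  unfold spherical_Hooke, curvature_Hooke. rewrite spherical_density_curvature.
  f_equal; apply functional_extensionality; intros x; unfold spherical_kinetic;
  now rewrite Rmult_1_l.
Qed.

Lemma hyperbolic_Hooke_curvature (f : R) : hyperbolic_Hooke f = curvature_Hooke (-1) f.
Proof.
  unfold hyperbolic_Hooke, curvature_Hooke. rewrite hyperbolic_density_curvature.
  f_equal; apply functional_extensionality; intros x; unfold hyperbolic_kinetic.
  - replace (1 + -1 * Cmod (fst x) ^ 2) with (1 - Cmod (fst x) ^ 2) by ring. reflexivity.
  - replace (1 - -1 * Cmod x ^ 2) with (1 + Cmod x ^ 2) by ring. reflexivity.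
Qed.

Lemma hooke_energy (s f : R) (x : state) :
  energy (curvature_Hooke s f) x =
  (1 + s * (Re (fst x) ^ 2 + Im (fst x) ^ 2)) ^ 2 * (Re (snd x) ^ 2 + Im (snd x) ^ 2) / 8 +
  4 * f * (Re (fst x) ^ 2 + Im (fst x) ^ 2) / (1 - s * (Re (fst x) ^ 2 + Im (fst x) ^ 2)) ^ 2.
Proof.
  unfold energy, curvature_Hooke, kinetic, force. rewrite !Cmod2_alt.
  unfold Rminus. now rewrite Ropp_involutive.
Qed.

Lemma hooke_grad_p (s f : R) (x : state) :
  grad_p (energy (curvature_Hooke s f)) x =
  (RtoC ((1 + s * Cmod (fst x) ^ 2) ^ 2 / 4) * snd x)%C.
Proof.
  destruct x as [[x y] [u v]]. unfold grad_p. simpl fst. simpl snd.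
  rewrite Cmod2_alt.
  apply C_ext; simpl; apply is_derive_unique.
  - eapply is_derive_ext; [intros t; symmetry; apply hooke_energy|]. simpl.
    auto_derive; [exact I|]. field.
  - eapply is_derive_ext; [intros t; symmetry; apply hooke_energy|]. simpl.
    auto_derive; [exact I|]. field.
Qed.

Lemma hooke_grad_q (s f : R) (x : state) : 1 - s * Cmod (fst x) ^ 2 <> 0 ->
  grad_q (energy (curvature_Hooke s f)) x =
  (RtoC (2 * (1 + s * Cmod (fst x) ^ 2) *
     (s * Cmod (snd x) ^ 2 / 4 + 4 * f / (1 - s * Cmod (fst x) ^ 2) ^ 3)) * fst x)%C.
Proof.
  rewrite !Cmod2_alt. destruct x as [[x y] [u v]]. unfold grad_q. simpl. intros H.
  apply C_ext; simpl; apply is_derive_unique.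
  - eapply is_derive_ext; [intros t; symmetry; apply hooke_energy|]. simpl.
    auto_derive; [simpl; repeat apply Rmult_integral_contrapositive_currified; lra|].
    field. simpl in *. lra.
  - eapply is_derive_ext; [intros t; symmetry; apply hooke_energy|]. simpl.
    auto_derive; [simpl; repeat apply Rmult_integral_contrapositive_currified; lra|].
    field. simpl in *. lra.
Qed.

Lemma kepler_energy (m : R) (x : state) :
  energy (hyperbolic_Kepler m) x =
  (1 - Cmod (fst x) ^ 2) ^ 2 * Cmod (snd x) ^ 2 / 8 -
  m * ((1 + Cmod (fst x) ^ 2) / (2 * Cmod (fst x))).
Proof. reflexivity. Qed.

Lemma kepler_grad_p (m : R) (x : state) :
  grad_p (energy (hyperbolic_Kepler m)) x =
  (RtoC ((1 - Cmod (fst x) ^ 2) ^ 2 / 4) * snd x)%C.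
Proof.
  destruct x as [q [u v]]. unfold grad_p. simpl fst. simpl snd.
  apply C_ext; simpl; apply is_derive_unique.
  - eapply is_derive_ext.
    { intros t. symmetry. rewrite kepler_energy, (Cmod2_alt (snd _)). reflexivity. }
    simpl. auto_derive; [exact I|]. field.
  - eapply is_derive_ext.
    { intros t. symmetry. rewrite kepler_energy, (Cmod2_alt (snd _)). reflexivity. }
    simpl. auto_derive; [exact I|]. field.
Qed.

Lemma kepler_grad_q (m : R) (x : state) : fst x <> 0%C ->
  grad_q (energy (hyperbolic_Kepler m)) x =
  (RtoC ((1 - Cmod (fst x) ^ 2) *
     (m / (2 * Cmod (fst x) ^ 3) - Cmod (snd x) ^ 2 / 2)) * fst x)%C.
Proof.
  destruct x as [q p]. simpl fst. simpl snd. intros Hq.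
  pose proof (proj1 (Cmod_gt_0 _) Hq) as Hr. pose proof (C_neq0 _ Hq) as Hr2.
  (* The energy depends on q only through |q|, so its gradient is the derivative of this profile
     divided by |q|, times q. *)
  set (pr := fun r => (1 - r ^ 2) ^ 2 * Cmod p ^ 2 / 8 - m * ((1 + r ^ 2) / (2 * r))).
  assert (profile : forall r, 0 < r -> is_derive pr r
    (r * ((1 - r ^ 2) * (m / (2 * r ^ 3) - Cmod p ^ 2 / 2)))).
  { intros r Hr'. unfold pr. generalize (Cmod p). intros P. auto_derive; [lra|]. field. lra. }
  unfold grad_q. simpl fst. simpl snd.
  apply C_ext; simpl; apply is_derive_unique.
  - eapply is_derive_eq.
    + apply (is_derive_ext (fun t : R => pr (Cmod (t, Im q)))); [reflexivity|].
      apply (is_derive_comp pr (fun t : R => Cmod (t, Im q))).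
      * replace (Re q, Im q) with q by now destruct q. now apply profile.
      * apply (is_derive_Cmod (fun t : R => (t, Im q)) (Re q) 1).
        -- split; simpl; [apply (is_derive_id (K := R_AbsRing))|].
           apply (is_derive_const (V := R_NormedModule)).
        -- now destruct q.
    + replace (Re q, Im q) with q by now destruct q. simpl.
      unfold scal; simpl; unfold mult, Re, Im; simpl. field. lra.
  - eapply is_derive_eq.
    + apply (is_derive_ext (fun t : R => pr (Cmod (Re q, t)))); [reflexivity|].
      apply (is_derive_comp pr (fun t : R => Cmod (Re q, t))).
      * replace (Re q, Im q) with q by now destruct q. now apply profile.
      * apply (is_derive_Cmod (fun t : R => (Re q, t)) (Im q) Ci).
        -- split; simpl; [apply (is_derive_const (V := R_NormedModule))|].
           apply (is_derive_id (K := R_AbsRing)).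
        -- now destruct q.
    + replace (Re q, Im q) with q by now destruct q. simpl.
      unfold scal; simpl; unfold mult, Re, Im; simpl. field. lra.
Qed.

(** * The square map *)


(* Elastic reflection reverses the normal component of the momentum; multiplication by
   [Cconj tau] makes the tangential direction real. *)
Lemma elastic_iff (S : mechanics) (W : C -> Prop) (k : C -> R) :
  (forall q, config S q -> density S q <> 0 /\ 0 < k q) ->
  (forall x, config S (fst x) -> grad_p (energy S) x = (RtoC (k (fst x)) * snd x)%C) ->
  forall x x', elastic S W x x' <->
    config S (fst x) /\ fst x' = fst x /\ W (fst x) /\
    exists tau, tangent W (fst x) tau /\
      (snd x' * Cconj tau = Cconj (snd x * Cconj tau))%C.
Proof.
  intros Hk Hgrad x x'. unfold elastic, phase.
  split; intros (Hc & Hf & HW & tau & Ht & H); (split; [exact Hc|]); (split; [exact Hf|]);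
    (split; [exact HW|]); exists tau; (split; [exact Ht|]);
    destruct (Hk _ Hc) as [Hd Hkp]; assert (Hd2 : density S (fst x) ^ 2 <> 0) by now apply pow_nonzero.
  - rewrite !Hgrad, Hf in H by (rewrite ?Hf; exact Hc). destruct H as [H1 H2].
    (* In the plane one normal vector suffices, and i tau is orthogonal to tau because the metric is
       conformal. *)
    specialize (H2 (Ci * tau)%C). unfold metric in *.
    set (K := k (fst x)) in *. set (d := density S (fst x) ^ 2) in *. clearbody K d.
    destruct x as [q [u v]], x' as [q' [u' v']], tau as [a b]. simpl in *.
    assert (E1 : u' * a + v' * b = u * a + v * b).
    { apply Rmult_eq_reg_l with (d * K); [lra|]. apply Rmult_integral_contrapositive_currified; lra. }
    assert (E2 : v' * a - u' * b = - (v * a - u * b)).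
    { apply Rmult_eq_reg_l with (d * K); [|apply Rmult_integral_contrapositive_currified; lra].
      assert (Z : d * ((0 * a - 1 * b) * a + (0 * b + 1 * a) * b) = 0) by ring.
      specialize (H2 Z). lra. }
    apply C_ext; simpl; lra.
  - cbv zeta. rewrite !Hgrad, Hf by (rewrite ?Hf; exact Hc). unfold metric.
    set (K := k (fst x)) in *. set (d := density S (fst x) ^ 2) in *.
    destruct Ht as [Htau _]. apply C_neq0 in Htau.
    assert (E1 := f_equal Re H). assert (E2 := f_equal Im H). clearbody K d.
    destruct x as [q [u v]], x' as [q' [u' v']], tau as [a b]. simpl in E1, E2, Htau |- *.
    split.
    + transitivity (d * K * (u' * a - v' * - b)); [ring|]. rewrite E1. ring.
    + intros [n1 n2] Hn. simpl in Hn |- *.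
      assert (Hn0 : n1 * a + n2 * b = 0) by (apply Rmult_eq_reg_l with d; lra).
      apply Rmult_eq_reg_r with (a * (a * 1) + b * (b * 1)); [|lra].
      (* |tau|^2 times the inner product with n, expanded in the orthogonal frame (tau, i tau). *)
      transitivity (d * K * ((u' * a - v' * - b) * (n1 * a + n2 * b) +
        (u' * - b + v' * a) * (n2 * a - n1 * b))); [ring|].
      rewrite E1, E2, Hn0.
      transitivity (- (d * K * ((u * a + v * b) * (n1 * a + n2 * b) +
        (v * a - u * b) * (n2 * a - n1 * b)))); [rewrite Hn0; ring|ring].
Qed.

Lemma hooke_elastic_iff (s f : R) (W : C -> Prop) : s * s = 1 ->
  forall x x', elastic (curvature_Hooke s f) W x x' <->
    unit_disc (fst x) /\ fst x' = fst x /\ W (fst x) /\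
    exists tau, tangent W (fst x) tau /\
      (snd x' * Cconj tau = Cconj (snd x * Cconj tau))%C.
Proof.
  intros Hs. apply (elastic_iff (curvature_Hooke s f) W (fun q => (1 + s * Cmod q ^ 2) ^ 2 / 4)).
  - intros q Hq. pose proof (curvature_factor_pos s Hs q Hq) as P. split.
    + simpl. unfold curvature_density. apply Rgt_not_eq, Rdiv_lt_0_compat; lra.
    + apply Rdiv_lt_0_compat; [now apply pow_lt|lra].
  - intros x _. apply hooke_grad_p.
Qed.

Lemma kepler_elastic_iff (m : R) (W : C -> Prop) :
  forall x x', elastic (hyperbolic_Kepler m) W x x' <->
    (unit_disc (fst x) /\ fst x <> 0%C) /\ fst x' = fst x /\ W (fst x) /\
    exists tau, tangent W (fst x) tau /\
      (snd x' * Cconj tau = Cconj (snd x * Cconj tau))%C.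
Proof.
  apply (elastic_iff (hyperbolic_Kepler m) W (fun q => (1 - Cmod q ^ 2) ^ 2 / 4)).
  - intros q [Hq _]. pose proof (one_minus_sqr_pos q Hq) as P. split.
    + simpl. unfold hyperbolic_density. apply Rgt_not_eq, Rdiv_lt_0_compat; lra.
    + apply Rdiv_lt_0_compat; [now apply pow_lt|lra].
  - intros x _. apply kepler_grad_p.
Qed.

Section SquareMap.
Variables (s m e : R) (Hs : s * s = 1).
Let f := - (s * m + e).
Let H := curvature_Hooke s f.
Let K := hyperbolic_Kepler m.

(** Here a = |z|^2. Since 1 - a^2 = (1 - s a) (1 + s a), this factor turns the pulled-back Kepler
    kinetic energy into the Hooke one; it is the rate of Kepler time with respect to Hooke time. *)
Definition time_factor (a : R) : R := 4 * a / (1 - s * a) ^ 2.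

Lemma curvature_cofactor_pos (z : C) : unit_disc z -> 0 < 1 - s * Cmod z ^ 2.
Proof.
  intros Hz. pose proof (one_minus_sqr_pos z Hz). pose proof (pow2_ge_0 (Cmod z)).
  destruct (sign_cases s Hs) as [E | E]; rewrite E; lra.
Qed.

Lemma time_factor_pos (z : C) : unit_disc z -> z <> 0%C -> 0 < time_factor (Cmod z ^ 2).
Proof.
  intros Hz H0. apply Cmod_gt_0 in H0. unfold time_factor.
  apply Rdiv_lt_0_compat; [|now apply pow_lt, curvature_cofactor_pos].
  pose proof (pow_lt _ 2 H0). lra.
Qed.

Lemma square_map_norms (x : state) : fst x <> 0%C ->
  Cmod (fst (square_map x)) = Cmod (fst x) ^ 2 /\
  Cmod (snd (square_map x)) ^ 2 = Cmod (snd x) ^ 2 / (4 * Cmod (fst x) ^ 2).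
Proof.
  intros H0. split; [apply Cmod_square|]. unfold square_map. simpl snd.
  rewrite Cmod_div by (apply Cmult_neq_0; auto using C2_neq0, Cconj_neq0).
  rewrite Cmod_mult, Cmod_conj, Cmod_R, Rabs_pos_eq by lra.
  apply Cmod_gt_0 in H0. field. lra.
Qed.

(** With A = |z|^2, the identity 1 + A^2 = (1 - s A)^2 + 2 s A splits the Kepler potential,
    multiplied by the time factor, into the constant - 2 m and a Hooke potential with coefficient -
    s m. The term from the energy is a Hooke potential with coefficient - e. This is the origin of
    [f] and of the level 2 m. *)
Lemma energy_square_map (x : state) : unit_disc (fst x) -> fst x <> 0%C ->
  time_factor (Cmod (fst x) ^ 2) * (energy K (square_map x) - e) = energy H x - 2 * m.
Proof.
  intros Hz H0. destruct (square_map_norms x H0) as [E1 E2].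
  unfold K, H. rewrite kepler_energy, hooke_energy, E1, E2, <- !Cmod2_alt.
  pose proof (curvature_cofactor_pos _ Hz) as P. apply Cmod_gt_0 in H0.
  pose proof (pow_lt _ 2 H0) as PA. unfold time_factor, f.
  set (A := Cmod (fst x) ^ 2) in *. set (Wn := Cmod (snd x) ^ 2). clearbody A Wn.
  destruct (sign_cases s Hs) as [E | E]; rewrite E in *; field; lra.
Qed.

Lemma energy_level_iff (x : state) : unit_disc (fst x) -> fst x <> 0%C ->
  (energy H x = 2 * m <-> energy K (square_map x) = e).
Proof.
  intros Hz H0. pose proof (energy_square_map x Hz H0) as E.
  pose proof (time_factor_pos _ Hz H0). split; intros G.
  - rewrite G in E. assert (energy K (square_map x) - e = 0); [|lra].
    apply Rmult_eq_reg_l with (time_factor (Cmod (fst x) ^ 2)); lra.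
  - rewrite G in E. lra.
Qed.

Lemma square_map_velocity (x : state) : unit_disc (fst x) -> fst x <> 0%C ->
  (time_factor (Cmod (fst x) ^ 2) * grad_p (energy K) (square_map x) =
   2 * fst x * grad_p (energy H) x)%C.
Proof.
  intros Hz H0. destruct (square_map_norms x H0) as [E1 _].
  unfold K, H. rewrite kepler_grad_p, hooke_grad_p, E1.
  pose proof (curvature_cofactor_pos _ Hz) as P.
  transitivity (RtoC (time_factor (Cmod (fst x) ^ 2) * ((1 - (Cmod (fst x) ^ 2) ^ 2) ^ 2 / 4)) *
    snd (square_map x))%C; [rewrite RtoC_mult; ring|].
  replace (time_factor (Cmod (fst x) ^ 2) * ((1 - (Cmod (fst x) ^ 2) ^ 2) ^ 2 / 4))
    with (4 * Cmod (fst x) ^ 2 * ((1 + s * Cmod (fst x) ^ 2) ^ 2 / 4)).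
  - rewrite !RtoC_mult, Cmod2_conj. unfold square_map. simpl snd. field.
    now apply Cconj_neq0.
  - unfold time_factor. set (A := Cmod (fst x) ^ 2) in *. clearbody A.
    destruct (sign_cases s Hs) as [E | E]; rewrite E in *; field; lra.
Qed.

(* On the energy level the drift of the momentum agrees with the Kepler force; this
   identity is where the value of the energy is used. *)
Lemma square_map_force (x : state) : unit_disc (fst x) -> fst x <> 0%C ->
  energy H x = 2 * m ->
  (time_factor (Cmod (fst x) ^ 2) * - grad_q (energy K) (square_map x) =
   - grad_q (energy H) x / (2 * Cconj (fst x)) -
   snd x * Cconj (grad_p (energy H) x) / (2 * (Cconj (fst x) * Cconj (fst x))))%C.
Proof.
  intros Hz H0 HE. destruct (square_map_norms x H0) as [E1 E2].
  pose proof (curvature_cofactor_pos _ Hz) as P.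
  pose proof (square_neq0 _ H0) as Hq0.
  unfold K, H in *. rewrite kepler_grad_q by exact Hq0.
  rewrite hooke_grad_p, hooke_grad_q, E1, E2 by lra.
  rewrite hooke_energy, <- !Cmod2_alt in HE.
  pose proof (Cconj_neq0 _ H0) as Hc.
  set (A := Cmod (fst x) ^ 2) in *. set (Wn := Cmod (snd x) ^ 2) in *.
  assert (PA : 0 < A) by (apply pow_lt; now apply Cmod_gt_0).
  assert (EA : RtoC A = (fst x * Cconj (fst x))%C) by apply Cmod2_conj.
  assert (EW : RtoC Wn = (snd x * Cconj (snd x))%C) by apply Cmod2_conj.
  set (k0 := (1 - A ^ 2) * (m / (2 * A ^ 3) - Wn / (4 * A) / 2)).
  set (k1 := time_factor A * k0).
  set (k2 := 2 * (1 + s * A) * (s * Wn / 4 + 4 * f / (1 - s * A) ^ 3)).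
  (* Both sides of the claim are real multiples of 1 / (conj z)^2; [key] compares the coefficients,
     and the level equation [HE] eliminates m. *)
  assert (key : k1 * A ^ 2 = k2 * A / 2 + (1 + s * A) ^ 2 / 4 * Wn / 2).
  { unfold k1, k0, k2, time_factor. replace m with (2 * m / 2) by field. rewrite <- HE.
    clear - P PA Hs. clearbody A Wn f.
    destruct (sign_cases s Hs) as [E | E]; rewrite E in *; field; lra. }
  transitivity (- (RtoC (k1 * A ^ 2) / (Cconj (fst x) * Cconj (fst x))))%C.
  - unfold square_map, square. simpl fst.
    replace (A ^ 2) with (A * A) by ring.
    rewrite !RtoC_mult, EA. unfold k1. rewrite RtoC_mult. field. exact Hc.
  - rewrite key. unfold Rdiv at 1. rewrite RtoC_plus. rewrite Cmult_conj.
    replace (Cconj (RtoC ((1 + s * A) ^ 2 / 4))) with (RtoC ((1 + s * A) ^ 2 / 4))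
      by (apply C_ext; simpl; ring).
    set (k3 := (1 + s * A) ^ 2 / 4). unfold Rdiv. rewrite !RtoC_mult, EA, EW, RtoC_inv by lra.
    field. exact Hc.
Qed.

Lemma square_map_push (I : R -> Prop) (x : R -> state) : motion H I x ->
  (forall t, I t -> fst (x t) <> 0%C /\ energy H (x t) = 2 * m) ->
  reparametrized_motion K I (fun t => square_map (x t)).
Proof.
  intros [HI Hx] Hlev.
  apply reparametrize with (fun t => time_factor (Cmod (fst (x t)) ^ 2)); [exact HI| | |].
  - intros t Ht. apply time_factor_pos; [apply (Hx t Ht)|apply (Hlev t Ht)].
  - intros t Ht. destruct (Hx t Ht) as (Hp & V & _).
    pose proof (has_velocity_continuous _ _ _ V) as Hc.
    pose proof (curvature_cofactor_pos _ Hp) as P. unfold time_factor. complex_cont.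
    apply Rgt_not_eq. now apply pow_lt.
  - intros t Ht. destruct (Hx t Ht) as (Hp & V1 & V2). destruct (Hlev t Ht) as [H0 HE].
    unfold phase in Hp. simpl config in Hp. split; [|split].
    + split; [now apply unit_disc_square|now apply square_neq0].
    + eapply has_velocity_eq; [apply square_curve_velocity; exact V1|].
      symmetry. now apply square_map_velocity.
    + eapply has_velocity_eq.
      * apply has_velocity_div; [exact V2| |].
        -- apply has_velocity_mult; [apply has_velocity_const|apply has_velocity_conj; exact V1].
        -- apply Cmult_neq_0; auto using C2_neq0, Cconj_neq0.
      * cbv beta. rewrite square_map_force by assumption. field. now apply Cconj_neq0.
Qed.

(** The position is lifted by [square_root_lift]; the momentum must then be 2 (conj z) p. The
    equations of motion follow from the two push-forward identities read backwards, at the inverse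
    rate of time. *)
Lemma square_map_lift (I : R -> Prop) (y : R -> state) : motion K I y ->
  (forall t, I t -> energy K (y t) = e) ->
  forall t0 x0, I t0 -> phase H x0 -> square_map x0 = y t0 ->
  exists x, x t0 = x0 /\ (forall t, I t -> square_map (x t) = y t) /\
    reparametrized_motion H I x.
Proof.
  intros [HI Hy] Hlev t0 x0 I0 Hx0 E0.
  destruct (square_root_lift I (fun t => fst (y t)) (fun t => grad_p (energy K) (y t))
    t0 (fst x0) HI) as (z & Ez0 & Hz); try assumption.
  - intros t Ht. now apply Hy.
  - intros t Ht. destruct (Hy t Ht) as (_ & V1 & V2).
    apply has_velocity_continuous in V1, V2.
    apply continuous_ext with
      (fun t => RtoC ((1 - Cmod (fst (y t)) ^ 2) ^ 2 / 4) * snd (y t))%C.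
    + intros r. symmetry. apply kepler_grad_p.
    + complex_cont. lra.
  - intros t Ht. now apply (Hy t Ht).
  - rewrite <- E0. reflexivity.
  - assert (Hz0 : forall t, I t -> z t <> 0%C /\ unit_disc (z t)).
    { intros t Ht. destruct (Hz t Ht) as [Ez _]. destruct (Hy t Ht) as ((Hd & Hn) & _).
      split; [|apply unit_disc_square; now rewrite Ez].
      intros E. apply Hn. rewrite <- Ez, E. unfold square. ring. }
    set (x := fun t => (z t, (2 * Cconj (z t) * snd (y t))%C) : state).
    assert (Hsq : forall t, I t -> square_map (x t) = y t).
    { intros t Ht. destruct (Hz t Ht) as [Ez _]. destruct (Hz0 t Ht) as [Hn _].
      apply injective_projections; simpl; [exact Ez|]. field. now apply Cconj_neq0. }
    exists x. split; [|split; [exact Hsq|]].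
    + apply injective_projections; simpl; [exact Ez0|]. rewrite Ez0, <- E0. simpl.
      field. apply Cconj_neq0. rewrite <- Ez0. now apply Hz0.
    + apply reparametrize with (fun t => / time_factor (Cmod (fst (x t)) ^ 2)); [exact HI| | |].
      * intros t Ht. destruct (Hz0 t Ht) as [Hn Hd].
        apply Rinv_0_lt_compat. now apply time_factor_pos.
      * intros t Ht. destruct (Hz0 t Ht) as [Hn Hd].
        pose proof (has_velocity_continuous _ _ _ (proj2 (Hz t Ht))) as Hc.
        pose proof (time_factor_pos _ Hd Hn) as TP.
        pose proof (curvature_cofactor_pos _ Hd) as P.
        apply (continuous_comp (fun t => time_factor (Cmod (z t) ^ 2)) Rinv).
        -- unfold time_factor. complex_cont. apply Rgt_not_eq. now apply pow_lt.
        -- apply continuous_Rinv. apply Rgt_not_eq, TP.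
      * intros t Ht. destruct (Hz0 t Ht) as [Hn Hd]. destruct (Hz t Ht) as [_ Vz].
        destruct (Hy t Ht) as (_ & _ & V2).
        pose proof (time_factor_pos _ Hd Hn) as TP.
        assert (Tn : RtoC (time_factor (Cmod (z t) ^ 2)) <> 0%C)
          by (intros E; apply RtoC_inj in E; lra).
        pose proof (Cconj_neq0 _ Hn) as Hcn.
        assert (HE : energy H (x t) = 2 * m).
        { apply energy_level_iff; try assumption. rewrite Hsq by exact Ht. now apply Hlev. }
        pose proof (square_map_velocity (x t) Hd Hn) as F1.
        pose proof (square_map_force (x t) Hd Hn HE) as F2.
        rewrite (Hsq t Ht) in F1, F2. change (fst (x t)) with (z t) in F1, F2.
        assert (Vz' : (grad_p (energy K) (y t) / (2 * z t) =
          RtoC (/ time_factor (Cmod (z t) ^ 2)) * grad_p (energy H) (x t))%C).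
        { rewrite RtoC_inv by lra.
          transitivity (/ time_factor (Cmod (z t) ^ 2) *
            (time_factor (Cmod (z t) ^ 2) * grad_p (energy K) (y t)) / (2 * z t))%C.
          - field. split; assumption.
          - rewrite F1. field. split; assumption. }
        split; [exact Hd|]. split.
        -- eapply has_velocity_eq; [exact Vz|exact Vz'].
        -- eapply has_velocity_eq.
           ++ apply has_velocity_mult; [|exact V2].
              apply has_velocity_mult; [apply has_velocity_const|apply has_velocity_conj; exact Vz].
           ++ cbv beta. change (fst (x t)) with (z t). rewrite Vz'.
              replace (- grad_q (energy K) (y t))%C with
                (/ time_factor (Cmod (z t) ^ 2) *
                  (time_factor (Cmod (z t) ^ 2) * - grad_q (energy K) (y t)))%C by (field; assumption).
              rewrite F2, Cmult_conj.
              replace (Cconj (RtoC (/ time_factor (Cmod (z t) ^ 2))))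
                with (RtoC (/ time_factor (Cmod (z t) ^ 2))) by (apply C_ext; simpl; ring).
              rewrite RtoC_inv by lra. unfold x. simpl snd. field. split; assumption.
Qed.

(** * Walls and reflections under the square map *)

Section Wall.
Variables (F : C) (HF : unit_disc F).
Variables (W : C -> Prop) (HW : combination (conic_branch hyperbolic_density 0%C F) W).

Lemma wall_in_disc (q : C) : W q -> unit_disc q.
Proof.
  intros Hq. destruct (combination_cover _ _ HW) as (L & HL & Hcov).
  destruct (Hcov q Hq) as (X & HX & Xq).
  destruct (conic_branch_level F X HF (HL X HX)) as (sg & k & _ & Hlev). now apply Hlev.
Qed.

(** The curve in the wall may run into 0, where no lift is available; as z <> 0 it can be shortened
    around its base point so as to avoid 0. *)
Lemma tangent_lift (z tau : C) : z <> 0%C ->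
  tangent W (square z) tau -> tangent (preimage W) z (tau / (2 * z))%C.
Proof.
  intros Hz (Htau & d & g & Hd & Hg & g0 & Hv & HWg).
  assert (D0 : (2 * z)%C <> 0%C) by (apply Cmult_neq_0; auto using C2_neq0).
  assert (V : forall t, - d < t < d -> has_velocity g t (velocity_of g t)).
  { intros t Ht. now apply (C1_on_has_velocity (fun t => - d < t < d)). }
  destruct (locally_neq0 g 0) as [r Hr].
  { eapply has_velocity_continuous, V. lra. }
  { rewrite g0. now apply square_neq0. }
  pose proof (cond_pos r) as Pr. set (d' := Rmin d r).
  assert (Pd' : 0 < d') by now apply Rmin_glb_lt.
  pose proof (Rmin_l d r : d' <= d) as L1. pose proof (Rmin_r d r : d' <= r) as L2.
  destruct (square_root_lift (fun t => - d' < t < d') g (velocity_of g) 0 z) as (h & h0 & Hh).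
  - split; [apply open_symmetric_interval|]. intros; lra.
  - intros t Ht. apply V. lra.
  - intros t Ht. apply Hg. lra.
  - intros t Ht. apply Hr. change (Rabs (t - 0) < r). apply Rabs_def1; lra.
  - lra.
  - now symmetry.
  - assert (Hn : forall t, - d' < t < d' -> h t <> 0%C).
    { intros t Ht E. apply (Hr t).
      - change (Rabs (t - 0) < r). apply Rabs_def1; lra.
      - rewrite <- (proj1 (Hh t Ht)), E. unfold square. ring. }
    split.
    + intros E. apply Htau. replace tau with (tau / (2 * z) * (2 * z))%C by (field; exact Hz).
      rewrite E. ring.
    + exists d', h. split; [exact Pd'|]. split; [|split; [exact h0|split]].
      * apply C1_on_intro with (fun t => velocity_of g t / (2 * h t))%C.
        -- intros t Ht. generalize (open_symmetric_interval d' t Ht). apply filter_imp.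
           intros u Hu. now apply Hh.
        -- intros t Ht. pose proof (has_velocity_continuous _ _ _ (proj2 (Hh t Ht))).
           destruct (Hg t) as (_ & _ & Hc); [lra|]. complex_cont.
           apply Cmult_neq_0; auto using C2_neq0.
      * rewrite (has_velocity_velocity_of h 0 _ (proj2 (Hh 0 ltac:(lra)))). now rewrite h0, Hv.
      * intros t Ht. assert (Wt : W (square (h t))) by (rewrite (proj1 (Hh t Ht)); apply HWg; lra).
        split; [|exact Wt]. now apply unit_disc_square, wall_in_disc.
Qed.

(** The reflection law involves only the product of the momentum with the conjugate tangent vector,
    and this product is unchanged: w / (2 conj z) times the conjugate of 2 z tau is w conj tau. *)
Lemma square_map_elastic (x x' : state) : phase H x -> fst x <> 0%C -> fst x' = fst x ->
  (elastic H (preimage W) x x' <-> elastic K W (square_map x) (square_map x')).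
Proof.
  intros Hx H0 Hf. unfold H, K. rewrite hooke_elastic_iff, kepler_elastic_iff by exact Hs.
  pose proof (Cconj_neq0 _ H0) as Hc. unfold phase in Hx. simpl config in Hx.
  unfold square_map. simpl fst. simpl snd. rewrite Hf. split.
  - intros (_ & _ & [_ HWz] & tau & Ht & E).
    split; [split; [now apply unit_disc_square|now apply square_neq0]|].
    split; [reflexivity|]. split; [exact HWz|]. exists (2 * fst x * tau)%C.
    split; [now apply tangent_preimage_square|]. rewrite Cmult_conj.
    rewrite Cmult_conj. replace (Cconj (RtoC 2)) with (RtoC 2) by (apply C_ext; simpl; ring).
    transitivity (snd x' * Cconj tau)%C; [field; exact Hc|]. rewrite E. f_equal. field. exact Hc.
  - intros (_ & _ & HWz & tau & Ht & E). split; [exact Hx|]. split; [reflexivity|].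
    split; [split; assumption|]. exists (tau / (2 * fst x))%C.
    split; [now apply tangent_lift|].
    assert (D0 : (2 * fst x)%C <> 0%C) by (apply Cmult_neq_0; auto using C2_neq0).
    rewrite Cdiv_conj by exact D0. rewrite Cmult_conj.
    replace (Cconj (RtoC 2)) with (RtoC 2) by (apply C_ext; simpl; ring).
    transitivity (snd x' / (2 * Cconj (fst x)) * Cconj tau)%C; [field; exact Hc|].
    rewrite E. f_equal. field. exact Hc.
Qed.

Lemma square_map_conformal :
  conformally_transformed K W e H (preimage W) (2 * m).
Proof.
  split.
  - intros x Hx H0. split; [now apply unit_disc_square|now apply square_neq0].
  - intros [q p] [Hq H0]. simpl in *. destruct (square_surjective q) as [z <-].
    assert (Hz : z <> 0%C) by (intros ->; apply H0; unfold square; ring).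
    exists (z, (2 * Cconj z * p)%C). split; [now apply unit_disc_square|].
    split; [exact Hz|]. unfold square_map. simpl. f_equal. field. now apply Cconj_neq0.
  - intros x Hx H0. now apply energy_level_iff.
  - exact square_map_push.
  - exact square_map_lift.
  - intros z Hz. unfold preimage. split; [now intros [_ Wz]|now split].
  - exact square_map_elastic.
Qed.
End Wall.
End SquareMap.

(** * First integrals *)


Definition inner (u v : C) : R := Re u * Re v + Im u * Im v.

(** Differentiability as a chain rule along all pairs of differentiable curves. Partial derivatives
    alone would not give the derivative along a motion. *)
Definition gradient_at (G : state -> R) (x : state) (gq gp : C) : Prop :=
  forall (q p : R -> C) (t : R) (dq dp : C), q t = fst x -> p t = snd x ->
    has_velocity q t dq -> has_velocity p t dp ->
    is_derive (fun s => G (q s, p s)) t (inner gq dq + inner gp dp).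

Lemma has_velocity_axis (x y : R) :
  has_velocity (fun s => (s, y)) x 1 /\ has_velocity (fun s => (x, s)) y Ci.
Proof.
  split; split; simpl; first [apply (is_derive_id (K := R_AbsRing))
                             |apply (is_derive_const (V := R_NormedModule))].
Qed.

Section GradientAt.
Variables (G : state -> R) (x : state) (gq gp : C).
Hypothesis HG : gradient_at G x gq gp.

Lemma gradient_at_partials :
  is_derive (fun s => G ((s, Im (fst x)), snd x)) (Re (fst x)) (Re gq) /\
  is_derive (fun s => G ((Re (fst x), s), snd x)) (Im (fst x)) (Im gq) /\
  is_derive (fun s => G (fst x, (s, Im (snd x)))) (Re (snd x)) (Re gp) /\
  is_derive (fun s => G (fst x, (Re (snd x), s))) (Im (snd x)) (Im gp).
Proof.
  destruct x as [[x1 y1] [u1 v1]]. simpl.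
  destruct (has_velocity_axis x1 y1) as [V1 V2], (has_velocity_axis u1 v1) as [V3 V4].
  pose proof (fun c t => has_velocity_const c t) as V0.
  pose proof (HG (fun s => (s, y1)) (fun _ => (u1, v1)) _ _ _ eq_refl eq_refl V1 (V0 _ _)) as D1.
  pose proof (HG (fun s => (x1, s)) (fun _ => (u1, v1)) _ _ _ eq_refl eq_refl V2 (V0 _ _)) as D2.
  pose proof (HG (fun _ => (x1, y1)) (fun s => (s, v1)) _ _ _ eq_refl eq_refl (V0 _ _) V3) as D3.
  pose proof (HG (fun _ => (x1, y1)) (fun s => (u1, s)) _ _ _ eq_refl eq_refl (V0 _ _) V4) as D4.
  split; [|split; [|split]]; eapply is_derive_eq; try eassumption; unfold inner; simpl; unfold Re, Im; ring.
Qed.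

Lemma gradient_at_grad : grad_q G x = gq /\ grad_p G x = gp.
Proof.
  destruct gradient_at_partials as (D1 & D2 & D3 & D4).
  split; apply C_ext; simpl; now apply is_derive_unique.
Qed.
End GradientAt.

(** * A sufficient criterion for integrability *)

Section Integrability.
Variables (S : mechanics) (W : C -> Prop) (G : state -> R) (gq gp c : state -> C) (k : state -> R).
Hypothesis phase_open : forall x, phase S x -> locally x (phase S).
Hypothesis HG : forall x, phase S x -> gradient_at G x (gq x) (gp x).
Hypothesis gq_cont : forall x, phase S x -> continuous gq x.
Hypothesis gp_cont : forall x, phase S x -> continuous gp x.
Hypothesis bracket : forall x, phase S x ->
  inner (gq x) (grad_p (energy S) x) = inner (gp x) (grad_q (energy S) x).

Lemma gradient_C1_phase : C1_phase S G.
Proof.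
  intros x Hx. destruct (gradient_at_partials G x _ _ (HG x Hx)) as (D1 & D2 & D3 & D4).
  split; [eexists; exact D1|]. split; [eexists; exact D2|]. split; [eexists; exact D3|].
  split; [eexists; exact D4|]. split.
  - apply continuous_ext_loc with gq; [|now apply gq_cont].
    generalize (phase_open x Hx). apply filter_imp. intros y Hy.
    symmetry. now apply (gradient_at_grad G y _ _ (HG y Hy)).
  - apply continuous_ext_loc with gp; [|now apply gp_cont].
    generalize (phase_open x Hx). apply filter_imp. intros y Hy.
    symmetry. now apply (gradient_at_grad G y _ _ (HG y Hy)).
Qed.

(** The hypothesis [bracket] says that the Poisson bracket with the energy vanishes; the chain rule
    turns it into a zero derivative along motions. *)
Lemma bracket_first_integral : first_integral S G.
Proof.
  intros I x [HI Hx].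
  enough (key : forall a b, I a -> I b -> a <= b -> G (x a) = G (x b)).
  { intros a b Ha Hb. destruct (Rle_dec a b); [now apply key|].
    symmetry. apply key; auto. lra. }
  intros a b Ha Hb Hab. apply (zero_derivative_const (fun t => G (x t))).
  intros t Ht. rewrite Rmin_left, Rmax_right in Ht by lra.
  destruct (Hx t (proj2 HI a t b Ha Hb Ht)) as (Hp & V1 & V2).
  apply is_derive_ext with (fun s => G (fst (x s), snd (x s))).
  - intros s. now rewrite <- surjective_pairing.
  - eapply is_derive_eq.
    + exact (HG _ Hp (fun s => fst (x s)) (fun s => snd (x s)) t _ _ eq_refl eq_refl V1 V2).
    + pose proof (bracket _ Hp) as B. unfold inner in *.
      revert B. generalize (grad_p (energy S) (x t)), (grad_q (energy S) (x t)).
      intros u v B. simpl. unfold Re, Im in *. lra.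
Qed.

Hypothesis Hk : forall x, phase S x -> 0 < k x.
Hypothesis Hgrad : forall x, phase S x -> grad_p (energy S) x = (RtoC (k x) * snd x)%C.
Hypothesis Hcross : forall x, phase S x ->
  Re (gp x) * Im (snd x) - Im (gp x) * Re (snd x) = Im (c x * (Cconj (snd x) * Cconj (snd x))).

(** The momentum part of the differential of the energy is parallel to the momentum p. By [Hcross],
    a nonzero imaginary part of c (conj p)^2 means that the momentum gradient of [G] is not, so the
    momentum parts alone give independence. *)
Lemma independent_of_energy (x : state) : phase S x ->
  Im (c x * (Cconj (snd x) * Cconj (snd x))) <> 0 -> independent_at G (energy S) x.
Proof.
  intros Hx Hn al be _ E. rewrite Hgrad in E by exact Hx.
  destruct (gradient_at_grad G x _ _ (HG x Hx)) as [_ Eg]. rewrite Eg in E.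
  pose proof (Hcross x Hx) as X. pose proof (Hk x Hx) as Kp.
  assert (Hw : snd x <> 0%C).
  { intros Z. apply Hn. rewrite Z. simpl. ring. }
  apply C_neq0 in Hw. pose proof (f_equal Re E) as E1. pose proof (f_equal Im E) as E2.
  rewrite <- X in Hn. simpl in E1, E2. unfold Re, Im in *.
  set (A := fst (gp x)) in *. set (B := snd (gp x)) in *.
  set (u := fst (snd x)) in *. set (v := snd (snd x)) in *.
  assert (al = 0) as ->.
  { apply Rmult_eq_reg_r with (A * v - B * u); [|exact Hn].
    transitivity ((al * A + be * k x * u) * v - (al * B + be * k x * v) * u); [ring|].
    replace (al * A + be * k x * u) with 0 by lra. replace (al * B + be * k x * v) with 0 by lra.
    ring. }
  split; [reflexivity|].
  apply Rmult_eq_reg_r with (k x * (u ^ 2 + v ^ 2)); [|apply Rgt_not_eq, Rmult_lt_0_compat; lra].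
  transitivity (be * k x * u * u + be * k x * v * v); [ring|].
  replace (be * k x * u) with 0 by lra. replace (be * k x * v) with 0 by lra. ring.
Qed.

Hypothesis c_position : forall q p p', c (q, p) = c (q, p').
Hypothesis c_dense : forall x d, phase S x -> 0 < d < 1 -> c x = 0%C ->
  phase S (RtoC (1 - d) * fst x, snd x)%C /\ c (RtoC (1 - d) * fst x, snd x)%C <> 0%C.
Hypothesis phase_position : forall q p p', phase S (q, p) -> phase S (q, p').

(** Im (z (conj p)^2) is a nonzero quadratic form in p. By the parallelogram identity, if it
    vanished at p, p + d n and p - d n, it would vanish at n. *)
Lemma nonreal_direction (z p : C) (eps : R) : z <> 0%C -> 0 < eps ->
  exists p', Cmod (p' - p) < eps /\ Im (z * (Cconj p' * Cconj p')) <> 0.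
Proof.
  intros Hz He.
  destruct (classic (Im (z * (Cconj p * Cconj p)) = 0)) as [E | N].
  2:{ exists p. replace (p - p)%C with (RtoC 0) by ring. now rewrite Cmod_0. }
  (* n = 1 works unless z is real; then 1 + i does, since the square of its conjugate is - 2 i. *)
  assert (Hn : exists n, Cmod n <= 2 /\ Im (z * (Cconj n * Cconj n)) <> 0).
  { destruct (Req_dec (Im z) 0) as [I0 | I1].
    - exists (1, 1). split.
      + eapply Rle_trans; [apply Cmod_2Rmax|]. simpl. rewrite Rabs_R1, Rmax_left by lra.
        rewrite Rmult_1_r. rewrite <- (sqrt_pow2 2) at 2 by lra. apply sqrt_le_1_alt. lra.
      + simpl. intros F. apply Hz. apply C_ext; simpl; [|exact I0].
        unfold Re, Im in *. rewrite I0 in F. lra.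
    - exists 1%C. split; [rewrite Cmod_1; lra|].
      simpl. unfold Re, Im in *. intros F. apply I1. lra. }
  destruct Hn as (n & Bn & Nn). set (d := eps / 4).
  assert (near : forall e : R, Rabs e = d -> Cmod (p + e * n - p) < eps).
  { intros e Hd. replace (p + e * n - p)%C with (e * n)%C by ring.
    rewrite Cmod_mult, Cmod_R, Hd. unfold d. pose proof (Cmod_ge_0 n). nra. }
  assert (Pd : 0 < d) by (unfold d; lra).
  destruct (classic (Im (z * (Cconj (p + d * n) * Cconj (p + d * n))) = 0)) as [E1 | N1].
  - exists (p + (- d)%R * n)%C. split; [apply near; rewrite Rabs_Ropp; apply Rabs_pos_eq; lra|].
    intros E2. apply Nn. apply Rmult_eq_reg_l with (2 * d ^ 2); [|nra].
    transitivity (Im (z * (Cconj (p + d * n) * Cconj (p + d * n))) +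
      Im (z * (Cconj (p + (- d)%R * n) * Cconj (p + (- d)%R * n))) -
      2 * Im (z * (Cconj p * Cconj p))).
    + destruct z, p, n. simpl. ring.
    + rewrite E, E1, E2. ring.
  - exists (p + d * n)%C. split; [apply near; apply Rabs_pos_eq; lra|exact N1].
Qed.

Lemma dense_independence : functionally_independent S G (energy S).
Proof.
  intros [q p] Hx eps He.
  assert (Hq : exists q', phase S (q', p) /\ Cmod (q' - q) < eps /\ c (q', p) <> 0%C).
  { destruct (classic (c (q, p) = 0%C)) as [E | N].
    (* d is small enough that the contraction by 1 - d moves q by less than eps; the added 1 in the
       denominator covers q = 0. *)
    - set (d := Rmin 1 (eps / (Cmod q + 1)) / 2). pose proof (Cmod_ge_0 q).
      assert (P : 0 < eps / (Cmod q + 1)) by (apply Rdiv_lt_0_compat; lra).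
      pose proof (Rmin_l 1 (eps / (Cmod q + 1))). pose proof (Rmin_r 1 (eps / (Cmod q + 1))).
      assert (0 < Rmin 1 (eps / (Cmod q + 1))) by (apply Rmin_glb_lt; lra).
      destruct (c_dense (q, p) d Hx) as [Hp Hc]; [unfold d; lra|exact E|].
      simpl in Hp, Hc. exists (RtoC (1 - d) * q)%C. split; [exact Hp|]. split; [|exact Hc].
      replace (RtoC (1 - d) * q - q)%C with (- (d * q))%C by (rewrite RtoC_minus; ring).
      rewrite Cmod_opp, Cmod_mult, Cmod_R, Rabs_pos_eq by (unfold d; lra).
      assert (d < eps / (Cmod q + 1)) by (unfold d; lra).
      apply Rle_lt_trans with (d * (Cmod q + 1)); [unfold d; nra|].
      apply Rlt_le_trans with (eps / (Cmod q + 1) * (Cmod q + 1)); [nra|].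
      right. field. lra.
    - exists q. replace (q - q)%C with (RtoC 0) by ring. now rewrite Cmod_0. }
  destruct Hq as (q' & Hq' & Dq & Nq).
  destruct (nonreal_direction (c (q', p)) p eps Nq He) as (p' & Dp & Np).
  exists (q', p'). split; [now apply phase_position with p|]. split; [exact Dq|]. split; [exact Dp|].
  apply independent_of_energy; [now apply phase_position with p|].
  simpl snd. now rewrite (c_position q' p' p).
Qed.

Lemma integrable_intro :
  (forall x x', elastic S W x x' -> G x' = G x) -> integrable S W.
Proof.
  intros HW. exists G. split; [exact gradient_C1_phase|]. split; [exact bracket_first_integral|].
  split; [exact HW|exact dense_independence].
Qed.
End Integrability.

(** For c (conj tau)^2 real, the quantity Re (c (conj p)^2) depends only on the squares of the real
    and imaginary parts of p conj tau, which complex conjugation preserves. *)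
Lemma reflection_invariants (c p p' tau : C) : tau <> 0%C ->
  Im (c * (Cconj tau * Cconj tau)) = 0 -> (p' * Cconj tau = Cconj (p * Cconj tau))%C ->
  Cmod p' ^ 2 = Cmod p ^ 2 /\
  Re (c * (Cconj p' * Cconj p')) = Re (c * (Cconj p * Cconj p)).
Proof.
  intros Ht Hc E. split.
  - f_equal. apply (f_equal Cmod) in E. rewrite Cmod_conj, !Cmod_mult, Cmod_conj in E.
    apply Cmod_gt_0 in Ht. apply Rmult_eq_reg_r with (Cmod tau); lra.
  - apply C_neq0 in Ht.
    apply Rmult_eq_reg_r with ((Re tau ^ 2 + Im tau ^ 2) ^ 2); [|apply Rgt_not_eq; now apply pow_lt].
    pose proof (f_equal Re E) as E1. pose proof (f_equal Im E) as E2.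
    set (d := (c * (Cconj tau * Cconj tau))%C) in *.
    (* Multiplying by |tau|^4 expresses c (conj w)^2 as d times the square of the conjugate of w
       conj tau; the mixed term carries the factor Im d = 0. *)
    assert (expand : forall w, Re (c * (Cconj w * Cconj w)) * (Re tau ^ 2 + Im tau ^ 2) ^ 2 =
      Re d * (Re (w * Cconj tau) ^ 2 - Im (w * Cconj tau) ^ 2) +
      2 * Im d * (Re (w * Cconj tau) * Im (w * Cconj tau))).
    { intros w. unfold d. destruct c, w, tau. simpl. ring. }
    rewrite !expand, Hc, E1, E2. simpl. ring.
Qed.

Lemma locally_unit_disc (x : state) : unit_disc (fst x) -> locally x (fun y => unit_disc (fst y)).
Proof.
  intros H.
  assert (Hc : continuous (fun y : state => Cmod (fst y)) x).
  { apply continuous_Cmod, continuous_fst. }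
  apply (Hc (fun r => r < 1)). now apply (open_lt 1).
Qed.

(** * The first integral of the Kepler billiard *)

Section KeplerIntegral.
Variables (m : R) (F : C).

(* The component along the major axis of the analogue of the Laplace-Runge-Lenz vector, minus a multiple
   of the square of the angular momentum. *)
Definition kepler_integral (x : state) : R :=
  let X := Re (fst x) in let Y := Im (fst x) in let U := Re (snd x) in let V := Im (snd x) in
  let L := X * V - Y * U in
  L * (Re F * V - Im F * U + (Re F * X + Im F * Y) * L -
       (X * U + Y * V) * (Re F * Y - Im F * X) - (1 + Re F ^ 2 + Im F ^ 2) * L) -
  2 * m * ((Re F * X + Im F * Y) / Cmod (fst x)).

Definition kepler_integral_q (x : state) : C :=
  let X := Re (fst x) in let Y := Im (fst x) in let U := Re (snd x) in let V := Im (snd x) in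
  let L := X * V - Y * U in let B := Re F * X + Im F * Y in let Q := X * U + Y * V in
  let N := Re F * Y - Im F * X in let ka := 1 + Re F ^ 2 + Im F ^ 2 in
  let M := Re F * V - Im F * U + B * L - Q * N - ka * L in
  (V * M + L * (Re F * L + B * V - U * N + Q * Im F - ka * V) -
     2 * m * (Re F / Cmod (fst x) - B * X / Cmod (fst x) ^ 3),
   - U * M + L * (Im F * L - B * U - V * N - Q * Re F + ka * U) -
     2 * m * (Im F / Cmod (fst x) - B * Y / Cmod (fst x) ^ 3)).

Definition kepler_integral_p (x : state) : C :=
  let X := Re (fst x) in let Y := Im (fst x) in let U := Re (snd x) in let V := Im (snd x) in
  let L := X * V - Y * U in let B := Re F * X + Im F * Y in let Q := X * U + Y * V in
  let N := Re F * Y - Im F * X in let ka := 1 + Re F ^ 2 + Im F ^ 2 in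
  let M := Re F * V - Im F * U + B * L - Q * N - ka * L in
  (- Y * M + L * (- Im F - B * Y - X * N + ka * Y),
   X * M + L * (Re F + B * X - Y * N - ka * X)).

Lemma kepler_integral_gradient (x : state) : fst x <> 0%C ->
  gradient_at kepler_integral x (kepler_integral_q x) (kepler_integral_p x).
Proof.
  intros Hx q p t dq dp Eq Ep Vq Vp. rewrite <- Eq in Hx.
  destruct x as [q0 p0]. simpl in Eq, Ep. subst q0 p0.
  pose proof (is_derive_Cmod q t dq Vq Hx) as DC.
  destruct Vq as [DX DY], Vp as [DU DV]. apply Cmod_gt_0 in Hx.
  unfold kepler_integral, kepler_integral_q, kepler_integral_p, inner. simpl fst. simpl snd.
  set (r := fun s => Cmod (q s)) in *. change (Cmod (q t)) with (r t) in *.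
  set (X := fun s => Re (q s)) in *. set (Y := fun s => Im (q s)) in *.
  set (U := fun s => Re (p s)) in *. set (V := fun s => Im (p s)) in *.
  eapply is_derive_ext with (fun s =>
    (X s * V s - Y s * U s) *
    (Re F * V s - Im F * U s + (Re F * X s + Im F * Y s) * (X s * V s - Y s * U s) -
       (X s * U s + Y s * V s) * (Re F * Y s - Im F * X s) -
       (1 + Re F ^ 2 + Im F ^ 2) * (X s * V s - Y s * U s)) -
    2 * m * ((Re F * X s + Im F * Y s) / r s)); [reflexivity|].
  change (Re (q t)) with (X t) in *. change (Im (q t)) with (Y t) in *.
  change (Re (p t)) with (U t) in *. change (Im (p t)) with (V t) in *.
  change (is_derive X t (Re dq)) in DX. change (is_derive Y t (Im dq)) in DY.
  change (is_derive U t (Re dp)) in DU. change (is_derive V t (Im dp)) in DV.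
  change (is_derive r t ((X t * Re dq + Y t * Im dq) / r t)) in DC.
  clearbody X Y U V r. simpl Re. simpl Im.
  auto_derive.
  - repeat match goal with |- _ /\ _ => split end; try (eexists; eassumption); try exact I. lra.
  - replace (Derive (fun x : R => X x) t) with (Re dq) by (symmetry; now apply is_derive_unique).
    replace (Derive (fun x : R => Y x) t) with (Im dq) by (symmetry; now apply is_derive_unique).
    replace (Derive (fun x : R => U x) t) with (Re dp) by (symmetry; now apply is_derive_unique).
    replace (Derive (fun x : R => V x) t) with (Im dp) by (symmetry; now apply is_derive_unique).
    replace (Derive (fun x : R => r x) t) with ((X t * Re dq + Y t * Im dq) / r t)
      by (symmetry; now apply is_derive_unique).
    unfold Re, Im. simpl. field. lra.
Qed.

Definition kepler_form (x : state) : C :=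
  ((F - fst x) * (1 - Cconj F * fst x) * fst x)%C.

(** This form shows the invariance under reflections: apart from functions of the position, the
    momentum enters only through |p|^2 and Re (c (conj p)^2), with c the coefficient in the tangency
    condition of the wall. *)
Lemma kepler_integral_form (x : state) :
  kepler_integral x =
  (- Re (kepler_form x * (Cconj (snd x) * Cconj (snd x))) +
   Cmod (snd x) ^ 2 * ((1 + Cmod (fst x) ^ 2) * (Re F * Re (fst x) + Im F * Im (fst x)) -
     Cmod (fst x) ^ 2 * (1 + Re F ^ 2 + Im F ^ 2))) / 2 -
  2 * m * ((Re F * Re (fst x) + Im F * Im (fst x)) / Cmod (fst x)).
Proof.
  rewrite !Cmod2_alt. unfold kepler_integral, kepler_form. cbv zeta.
  apply (f_equal (fun r => r - _)). destruct F, x as [[x y] [u v]]. simpl. field.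
Qed.

Lemma kepler_integrable (W : C -> Prop) : unit_disc F -> F <> 0%C ->
  combination (conic_branch hyperbolic_density 0%C F) W ->
  integrable (hyperbolic_Kepler m) W.
Proof.
  intros HF HF0 HW.
  apply (integrable_intro (hyperbolic_Kepler m) W kepler_integral kepler_integral_q
    kepler_integral_p kepler_form (fun x => (1 - Cmod (fst x) ^ 2) ^ 2 / 4)).
  - intros x [Hd H0]. apply filter_and; [now apply locally_unit_disc|].
    apply (locally_neq0 (fun y : state => fst y) x); [apply continuous_fst|exact H0].
  - intros x [Hd H0]. now apply kepler_integral_gradient.
  - intros x [Hd H0]. apply Cmod_gt_0 in H0. pose proof (pow_lt _ 3 H0) as H3. simpl in H3.
    apply continuous_C; unfold kepler_integral_q; cbv zeta; simpl Re; simpl Im; complex_cont;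
      lra.
  - intros x [Hd H0].
    apply continuous_C; unfold kepler_integral_p; cbv zeta; simpl Re; simpl Im; complex_cont.
  - intros x [Hd H0]. rewrite kepler_grad_p, kepler_grad_q by exact H0.
    apply Cmod_gt_0 in H0. unfold inner, kepler_integral_q, kepler_integral_p. cbv zeta.
    pose proof (Cmod2_alt (fst x)) as E. rewrite (Cmod2_alt (snd x)).
    set (r := Cmod (fst x)) in *. clearbody r.
    (* All negative powers of r are brought to r^(-3), which is then treated as an unknown; since
       r^2 is replaced by X^2 + Y^2, the bracket becomes a polynomial identity. *)
    assert (E1 : forall b, b / r = b * (Re (fst x) ^ 2 + Im (fst x) ^ 2) * / r ^ 3)
      by (intros b; rewrite <- E; field; lra).
    rewrite !E1, E. unfold Rdiv. rewrite Rinv_mult. generalize (/ r ^ 3). intros r3.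
    destruct F, x as [[x y] [u v]]. simpl. field.
  - intros x [Hd H0]. apply Rdiv_lt_0_compat; [apply pow_lt; now apply one_minus_sqr_pos|lra].
  - intros x _. apply kepler_grad_p.
  - intros x _. unfold kepler_integral_p, kepler_form.
    destruct F, x as [[x y] [u v]]. simpl. ring.
  - reflexivity.
  (* Within the phase space the form vanishes only over q = F, and contraction towards 0 leaves that
     point because F <> 0. *)
  - intros x d [Hd H0] Hdd E. unfold kepler_form in *. simpl fst.
    assert (Pd : 0 < 1 - d < 1) by lra.
    assert (Nd : RtoC (1 - d) <> 0%C) by (intros Z; apply RtoC_inj in Z; lra).
    assert (Nq : (RtoC (1 - d) * fst x)%C <> 0%C) by now apply Cmult_neq_0.
    assert (Dq : unit_disc (RtoC (1 - d) * fst x)).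
    { unfold unit_disc in *. rewrite Cmod_mult, Cmod_R, Rabs_pos_eq by lra.
      pose proof (Cmod_ge_0 (fst x)). nra. }
    assert (NY : forall q, unit_disc q -> (1 - Cconj F * q)%C <> 0%C).
    { intros q Hq. apply Cmod_gt_0. pose proof (hyperbolic_gap_pos F q HF Hq).
      pose proof (Cmod_ge_0 (q - F)). lra. }
    split; [split; assumption|]. repeat apply Cmult_neq_0; try assumption; [|now apply NY].
    assert (EF : (F - fst x)%C = 0%C).
    { apply NNPP. intros N. revert E. repeat apply Cmult_neq_0; auto. }
    intros Z. apply HF0.
    assert (Fq : F = fst x) by (replace F with (F - fst x + fst x)%C by ring; rewrite EF; ring).
    rewrite <- Fq, RtoC_minus in Z. apply NNPP. intros N. apply (Cmult_neq_0 d F).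
    + intros Zd. apply RtoC_inj in Zd. lra.
    + exact N.
    + rewrite <- Z. ring.
  - intros q p p' H. exact H.
  - intros x x' Hel. apply kepler_elastic_iff in Hel.
    destruct Hel as ([Hd H0] & Hf & HWx & tau & Ht & E).
    assert (Hc : Im (kepler_form x * (Cconj tau * Cconj tau)) = 0)
      by exact (tangent_conic_form F HF HF0 W HW _ _ Ht).
    destruct (reflection_invariants _ _ _ _ (proj1 Ht) Hc E) as [R1 R2].
    rewrite !kepler_integral_form, Hf, R1.
    replace (kepler_form x') with (kepler_form x) by (unfold kepler_form; now rewrite Hf).
    now rewrite R2.
Qed.
End KeplerIntegral.


(** * The first integral of the Hooke billiards *)

Section HookeIntegral.
Variables (s f : R) (Hs : s * s = 1) (a : C).

(* Without the force, the product of the angular momenta about the two foci. *)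
Definition hooke_integral (x : state) : R :=
  let X := Re (fst x) in let Y := Im (fst x) in let U := Re (snd x) in let V := Im (snd x) in
  let c1 := Re a - s * (Re a * (X ^ 2 - Y ^ 2) + 2 * Im a * X * Y) in
  let c2 := Im a - s * (2 * Re a * X * Y - Im a * (X ^ 2 - Y ^ 2)) in
  (V * c1 - U * c2) ^ 2 - (1 - s * (Re a ^ 2 + Im a ^ 2)) ^ 2 * (X * V - Y * U) ^ 2 +
  32 * f * ((Re a * Y - Im a * X) ^ 2 / (1 - s * (X ^ 2 + Y ^ 2)) ^ 2).

Definition hooke_integral_q (x : state) : C :=
  let X := Re (fst x) in let Y := Im (fst x) in let U := Re (snd x) in let V := Im (snd x) in
  let c1 := Re a - s * (Re a * (X ^ 2 - Y ^ 2) + 2 * Im a * X * Y) in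
  let c2 := Im a - s * (2 * Re a * X * Y - Im a * (X ^ 2 - Y ^ 2)) in
  let P := V * c1 - U * c2 in let L := X * V - Y * U in let N := Re a * Y - Im a * X in
  let k := 1 - s * (Re a ^ 2 + Im a ^ 2) in let D := 1 - s * (X ^ 2 + Y ^ 2) in
  (2 * P * - s * (V * (2 * Re a * X + 2 * Im a * Y) - U * (2 * Re a * Y - 2 * Im a * X)) -
     2 * k ^ 2 * L * V + 32 * f * (- 2 * Im a * N / D ^ 2 + 4 * s * X * N ^ 2 / D ^ 3),
   2 * P * - s * (V * (2 * Im a * X - 2 * Re a * Y) - U * (2 * Re a * X + 2 * Im a * Y)) +
     2 * k ^ 2 * L * U + 32 * f * (2 * Re a * N / D ^ 2 + 4 * s * Y * N ^ 2 / D ^ 3)).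

Definition hooke_integral_p (x : state) : C :=
  let X := Re (fst x) in let Y := Im (fst x) in let U := Re (snd x) in let V := Im (snd x) in
  let c1 := Re a - s * (Re a * (X ^ 2 - Y ^ 2) + 2 * Im a * X * Y) in
  let c2 := Im a - s * (2 * Re a * X * Y - Im a * (X ^ 2 - Y ^ 2)) in
  let P := V * c1 - U * c2 in let L := X * V - Y * U in
  let k := 1 - s * (Re a ^ 2 + Im a ^ 2) in
  (- 2 * P * c2 + 2 * k ^ 2 * L * Y, 2 * P * c1 - 2 * k ^ 2 * L * X).

Lemma hooke_integral_gradient (x : state) : unit_disc (fst x) ->
  gradient_at hooke_integral x (hooke_integral_q x) (hooke_integral_p x).
Proof.
  intros Hx q p t dq dp Eq Ep Vq Vp. pose proof (curvature_cofactor_pos s Hs _ Hx) as PD.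
  rewrite <- Eq, Cmod2_alt in PD. clear Hx.
  destruct x as [q0 p0]. simpl in Eq, Ep. subst q0 p0.
  destruct Vq as [DX DY], Vp as [DU DV].
  unfold hooke_integral, hooke_integral_q, hooke_integral_p, inner. simpl fst. simpl snd.
  set (X := fun s => Re (q s)) in *. set (Y := fun s => Im (q s)) in *.
  set (U := fun s => Re (p s)) in *. set (V := fun s => Im (p s)) in *.
  eapply is_derive_ext with (fun r =>
    (V r * (Re a - s * (Re a * (X r ^ 2 - Y r ^ 2) + 2 * Im a * X r * Y r)) -
     U r * (Im a - s * (2 * Re a * X r * Y r - Im a * (X r ^ 2 - Y r ^ 2)))) ^ 2 -
    (1 - s * (Re a ^ 2 + Im a ^ 2)) ^ 2 * (X r * V r - Y r * U r) ^ 2 +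
    32 * f * ((Re a * Y r - Im a * X r) ^ 2 / (1 - s * (X r ^ 2 + Y r ^ 2)) ^ 2));
    [reflexivity|].
  change (Re (q t)) with (X t) in *. change (Im (q t)) with (Y t) in *.
  change (Re (p t)) with (U t) in *. change (Im (p t)) with (V t) in *.
  change (is_derive X t (Re dq)) in DX. change (is_derive Y t (Im dq)) in DY.
  change (is_derive U t (Re dp)) in DU. change (is_derive V t (Im dp)) in DV.
  clearbody X Y U V. simpl Re. simpl Im.
  auto_derive.
  - repeat match goal with |- _ /\ _ => split end; try (eexists; eassumption); try exact I.
    simpl. repeat apply Rmult_integral_contrapositive_currified; simpl in PD; lra.
  - replace (Derive (fun x : R => X x) t) with (Re dq) by (symmetry; now apply is_derive_unique).
    replace (Derive (fun x : R => Y x) t) with (Im dq) by (symmetry; now apply is_derive_unique).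
    replace (Derive (fun x : R => U x) t) with (Re dp) by (symmetry; now apply is_derive_unique).
    replace (Derive (fun x : R => V x) t) with (Im dp) by (symmetry; now apply is_derive_unique).
    unfold Re, Im. simpl. field. simpl in PD. lra.
Qed.

Definition hooke_form (x : state) : C :=
  ((square a - square (fst x)) * (1 - Cconj (square a) * square (fst x)))%C.

(** As for Kepler, the momentum enters only through the two reflection invariants. In the
    definition, c1 + i c2 is a - s (conj a) z^2, so that the kinetic part is a difference of squares
    P^2 - (k L)^2, with L the angular momentum about 0 and k = 1 - s |a|^2. *)
Lemma hooke_integral_form (x : state) :
  hooke_integral x =
  (- Re (hooke_form x * (Cconj (snd x) * Cconj (snd x))) +
   Cmod (snd x) ^ 2 * ((Cmod a ^ 2 - Cmod (fst x) ^ 2) * (1 - Cmod a ^ 2 * Cmod (fst x) ^ 2) +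
     4 * s * (Re a * Im (fst x) - Im a * Re (fst x)) ^ 2)) / 2 +
  32 * f * ((Re a * Im (fst x) - Im a * Re (fst x)) ^ 2 / (1 - s * Cmod (fst x) ^ 2) ^ 2).
Proof.
  rewrite !Cmod2_alt. unfold hooke_integral, hooke_form, square. cbv zeta.
  apply (f_equal (fun r => r + _)). destruct a, x as [[x y] [u v]]. simpl.
  destruct (sign_cases s Hs) as [-> | ->]; field.
Qed.

Lemma hooke_integrable (W : C -> Prop) : unit_disc a -> square a <> 0%C ->
  combination (conic_branch hyperbolic_density 0%C (square a)) W ->
  integrable (curvature_Hooke s f) (preimage W).
Proof.
  intros Ha Ha0 HW.
  apply (integrable_intro (curvature_Hooke s f) (preimage W) hooke_integral hooke_integral_q
    hooke_integral_p hooke_form (fun x => (1 + s * Cmod (fst x) ^ 2) ^ 2 / 4)).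
  - intros x Hx. now apply locally_unit_disc.
  - intros x Hx. now apply hooke_integral_gradient.
  - intros x Hx. pose proof (curvature_cofactor_pos s Hs _ Hx) as PD. rewrite Cmod2_alt in PD.
    pose proof (pow_lt _ 2 PD) as P2. pose proof (pow_lt _ 3 PD) as P3.
    apply continuous_C; unfold hooke_integral_q; cbv zeta; unfold Re, Im in *;
      cbn [fst snd]; complex_cont; lra.
  - intros x Hx.
    apply continuous_C; unfold hooke_integral_p; cbv zeta; unfold Re, Im in *;
      cbn [fst snd]; complex_cont.
  - intros x Hx. pose proof (curvature_cofactor_pos s Hs _ Hx) as PD.
    rewrite hooke_grad_p, hooke_grad_q by lra.
    unfold inner, hooke_integral_q, hooke_integral_p. cbv zeta. rewrite !Cmod2_alt in *.
    destruct a, x as [[x y] [u v]]. simpl in PD |- *.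
    destruct (sign_cases s Hs) as [E | E]; rewrite E in *; field; lra.
  - intros x Hx. pose proof (curvature_factor_pos s Hs _ Hx).
    apply Rdiv_lt_0_compat; [now apply pow_lt|lra].
  - intros x _. apply hooke_grad_p.
  - intros x _. unfold hooke_integral_p, hooke_form, square.
    destruct a, x as [[x y] [u v]]. simpl.
    destruct (sign_cases s Hs) as [-> | ->]; ring.
  - reflexivity.
  (* The form vanishes only where z^2 = a^2; the contraction multiplies z^2 by (1 - d)^2 < 1, which
     leaves this set because a^2 <> 0. *)
  - intros x d Hx Hd E. unfold hooke_form in *. simpl fst. unfold phase in Hx. simpl config in Hx.
    assert (Dq : unit_disc (RtoC (1 - d) * fst x)).
    { unfold unit_disc in *. rewrite Cmod_mult, Cmod_R, Rabs_pos_eq by lra.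
      pose proof (Cmod_ge_0 (fst x)). nra. }
    assert (NY : forall z, unit_disc z -> (1 - Cconj (square a) * square z)%C <> 0%C).
    { intros z Hz. apply unit_disc_square in Ha, Hz. apply Cmod_gt_0.
      pose proof (hyperbolic_gap_pos (square a) (square z) Ha Hz).
      pose proof (Cmod_ge_0 (square z - square a)). lra. }
    split; [exact Dq|]. apply Cmult_neq_0; [|now apply NY].
    assert (EF : (square a - square (fst x))%C = 0%C).
    { apply NNPP. intros N. revert E. apply Cmult_neq_0; auto. }
    intros Z. apply Ha0.
    assert (Fq : square a = square (fst x))
      by (replace (square a) with (square a - square (fst x) + square (fst x))%C by ring; rewrite EF; ring).
    apply NNPP. intros N. apply (Cmult_neq_0 (RtoC (1 - (1 - d) * (1 - d))) (square a)).
    + intros Zd. apply RtoC_inj in Zd. nra.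
    + exact N.
    + rewrite <- Z. rewrite Fq. unfold square. rewrite RtoC_minus, RtoC_mult. ring.
  - intros q p p' H. exact H.
  - intros x x' Hel. apply hooke_elastic_iff in Hel; [|exact Hs].
    destruct Hel as (Hd & Hf & HWx & tau & Ht & E).
    assert (Hc : Im (hooke_form x * (Cconj tau * Cconj tau)) = 0)
      by exact (tangent_centered_conic_form a W _ _ Ha Ha0 HW Ht).
    destruct (reflection_invariants _ _ _ _ (proj1 Ht) Hc E) as [R1 R2].
    rewrite !hooke_integral_form, Hf, R1.
    replace (hooke_form x') with (hooke_form x) by (unfold hooke_form; now rewrite Hf).
    now rewrite R2.
Qed.
End HookeIntegral.

Theorem proposition11 (m e : R) (F a : C) (W : C -> Prop)
    (hF : unit_disc F) (hF0 : F <> 0%C) (ha : square a = F)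
    (hW : combination (conic_branch hyperbolic_density 0%C F) W) :
  ((forall X, conic_branch hyperbolic_density 0%C F X ->
      conic spherical_density a (- a)%C (preimage X)) /\
   (forall Y, conic spherical_density a (- a)%C Y ->
      exists X, conic_branch hyperbolic_density 0%C F X /\
        forall z, Y z <-> preimage X z) /\
   midpoint spherical_density 0%C a (- a)%C /\
   combination (conic spherical_density a (- a)%C) (preimage W) /\
   conformally_transformed (hyperbolic_Kepler m) W e
     (spherical_Hooke (- (m + e))) (preimage W) (2 * m) /\
   (integrable (hyperbolic_Kepler m) W <->
    integrable (spherical_Hooke (- (m + e))) (preimage W)))
  /\
  ((forall X, conic_branch hyperbolic_density 0%C F X ->
      conic hyperbolic_density a (- a)%C (preimage X)) /\
   (forall Y, conic hyperbolic_density a (- a)%C Y ->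
      exists X, conic_branch hyperbolic_density 0%C F X /\
        forall z, Y z <-> preimage X z) /\
   midpoint hyperbolic_density 0%C a (- a)%C /\
   combination (conic hyperbolic_density a (- a)%C) (preimage W) /\
   conformally_transformed (hyperbolic_Kepler m) W e
     (hyperbolic_Hooke (m - e)) (preimage W) (2 * m) /\
   (integrable (hyperbolic_Kepler m) W <->
    integrable (hyperbolic_Hooke (m - e)) (preimage W))).
Proof.
  subst F. pose proof (proj1 (unit_disc_square a) hF) as Ha.
  pose proof (kepler_integrable m (square a) W hF hF0 hW) as HK.
  (* The constant - (s m + e) is - (m + e) for s = 1 and m - e for s = -1. *)
  assert (hooke : forall s, s * s = 1 ->
    conformally_transformed (hyperbolic_Kepler m) W e
      (curvature_Hooke s (- (s * m + e))) (preimage W) (2 * m) /\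
    (integrable (hyperbolic_Kepler m) W <->
     integrable (curvature_Hooke s (- (s * m + e))) (preimage W))).
  { intros s Hs. split; [now apply (square_map_conformal s m e Hs (square a))|].
    pose proof (hooke_integrable s (- (s * m + e)) Hs a W Ha hF0 hW). now split. }
  destruct (conic_correspondence a Ha _ (spherical_same_levels a Ha)) as [S1 S2].
  destruct (conic_correspondence a Ha _ (hyperbolic_same_levels a Ha)) as [H1 H2].
  split.
  - destruct (hooke 1 ltac:(ring)) as [C I]. rewrite Rmult_1_l, <- spherical_Hooke_curvature in C, I.
    split; [exact S1|]. split; [exact S2|]. split; [now apply spherical_midpoint|].
    split; [now apply (combination_preimage (square a))|]. now split.
  - destruct (hooke (-1) ltac:(ring)) as [C I].
    replace (- (-1 * m + e)) with (m - e) in C, I by ring.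
    rewrite <- hyperbolic_Hooke_curvature in C, I.
    split; [exact H1|]. split; [exact H2|]. split; [now apply hyperbolic_midpoint|].
    split; [now apply (combination_preimage (square a))|]. now split.
Qed.
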